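(* Let $x^{i,+}=f^i(x,u)$, $i=1,\ldots,n$, be a nonlinear time-invariant discrete-time system with $\dim(x)=n$, $\dim(u)=m$, smooth $f$ and $\mathrm{rank}(\partial_{(x,u)}f)=n$, considered locally around an equilibrium $(x_0,u_0)$, and let $P_1,P_2$ be the first two codistributions of the associated sequence described in the context. The system can be transformed by an invertible state transformation $(\bar x_1,\bar x_2)=\Phi_x(x)$ and an invertible input transformation $(\bar u_1,\bar u_2)=\Phi_u(x,u)$ into the triangular form $$\bar x_2^+=f_2(\bar x_2,\bar x_1,\bar u_2),\qquad \bar x_1^+=f_1(\bar x_2,\bar x_1,\bar u_2,\bar u_1)$$ with $\dim(\bar x_1)\ge 1$ and $\mathrm{rank}(\partial_{\bar u_1}f_1)=\dim(\bar x_1)$ if and only if $\dim(P_2)<\dim(P_1)$.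
   Context: All statements are local, in a suitable neighborhood of an equilibrium $(x_0,u_0)$, i.e. $f(x_0,u_0)=x_0$. Throughout, the dimensions of all considered distributions and codistributions and the ranks of all considered Jacobian matrices are assumed to be locally constant. Spans are over the ring of smooth functions. State and input transformations are local: $x\mapsto\Phi_x(x)$ is a local diffeomorphism and $u\mapsto\Phi_u(x,u)$ is locally invertible for fixed $x$, depending smoothly on $(x,u)$. The blocks $\bar x_2$ and $\bar u_2$ may be empty. Invariance: a codistribution $P$ is invariant w.r.t. a distribution $D$ if the Lie derivative $L_v\omega\in P$ for all 1-forms $\omega\in P$ and all vector fields $v\in D$. For any codistribution $P$ and distribution $D$ there is a unique codistribution of minimal dimension containing $P$ and invariant w.r.t. $D$; it is called the smallest such codistribution. Annihilator: $\mathrm{span}\{\mathrm{d}f\}^\perp$ is the distribution of all vector fields $v$ on the $(x,u)$-manifold with $v\rfloor \mathrm{d}f^i=0$, $i=1,\ldots,n$. Backward-shift: $\delta^{-1}(\omega_i(f(x,u))\,\mathrm{d}f^i)=\omega_i(x)\,\mathrm{d}x^i$; for a codistribution having a basis of 1-forms of the form $\omega_i(f(x,u))\mathrm{d}f^i$, its backward-shift is the codistribution spanned by the backward-shifts of these 1-forms. Sequence of codistributions (on the $(n+m)$-dimensional manifold $\mathcal{X}\times\mathcal{U}$ with coordinates $(x,u)$): start with $P_1=\mathrm{span}\{\mathrm{d}x\}$ and for $k\ge 1$ repeat: (1) compute $P_k\cap\mathrm{span}\{\mathrm{d}f\}$; (2) let $P_{k+1}^+$ be the smallest codistribution which is invariant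 w.r.t. $\mathrm{span}\{\mathrm{d}f\}^\perp$ and contains $P_k\cap\mathrm{span}\{\mathrm{d}f\}$ (it always has a local basis of 1-forms $\omega_i(f(x,u))\mathrm{d}f^i$); (3) set $P_{k+1}=\delta^{-1}(P_{k+1}^+)$. Stop if $P_{\bar k+1}=P_{\bar k}$ for some $k=\bar k$. *)

(* Defs.v *)
(* MathComp-Analysis *)
From HB Require Import structures.
From mathcomp Require Import all_boot all_order all_algebra.
From mathcomp Require Import all_classical all_reals all_analysis.
Import Order.TTheory GRing.Theory Num.Theory.
Import numFieldNormedType.Exports.

Set Implicit Arguments.
Unset Strict Implicit.
Unset Printing Implicit Defensive.

Local Open Scope classical_set_scope.
Local Open Scope ring_scope.

(* A local object around a point z0 (function, 1-form, vector field) is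
   represented by a total function of which only the germ at z0 matters. *)

Section Smooth.
Context {R : realType}.

Fixpoint Ck {V W : normedModType R} (k : nat) (A : set V) (f : V -> W) : Prop :=
  match k with
  | 0 => forall x, A x -> {for x, continuous f}
  | k'.+1 => (forall x, A x -> differentiable f x) /\
             forall v, Ck k' A (fun x => 'D_v f x)
  end.

(* One neighborhood serves for all orders of differentiation. *)
Definition smooth_near {V W : normedModType R} (x0 : V) (f : V -> W) : Prop :=
  exists A : set V, [/\ open A, A x0 & forall k, Ck k A f].

Definition local_diffeo {V W : normedModType R} (x0 : V) (Phi : V -> W)
  : Prop :=
  smooth_near x0 Phi /\
  exists Psi : W -> V,
    [/\ smooth_near (Phi x0) Psi,
        \forall x \near x0, Psi (Phi x) = x &
        \forall y \near Phi x0, Phi (Psi y) = y].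

End Smooth.

Section Forms.
Context {R : realType}.

(* In coordinates, 1-forms and vector fields on R^N are both row-vector-valued
   functions: w stands for \sum_i w_i dz^i and v for \sum_i v^i d/dz^i. *)
Definition contraction N (v w : 'rV[R]_N -> 'rV[R]_N) (z : 'rV[R]_N) : R :=
  \sum_(i < N) v z 0 i * w z 0 i.

Definition dform N (h : 'rV[R]_N -> R^o) (z : 'rV[R]_N) : 'rV[R]_N :=
  \row_(j < N) 'D_(delta_mx 0 j) h z.

(* (L_v w)_j = \sum_i v^i dw_j/dz^i + \sum_i w_i dv^i/dz^j;
   ['J v z] has dv^i/dz^j in row j and column i. *)
Definition Lie_derivative N (v w : 'rV[R]_N -> 'rV[R]_N) (z : 'rV[R]_N)
  : 'rV[R]_N := v z *m 'J w z + w z *m ('J v z)^T.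

(* w |-> \sum_i w_i(g(z)) dg^i *)
Definition pullback N n (g : 'rV[R]_N -> 'rV[R]_n) (w : 'rV[R]_n -> 'rV[R]_n)
    (z : 'rV[R]_N) : 'rV[R]_N :=
  \sum_(i < n) w (g z) 0 i *: dform (fun z => g z 0 i) z.

(* Submodules, over the ring of germs at z0 of smooth functions, of the module
   of germs at z0 of smooth 1-forms. *)
Definition codistribution N (z0 : 'rV[R]_N) (P : set ('rV[R]_N -> 'rV[R]_N))
  : Prop :=
  [/\ forall w, P w -> smooth_near z0 w,
      P (fun=> 0),
      forall w w', P w -> P w' -> P (fun z => w z + w' z),
      forall (g : 'rV[R]_N -> R^o) w, smooth_near z0 g -> P w ->
        P (fun z => g z *: w z) &
      forall w w', P w -> (\forall z \near z0, w z = w' z) -> P w'].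

Definition codist_span N (z0 : 'rV[R]_N) (B : set ('rV[R]_N -> 'rV[R]_N)) :=
  smallest (codistribution z0) B.

(* P has locally constant dimension r around z0: it has a local basis of r
   1-forms that are linearly independent at every point near z0. *)
Definition has_dim N (z0 : 'rV[R]_N) (P : set ('rV[R]_N -> 'rV[R]_N)) (r : nat)
  : Prop :=
  exists b : 'I_r -> 'rV[R]_N -> 'rV[R]_N,
    [/\ forall i, smooth_near z0 (b i),
        \forall z \near z0, row_free (\matrix_(i < r) b i z) &
        P = codist_span z0 (range b)].

Definition annihilator N (z0 : 'rV[R]_N) (P : set ('rV[R]_N -> 'rV[R]_N)) :=
  [set v : 'rV[R]_N -> 'rV[R]_N | smooth_near z0 v /\
    forall w, P w -> \forall z \near z0, contraction v w z = 0].

Definition invariant_codist N (D P : set ('rV[R]_N -> 'rV[R]_N)) : Prop :=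
  forall v w, D v -> P w -> P (Lie_derivative v w).

(* When it has locally constant dimension, this intersection of all invariant
   codistributions containing P is the one of minimal dimension. *)
Definition smallest_invariant N (z0 : 'rV[R]_N)
    (D P : set ('rV[R]_N -> 'rV[R]_N)) :=
  smallest (fun Q => codistribution z0 Q /\ invariant_codist D Q) P.

End Forms.

Section System.
Context {R : realType} (n m : nat).
(* The point (x, u) is [row_mx x u]; the coordinates of z are x = [lsubmx z]
   and u = [rsubmx z]. *)

Definition dx (i : 'I_n) : 'rV[R]_(n + m) -> 'rV[R]_(n + m) :=
  dform (fun z => lsubmx z 0 i).

Definition df (f : 'rV[R]_(n + m) -> 'rV[R]_n) (i : 'I_n)
  : 'rV[R]_(n + m) -> 'rV[R]_(n + m) :=
  dform (fun z => f z 0 i).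

Definition span_dx (z0 : 'rV[R]_(n + m)) := codist_span z0 (range dx).

Definition span_df (f : 'rV[R]_(n + m) -> 'rV[R]_n)
    (z0 : 'rV[R]_(n + m)) := codist_span z0 (range (df f)).

(* Spanned by the w_i(x) dx^i such that w_i(f(x,u)) df^i lies in P; the w_i are
   functions near f(z0), which is x0 at an equilibrium. *)
Definition backward_shift (f : 'rV[R]_(n + m) -> 'rV[R]_n)
    (z0 : 'rV[R]_(n + m)) (P : set ('rV[R]_(n + m) -> 'rV[R]_(n + m))) :=
  codist_span z0
    [set pullback (fun z => lsubmx z) w |
      w in [set w : 'rV[R]_n -> 'rV[R]_n |
             smooth_near (f z0) w /\ P (pullback f w)]].

Definition next_plus (f : 'rV[R]_(n + m) -> 'rV[R]_n)
    (z0 : 'rV[R]_(n + m)) (P : set ('rV[R]_(n + m) -> 'rV[R]_(n + m))) :=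
  smallest_invariant z0 (annihilator z0 (span_df f z0)) (P `&` span_df f z0).

(* [codist_seq f z0 k] is P_(k+1). *)
Fixpoint codist_seq (f : 'rV[R]_(n + m) -> 'rV[R]_n)
    (z0 : 'rV[R]_(n + m)) (k : nat)
  : set ('rV[R]_(n + m) -> 'rV[R]_(n + m)) :=
  match k with
  | 0 => span_dx z0
  | k'.+1 => backward_shift f z0 (next_plus f z0 (codist_seq f z0 k'))
  end.

(* The dimension of the intersection of span{dx} and span{df} is locally
   constant, the intersection being taken in each cotangent space. This does
   not follow from the intersection of the two modules having a local basis:
   for f = x + u^3 that module is 0, but the fibers meet in a line at u = 0. *)
Definition locally_constant_dim_dx_cap_df (f : 'rV[R]_(n + m) -> 'rV[R]_n)
    (z0 : 'rV[R]_(n + m)) : Prop :=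
  let cap z := (\matrix_(i < n) dx i z :&: \matrix_(i < n) df f i z)%MS in
  \forall z \near z0, \rank (cap z) = \rank (cap z0).

Definition input_transformation m' (x0 : 'rV[R]_n) (u0 : 'rV[R]_m)
    (Phiu : 'rV[R]_(n + m) -> 'rV[R]_m') : Prop :=
  let z0 := row_mx x0 u0 in
  let w0 := row_mx x0 (Phiu z0) in
  smooth_near z0 Phiu /\
  exists Psiu : 'rV[R]_(n + m') -> 'rV[R]_m,
    [/\ smooth_near w0 Psiu,
        \forall z \near z0, Psiu (row_mx (lsubmx z) (Phiu z)) = rsubmx z &
        \forall w \near w0, Phiu (row_mx (lsubmx w) (Psiu w)) = rsubmx w].

(* With xb = Phi_x(x) = (xb1, xb2) and ub = Phi_u(x,u) = (ub1, ub2):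
     xb2+ = f2(xb2, xb1, ub2),   xb1+ = f1(xb2, xb1, ub2, ub1).
   [dsubmx ('J f1 p)] is the (transposed) Jacobian of f1 with respect to ub1,
   the last block of arguments. *)
Definition transformable_to_triangular_form
    (f : 'rV[R]_(n + m) -> 'rV[R]_n) (x0 : 'rV[R]_n) (u0 : 'rV[R]_m)
  : Prop :=
  let z0 := row_mx x0 u0 in
  exists (n1 n2 m1 m2 : nat)
    (Phix : 'rV[R]_n -> 'rV[R]_(n1 + n2))
    (Phiu : 'rV[R]_(n + m) -> 'rV[R]_(m1 + m2))
    (f2 : 'rV[R]_(n2 + n1 + m2) -> 'rV[R]_n2)
    (f1 : 'rV[R]_(n2 + n1 + m2 + m1) -> 'rV[R]_n1),
  let xb1 z := lsubmx (Phix (lsubmx z)) in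
  let xb2 z := rsubmx (Phix (lsubmx z)) in
  let ub1 z := lsubmx (Phiu z) in
  let ub2 z := rsubmx (Phiu z) in
  let arg2 z := row_mx (row_mx (xb2 z) (xb1 z)) (ub2 z) in
  let arg1 z := row_mx (arg2 z) (ub1 z) in
  [/\ [/\ (n1 + n2 = n)%N, (m1 + m2 = m)%N & (1 <= n1)%N],
      local_diffeo x0 Phix /\ input_transformation x0 u0 Phiu,
      smooth_near (arg2 z0) f2 /\ smooth_near (arg1 z0) f1,
      \forall z \near z0,
        rsubmx (Phix (f z)) = f2 (arg2 z) /\
        lsubmx (Phix (f z)) = f1 (arg1 z) &
      \forall p \near arg1 z0, \rank (dsubmx ('J f1 p)) = n1].

End System.

(* Main.v *)
Require Import Defs.
From HB Require Import structures.
From mathcomp Require Import all_boot all_order all_algebra.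
From mathcomp Require Import all_classical all_reals all_analysis.
From mathcomp Require Import lra ring.
Import Order.TTheory GRing.Theory Num.Theory.
Import numFieldNormedType.Exports.

Set Implicit Arguments.
Unset Strict Implicit.
Unset Printing Implicit Defensive.

Local Open Scope classical_set_scope.
Local Open Scope ring_scope.

(* With row vectors, 'D_v f z = v *m 'J f z, and f_u denotes the lower block of
   'J f z.  A form b df lies in span{dx} exactly when b kills f_u, that is when
   b f_u^T = 0; call these b the left kernel at z.

   Necessity: in the triangular form the forms lying pointwise in
   span{d(xbar_2 o f)} make up an invariant codistribution (by Schwarz), and it
   contains span{dx} /\ span{df} because f_1 is submersive in ubar_1.  Hence it
   contains P_2^+, and pulling back along a section of f gives
   dim P_2 <= dim xbar_2 < n.

   Sufficiency, without Frobenius' theorem: let r < n be the dimension of P_2^+.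
   By invariance and Gronwall along the fibres of f, the coefficients of P_2^+
   span a space depending on f z only; so the left kernels at the points of one
   fibre, close to z0, span at most r dimensions, and by minimality of P_2^+
   some points z_i, as close to z0 as wanted, and some left kernel vectors al_i
   at z_i reach r.  By constant rank the equation x^+ = f(x,u), solvable in u,
   becomes h(x,y) = 0.  Following sections xi_i of f through the z_i, the
   equations h(xi_i(y0 + t P), y) al_i^T = 0 define t = psi(y), and a frame W(y)
   spans the common annihilator of the left kernels over y.  As W h_y = O(h), a
   Gronwall argument along the level sets of psi makes h(xi_i(y0 + psi(y) P), y)
   vanish, and therefore W psi' = 0.  Since the rows of W(f z) are combinations of those
   of f_u, the component of x^+ transverse to psi can be taken as ubar_1, and
   psi o f then depends on x and on the complementary inputs only. *)

(** The obstacle is integrability: the rows of [W] span a distribution, and functions psi with W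
    psi' = 0 are wanted. Its leaves can be guessed, because they consist of reachable states. For
    fixed x the states f(x,u) form a submanifold whose tangent space is the row space of f_u;
    intersecting these spaces over r suitable points of a fibre leaves the span of [W]. So the leaf
    through y0 + t P should be the set of all y reachable from each of the r states xi_i(y0 + t P),
    with t as its label. Reachability from one state means the n equations h = 0. Keeping one
    combination for each i, chosen by al_i, leaves as many equations as labels, and the Gronwall
    argument recovers the discarded ones.

    The equation is h(x,y) = y - f(Z(x,y)), where Z(x,y) = (x,u) selects an input. On the graph of f
    the matrix h_y^T fixes left kernel vectors, and a point v is moved to the graph by changing y by
    h v alone; this is the source of W h_y = O(h).

    The fibres of f and the level sets of psi are handled by one lemma: a linear bound on
    derivatives along a fibre propagates zeros. *)

Section Calculus.
Context {R : realType}.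
Implicit Types V W U : normedModType R.

(** The candidate differential comes with the estimate, so existence and value are obtained
    together; the derivative of a local inverse is found this way. *)
Lemma differentiable_eps V W (f : V -> W) (x : V) (L : {linear V -> W}) :
  continuous L ->
  (forall e : R, 0 < e ->
     \forall h \near 0, `|f (h + x) - f x - L h| <= e * `|h|) ->
  differentiable f x /\ 'd f x = L :> (V -> W).
Proof.
move=> Lc fL.
have fE : f \o shift x = cst (f x) + L +o_ 0 id.
  by apply/eqaddoP => e e0; near=> h; rewrite !fctE /= opprD addrA;
     near: h; exact: fL.
have dE := diff_unique Lc fE.
by split=> //; apply/diff_locallyP; rewrite dE.
Unshelve. all: by end_near. Qed.

Lemma near_eq_differentiable V W (f g : V -> W) (x : V) :
  (\forall y \near x, f y = g y) -> differentiable f x ->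
  differentiable g x /\ 'd g x = 'd f x :> (V -> W).
Proof.
move=> fg df; apply: differentiable_eps; first exact: diff_continuous.
move=> e e0.
have gfx := nbhs_singleton fg.
have /eqaddoP /(_ _ e0) fe := diff_locally df.
have : \forall h \near 0, f (h + x) = g (h + x).
  by move: fg; rewrite (near_shift 0) subr0.
move=> fg0; near=> h; rewrite -(near fg0 h) // -gfx.
suff : `|(f \o shift x - (cst (f x) + 'd f x)) h| <= e * `|h|.
  by rewrite !fctE /= opprD addrA.
by near: h.
Unshelve. all: by end_near. Qed.

Lemma deriveDir V W (f : V -> W) (x v w : V) (a : R) : differentiable f x ->
  'D_(a *: v + w) f x = a *: 'D_v f x + 'D_w f x.
Proof. by move=> df; rewrite !deriveE // linearP. Qed.

Lemma derive_comp V W U (f : V -> W) (g : W -> U) (x v : V) :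
  differentiable f x -> differentiable g (f x) ->
  'D_v (fun y => g (f y)) x = 'D_('D_v f x) g (f x).
Proof.
move=> df dg; rewrite !deriveE //; last exact: differentiable_comp.
by rewrite (diff_comp df dg).
Qed.

Lemma derive_linear V W U (f : V -> W) (L : {linear W -> U}) (x v : V) :
  continuous L -> differentiable f x ->
  'D_v (fun y => L (f y)) x = L ('D_v f x).
Proof.
move=> Lc df; have dL : differentiable L (f x) by exact: linear_differentiable.
by rewrite derive_comp // deriveE // diff_lin.
Qed.

Lemma is_diff_affine (V : normedModType R) (z v : V) (t : R) :
  is_diff t (fun s : R => z + s *: v) (fun s : R => s *: v).
Proof.
have : is_diff t (cst z + ( *:%R ^~ v : R -> V)) (0 + ( *:%R ^~ v : R -> V)).
  exact: is_diffD.
by rewrite add0r.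
Qed.

Lemma derive_affine (V : normedModType R) (z v : V) (t s : R) :
  'D_s (fun s : R => z + s *: v) t = s *: v.
Proof. by have dl := is_diff_affine z v t; rewrite deriveE // diff_val. Qed.

Lemma mvt_segment (V : normedModType R) (f : V -> R^o) (z v : V) :
  (forall t : R, 0 <= t <= 1 -> differentiable f (z + t *: v)) ->
  exists c : R, 0 <= c <= 1 /\ f (z + v) - f z = 'D_v f (z + c *: v).
Proof.
move=> df.
pose phi := fun t : R => f (z + t *: v) : R.
have dphi (t : R) : 0 <= t <= 1 -> is_derive t 1 phi ('D_v f (z + t *: v)).
  move=> t01; have dl := is_diff_affine z v t.
  apply: DeriveDef.
    apply/derivable1_diffP; apply: differentiable_comp => //; exact: df.
  have -> := derive_comp (f := fun s : R => z + s *: v) 1 _ (df t t01) => //.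
  by rewrite derive_affine scale1r.
have [|t|c] := @MVT_segment R phi (fun t => 'D_v f (z + t *: v)) 0 1 ler01.
- by move=> t; rewrite in_itv /= => /andP[t0 t1]; apply: dphi; rewrite !ltW.
- apply: derivable_within_continuous => {}t; rewrite in_itv /= => t01.
  by have [] := dphi t t01.
rewrite in_itv /= => c01; rewrite subr0 mulr1 /phi scale1r scale0r addr0 => E.
by exists c.
Qed.

(** * Smooth functions *)

Lemma Ck_weak V W k (A : set V) (f : V -> W) : Ck k.+1 A f -> Ck k A f.
Proof.
elim: k f => [|k IH] f /= [df Df].
  by move=> x Ax; exact/differentiable_continuous/df.
by split=> // v; apply: IH; exact: Df.
Qed.

Lemma Ck_eq V W k (A : set V) (f g : V -> W) : open A ->
  (forall x, A x -> f x = g x) -> Ck k A f -> Ck k A g.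
Proof.
move=> Ao; elim: k f g => [|k IH] f g fg /=.
all: have fgn x : A x -> \forall y \near x, f y = g y
  by move=> Ax; have := open_nbhs_nbhs (conj Ao Ax); apply: filterS => y /fg.
  move=> cf x Ax; have := cf x Ax.
  rewrite /prop_for /continuous_at (fg x Ax); apply: cvg_trans.
  exact/near_eq_cvg/(filterS _ (fgn x Ax)).
move=> [df Df]; split.
  by move=> x Ax; have [] := near_eq_differentiable (fgn x Ax) (df x Ax).
by move=> v; apply: IH (Df v) => x Ax; exact/near_eq_derive/fgn.
Qed.

Lemma CkS V W k (A B : set V) (f : V -> W) : A `<=` B -> Ck k B f -> Ck k A f.
Proof.
move=> AB; elim: k f => [|k IH] f /=; first by move=> cf x /AB; exact: cf.
by move=> [df Df]; split=> [x /AB|v]; [exact: df|exact: IH].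
Qed.

Lemma Ck_cst V W k (A : set V) (w : W) : Ck k A (fun=> w).
Proof.
elim: k w => [|k IH] w /=; first by move=> x _; exact: cst_continuous.
split=> [x _|v]; first exact: differentiable_cst.
by rewrite (_ : 'D_v (fun=> w) = fun=> 0)//; apply/funext => x; rewrite derive_cst.
Qed.

Lemma Ck_lin V W U k (A : set V) (f : V -> W) (L : {linear W -> U}) :
  open A -> continuous L -> Ck k A f -> Ck k A (fun x => L (f x)).
Proof.
move=> Ao Lc; elim: k f => [|k IH] f /=.
  by move=> cf x Ax; apply: continuous_comp; [exact: cf|exact: Lc].
move=> [df Df]; split=> [x Ax|v].
  by apply: differentiable_comp; [exact: df|exact: linear_differentiable].
apply: (Ck_eq (f := fun x => L ('D_v f x))) => //; last exact/IH/Df.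
by move=> x Ax; rewrite derive_linear //; exact: df.
Qed.

Lemma Ck_add V W k (A : set V) (f g : V -> W) :
  open A -> Ck k A f -> Ck k A g -> Ck k A (fun x => f x + g x).
Proof.
move=> Ao; elim: k f g => [|k IH] f g /=.
  by move=> cf cg x Ax; apply: continuousD; [exact: cf|exact: cg].
move=> [df Df] [dg Dg]; split=> [x Ax|v].
  by apply: differentiableD; [exact: df|exact: dg].
apply: (Ck_eq (f := fun x => 'D_v f x + 'D_v g x)) => //; last exact: IH.
by move=> x Ax; rewrite deriveD //; apply: diff_derivable; [exact: df|exact: dg].
Qed.

Lemma Ck_mul V k (A : set V) (f g : V -> R^o) :
  open A -> Ck k A f -> Ck k A g -> Ck k A (fun x => f x * g x : R^o).
Proof.
move=> Ao; elim: k f g => [|k IH] f g.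
  by move=> cf cg x Ax; apply: continuousM; [exact: cf|exact: cg].
move=> Cf Cg; have [df Df] := Cf; have [dg Dg] := Cg; split=> [x Ax|v].
  by apply: differentiableM; [exact: df|exact: dg].
apply: (Ck_eq (f := fun x => f x * 'D_v g x + g x * 'D_v f x)) => //.
  by move=> x Ax; rewrite deriveM //; apply: diff_derivable;
    [exact: df|exact: dg].
have [Cf' Cg'] := (Ck_weak Cf, Ck_weak Cg).
exact: (Ck_add Ao (IH _ _ Cf' (Dg v)) (IH _ _ Cg' (Df v))).
Qed.

Lemma Ck_inv V k (A : set V) (f : V -> R^o) :
  open A -> (forall x, A x -> f x != 0) -> Ck k A f ->
  Ck k A (fun x => (f x)^-1 : R^o).
Proof.
move=> Ao f0; elim: k f f0 => [|k IH] f f0.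
  by move=> cf x Ax; apply: cvgV; [exact: f0|exact: cf].
move=> Cf; have [df Df] := Cf; split=> [x Ax|v].
  by apply: differentiableV; [exact: df|exact: f0].
pose g x : R^o := - 1 * ((f x)^-1 * (f x)^-1 * 'D_v f x).
apply: (Ck_eq (f := g)) => //.
  move=> x Ax; rewrite deriveV ?f0 //; last exact/diff_derivable/df.
  by rewrite /g mulN1r /GRing.scale /= mulNr expr2 invfM.
have Ci := IH f f0 (Ck_weak Cf).
exact: (Ck_mul Ao (Ck_cst _ _ _) (Ck_mul Ao (Ck_mul Ao Ci Ci) (Df v))).
Qed.

End Calculus.

(** * Closure properties of germs of smooth functions and the calculus of Jacobians *)

Section SmoothNear.
Context {R : realType}.
Implicit Types V W U : normedModType R.

(** Taking an entry is given a name so that it can carry the linear structure expected by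
    [smooth_near_lin] and [Ck_lin]. *)
Definition coordmx p q (i : 'I_p) (j : 'I_q) (M : 'M[R]_(p, q)) : R^o := M i j.

Lemma coordmx_is_linear p q (i : 'I_p) (j : 'I_q) : linear (coordmx i j).
Proof. by move=> a A B; rewrite /coordmx !mxE. Qed.

HB.instance Definition _ p q (i : 'I_p) (j : 'I_q) :=
  GRing.isLinear.Build R 'M[R]_(p, q) R^o _ (coordmx i j)
    (coordmx_is_linear i j).

Lemma continuous_coordmx p q (i : 'I_p) (j : 'I_q) : continuous (coordmx i j).
Proof. exact: coord_continuous. Qed.

Lemma continuous_sum_seq V W (I : Type) (r : seq I) (F : I -> V -> W) :
  (forall i, continuous (F i)) -> continuous (fun x => \sum_(i <- r) F i x).
Proof.
move=> Fc; elim: r => [|i r IH].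
  by under eq_fun do rewrite big_nil; exact: cst_continuous.
under eq_fun do rewrite big_cons.
by move=> x; apply: continuousD; [exact: Fc|exact: IH].
Qed.

Lemma continuous_linear_mx p q W (L : {linear 'M[R]_(p, q) -> W}) :
  continuous L.
Proof.
have -> : L = (fun M => \sum_i \sum_j M i j *: L (delta_mx i j)) :> (_ -> _).
  apply/funext => M; rewrite {1}[M]matrix_sum_delta linear_sum.
  by apply: eq_bigr => i _; rewrite linear_sum; apply: eq_bigr => j _;
     rewrite linearZ.
apply: continuous_sum_seq => i; apply: continuous_sum_seq => j M.
have c1 : {for M, continuous (fun x : 'M[R]_(p, q) => x i j)} :=
  @coord_continuous R p q i j M.
exact: (continuous_comp c1 (@scalel_continuous _ _ _ (M i j))).
Qed.

(** The open set that witnesses smoothness serves all of its points. This is what allows a germ to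
    be differentiated again at nearby points in the [near] arguments. *)
Lemma smooth_near_open V W z (f : V -> W) :
  smooth_near z f -> \forall y \near z, smooth_near y f.
Proof.
move=> [A [Ao Az fA]]; have := open_nbhs_nbhs (conj Ao Az).
by apply: filterS => y Ay; exists A.
Qed.

Lemma smooth_near_diff V W z (f : V -> W) :
  smooth_near z f -> differentiable f z.
Proof. by move=> [A [Ao Az /(_ 1%N) [df _]]]; exact: df. Qed.

Lemma smooth_near_cont V W z (f : V -> W) :
  smooth_near z f -> {for z, continuous f}.
Proof. by move=> /smooth_near_diff/differentiable_continuous. Qed.

Lemma smooth_near_eq V W z (f g : V -> W) :
  (\forall y \near z, f y = g y) -> smooth_near z f -> smooth_near z g.
Proof.
move=> fg [A [Ao Az fA]].
exists (A `&` [set y | f y = g y]^°); split.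
- exact: openI Ao (open_interior _).
- by split=> //; exact: fg.
move=> k; apply: (@Ck_eq _ _ _ k _ f).
- exact: openI Ao (open_interior _).
- by move=> x [_ /interior_subset].
- by apply: CkS (fA k); exact: subIsetl.
Qed.

Lemma smooth_near_derive V W z (f : V -> W) v :
  smooth_near z f -> smooth_near z (fun x => 'D_v f x).
Proof.
move=> [A [Ao Az fA]]; exists A; split=> // k.
by have [_] := fA k.+1; exact.
Qed.

Lemma smooth_near_cst V W z (w : W) : smooth_near z (fun _ : V => w).
Proof. by exists setT; split=> // [|k]; [exact: openT|exact: Ck_cst]. Qed.

Lemma smooth_near_lin V W U z (f : V -> W) (L : {linear W -> U}) :
  continuous L -> smooth_near z f -> smooth_near z (fun x => L (f x)).
Proof.
by move=> Lc [A [Ao Az fA]]; exists A; split=> // k; apply: Ck_lin.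
Qed.

Let smooth2 V W1 W2 W z (op : W1 -> W2 -> W) (f : V -> W1) (g : V -> W2) :
  (forall k A f g, open A -> Ck k A f -> Ck k A g ->
     Ck k A (fun x : V => op (f x) (g x))) ->
  smooth_near z f -> smooth_near z g -> smooth_near z (fun x => op (f x) (g x)).
Proof.
move=> H [A [Ao Az fA]] [B [Bo Bz gB]]; exists (A `&` B).
split=> // [|k]; first exact: openI.
by apply: H; [exact: openI|apply: CkS (fA k)|apply: CkS (gB k)] => x [].
Qed.

Lemma smooth_near_add V W z (f g : V -> W) :
  smooth_near z f -> smooth_near z g -> smooth_near z (fun x => f x + g x).
Proof. by apply: smooth2 => k A f' g'; exact: Ck_add. Qed.

Lemma smooth_near_mul V z (f g : V -> R^o) :
  smooth_near z f -> smooth_near z g ->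
  smooth_near z (fun x => f x * g x : R^o).
Proof. by apply: (@smooth2 _ R^o R^o R^o) => k A f' g'; exact: Ck_mul. Qed.

Lemma smooth_near_opp V W z (f : V -> W) :
  smooth_near z f -> smooth_near z (fun x => - f x).
Proof.
move=> sf; have := @smooth_near_lin V W W z f (GRing.opp : {linear W -> W}).
by apply => //; exact: opp_continuous.
Qed.

Lemma smooth_near_sub V W z (f g : V -> W) :
  smooth_near z f -> smooth_near z g -> smooth_near z (fun x => f x - g x).
Proof. by move=> sf sg; exact: smooth_near_add sf (smooth_near_opp sg). Qed.

Lemma smooth_near_id V z : smooth_near z (fun x : V => x).
Proof.
exists setT; split=> // [|[|k]]; first exact: openT.
  by move=> x _; exact: cvg_id.
split=> [x _|v]; first by have [] := is_diff_id x.
rewrite (_ : 'D_v _ = fun=> v); first exact: Ck_cst.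
by apply/funext => x; rewrite derive_id.
Qed.

Lemma smooth_near_sum V W z (I : Type) (r : seq I) (P : pred I)
    (F : I -> V -> W) : (forall i, P i -> smooth_near z (F i)) ->
  smooth_near z (fun x => \sum_(i <- r | P i) F i x).
Proof.
move=> sF; elim: r => [|i r IH].
  rewrite (_ : (fun x => _) = fun=> 0); first exact: smooth_near_cst.
  by apply/funext => x; rewrite big_nil.
case: (boolP (P i)) => Pi; last first.
  by apply: smooth_near_eq IH; near=> x; rewrite big_cons (negPf Pi).
have := smooth_near_add (sF i Pi) IH; apply: smooth_near_eq.
by near=> x; rewrite big_cons Pi.
Unshelve. all: by end_near. Qed.

Lemma smooth_near_prod V z (I : Type) (r : seq I) (P : pred I)
    (F : I -> V -> R^o) : (forall i, P i -> smooth_near z (F i)) ->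
  smooth_near z (fun x => \prod_(i <- r | P i) F i x : R^o).
Proof.
move=> sF; elim: r => [|i r IH].
  rewrite (_ : (fun x => _) = fun=> 1); first exact: smooth_near_cst.
  by apply/funext => x; rewrite big_nil.
case: (boolP (P i)) => Pi; last first.
  by apply: smooth_near_eq IH; near=> x; rewrite big_cons (negPf Pi).
have := smooth_near_mul (sF i Pi) IH; apply: smooth_near_eq.
by near=> x; rewrite big_cons Pi.
Unshelve. all: by end_near. Qed.

Lemma smooth_near_inv V z (f : V -> R^o) : f z != 0 -> smooth_near z f ->
  smooth_near z (fun x => (f x)^-1 : R^o).
Proof.
move=> fz0 sf; have [A [Ao Az fA]] := sf.
have fn0 : \forall y \near z, f y != 0.
  by have := smooth_near_cont sf => /cvgr_neq0; apply.
exists (A `&` [set y | f y != 0]^°); split.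
- exact: openI Ao (open_interior _).
- by split=> //; exact: fn0.
move=> k; apply: Ck_inv.
- exact: openI Ao (open_interior _).
- by move=> x [_ /interior_subset].
- by apply: CkS (fA k); exact: subIsetl.
Qed.

Lemma smooth_near_mxP V p q z (M : V -> 'M[R]_(p, q)) :
  smooth_near z M <-> forall i j, smooth_near z (fun x => M x i j : R^o).
Proof.
split=> [sM i j|sM].
  exact: (smooth_near_lin (@continuous_coordmx p q i j) sM).
have : smooth_near z (fun x => \sum_i \sum_j M x i j *: delta_mx i j).
  apply: smooth_near_sum => i _; apply: smooth_near_sum => j _.
  pose L := fun a : R^o => a *: (delta_mx i j : 'M[R]_(p, q)).
  have Ll : linear L by move=> a x y; rewrite /L scalerDl scalerA.
  pose LM := GRing.isLinear.Build _ _ _ _ _ Ll.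
  pose LL : {linear R^o -> 'M[R]_(p, q)} := HB.pack L LM.
  apply: (@smooth_near_lin _ _ _ _ (fun x => M x i j) LL) => //.
  exact: scalel_continuous.
by apply: smooth_near_eq; near=> x; rewrite -matrix_sum_delta.
Unshelve. all: by end_near. Qed.

Lemma smooth_near_entries V p q z (M : V -> 'M[R]_(p, q))
    (F : 'I_p -> 'I_q -> V -> R^o) :
  (forall x i j, M x i j = F i j x) -> (forall i j, smooth_near z (F i j)) ->
  smooth_near z M.
Proof.
move=> MF sF; apply/smooth_near_mxP => i j; apply: smooth_near_eq (sF i j).
by near=> x; rewrite MF.
Unshelve. all: by end_near. Qed.

Lemma smooth_near_mulmx V p q r z (A : V -> 'M[R]_(p, q))
    (B : V -> 'M[R]_(q, r)) :
  smooth_near z A -> smooth_near z B -> smooth_near z (fun x => A x *m B x).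
Proof.
move=> /smooth_near_mxP sA /smooth_near_mxP sB.
apply: (smooth_near_entries (F := fun i j x => \sum_k A x i k * B x k j)).
  by move=> x i j; rewrite mxE.
by move=> i j; apply: smooth_near_sum => k _; exact: smooth_near_mul.
Qed.

Lemma smooth_near_scale V p q z (a : V -> R^o) (A : V -> 'M[R]_(p, q)) :
  smooth_near z a -> smooth_near z A -> smooth_near z (fun x => a x *: A x).
Proof.
move=> sa /smooth_near_mxP sA.
apply: (smooth_near_entries (F := fun i j x => a x * A x i j)).
  by move=> x i j; rewrite mxE.
by move=> i j; exact: smooth_near_mul.
Qed.

Lemma smooth_near_mxsub V p q p' q' z (A : V -> 'M[R]_(p, q))
    (B : V -> 'M[R]_(p', q')) (g : 'I_p' -> 'I_q' -> 'I_p * 'I_q) :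
  (forall x i j, B x i j = A x (g i j).1 (g i j).2) ->
  smooth_near z A -> smooth_near z B.
Proof.
move=> BA /smooth_near_mxP sA.
exact: (smooth_near_entries (F := fun i j x => A x (g i j).1 (g i j).2)).
Qed.

Lemma smooth_near_tr V p q z (A : V -> 'M[R]_(p, q)) :
  smooth_near z A -> smooth_near z (fun x => (A x)^T).
Proof.
by apply: (smooth_near_mxsub (g := fun i j => (j, i))) => x i j; rewrite mxE.
Qed.

Lemma smooth_near_row V p q z (A : V -> 'M[R]_(p, q)) i :
  smooth_near z A -> smooth_near z (fun x => row i (A x)).
Proof.
by apply: (smooth_near_mxsub (g := fun _ j => (i, j))) => x k j; rewrite mxE.
Qed.

Lemma smooth_near_rows V p q z (B : 'I_p -> V -> 'rV[R]_q) :
  (forall i, smooth_near z (B i)) ->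
  smooth_near z (fun x => \matrix_(i < p) B i x).
Proof.
move=> sB; apply: (smooth_near_entries (F := fun i j x => B i x 0 j)).
  by move=> x i j; rewrite mxE.
by move=> i j; move/smooth_near_mxP: (sB i).
Qed.

Lemma smooth_near_row_mx V p q r z (A : V -> 'M[R]_(p, q))
    (B : V -> 'M[R]_(p, r)) :
  smooth_near z A -> smooth_near z B ->
  smooth_near z (fun x => row_mx (A x) (B x)).
Proof.
move=> /smooth_near_mxP sA /smooth_near_mxP sB.
apply: (smooth_near_entries (F := fun i (j : 'I_(q + r)) x =>
  match fintype.split j with inl k => A x i k | inr k => B x i k end : R^o)).
  by move=> x i j; rewrite mxE.
by move=> i j; case: (fintype.split j).
Qed.

Lemma smooth_near_lsubmx V p q r z (A : V -> 'M[R]_(p, q + r)) :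
  smooth_near z A -> smooth_near z (fun x => lsubmx (A x)).
Proof.
by apply: (smooth_near_mxsub (g := fun i j => (i, lshift _ j))) => x i j;
  rewrite mxE.
Qed.

Lemma smooth_near_rsubmx V p q r z (A : V -> 'M[R]_(p, q + r)) :
  smooth_near z A -> smooth_near z (fun x => rsubmx (A x)).
Proof.
by apply: (smooth_near_mxsub (g := fun i j => (i, rshift _ j))) => x i j;
  rewrite mxE.
Qed.

Lemma smooth_near_usubmx V p q r z (A : V -> 'M[R]_(p + q, r)) :
  smooth_near z A -> smooth_near z (fun x => usubmx (A x)).
Proof.
by apply: (smooth_near_mxsub (g := fun i j => (lshift _ i, j))) => x i j;
  rewrite mxE.
Qed.

Lemma smooth_near_dsubmx V p q r z (A : V -> 'M[R]_(p + q, r)) :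
  smooth_near z A -> smooth_near z (fun x => dsubmx (A x)).
Proof.
by apply: (smooth_near_mxsub (g := fun i j => (rshift _ i, j))) => x i j;
  rewrite mxE.
Qed.

Lemma smooth_near_det V p z (A : V -> 'M[R]_p) :
  smooth_near z A -> smooth_near z (fun x => \det (A x) : R^o).
Proof.
move=> /smooth_near_mxP sA; apply: smooth_near_sum => s _.
by apply: smooth_near_mul; [exact: smooth_near_cst|exact: smooth_near_prod].
Qed.

Lemma near_unitmx V p z (A : V -> 'M[R]_p) : smooth_near z A ->
  A z \in unitmx -> \forall x \near z, A x \in unitmx.
Proof.
move=> /smooth_near_det/smooth_near_cont sA; rewrite unitmxE unitfE => dA.
have : \forall x \near z, \det (A x) != 0 by exact: cvgr_neq0 sA dA.
by apply: filterS => x; rewrite unitmxE unitfE.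
Qed.

Lemma smooth_near_invmx V p z (A : V -> 'M[R]_p) : smooth_near z A ->
  A z \in unitmx -> smooth_near z (fun x => invmx (A x)).
Proof.
move=> sA uA; have un := near_unitmx sA uA.
have : smooth_near z (fun x => (\det (A x))^-1 *: \adj (A x)).
  apply: smooth_near_scale.
    apply: smooth_near_inv (smooth_near_det sA).
    by move: uA; rewrite unitmxE unitfE.
  apply: (smooth_near_entries (F := fun i j x =>
      (-1) ^+ (j + i) * \det (row' j (col' i (A x))))).
    by move=> x i j; rewrite mxE.
  move=> i j; apply: smooth_near_mul; first exact: smooth_near_cst.
  apply: smooth_near_det; move: sA.
  by apply: (smooth_near_mxsub (g := fun k l => (lift j k, lift i l))) => x k l;
    rewrite !mxE.
by apply: smooth_near_eq; near=> x; rewrite /invmx (near un x).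
Unshelve. all: by end_near. Qed.

(** [Ck] speaks of derivatives in fixed directions, while the chain rule differentiates g in the
    moving direction 'D_v f x. Expanding that direction over the coordinate vectors gives a sum of
    products to which the induction applies; hence the finite-dimensional middle space. *)
Lemma Ck_comp V N k (A : set V) (B : set 'rV[R]_N) (f : V -> 'rV[R]_N)
    (g : 'rV[R]_N -> R^o) : open A -> (forall x, A x -> B (f x)) ->
  Ck k A f -> Ck k B g -> Ck k A (fun x => g (f x)).
Proof.
move=> Ao fAB; elim: k g => [|k IH] g.
  move=> cf cg x Ax; apply: continuous_comp; first exact: cf.
  exact/cg/fAB.
move=> Cf [dg Dg]; have [df Df] := Cf; split=> [x Ax|v].
  by apply: differentiable_comp; [exact: df|exact/dg/fAB].
apply: (Ck_eq (f := fun x => \sum_i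
    coordmx 0 i ('D_v f x) * 'D_(delta_mx 0 i) g (f x))) => //.
  move=> x Ax; rewrite (derive_comp _ (df _ Ax) (dg _ (fAB _ Ax))).
  set w := 'D_v f x; rewrite deriveE; last exact/dg/fAB.
  rewrite {2}[w]row_sum_delta linear_sum; apply: eq_bigr => i _.
  by rewrite linearZ /= deriveE; [|exact/dg/fAB].
have CkD i : Ck k A (fun x => coordmx 0 i ('D_v f x) * 'D_(delta_mx 0 i) g (f x)).
  apply: Ck_mul => //; last exact: IH (Ck_weak Cf) (Dg _).
  exact: (Ck_lin Ao (@continuous_coordmx _ _ 0 i) (Df v)).
elim: (index_enum _) => [|i r IHr].
  apply: (Ck_eq (f := fun=> 0)) => //; last exact: Ck_cst.
  by move=> x _; rewrite big_nil.
apply: (Ck_eq (f := fun x => coordmx 0 i ('D_v f x) * 'D_(delta_mx 0 i) g (f x)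
  + \sum_(i <- r) coordmx 0 i ('D_v f x) * 'D_(delta_mx 0 i) g (f x))) => //.
  by move=> x _; rewrite big_cons.
exact: Ck_add.
Qed.

Lemma smooth_near_comp_scalar V N z (f : V -> 'rV[R]_N) (g : 'rV[R]_N -> R^o) :
  smooth_near z f -> smooth_near (f z) g -> smooth_near z (fun x => g (f x)).
Proof.
move=> sf [B [Bo Bfz gB]].
have fB : \forall x \near z, B (f x).
  by apply: (smooth_near_cont sf); exact: open_nbhs_nbhs.
move: sf => [A [Ao Az fA]].
have Co : open (A `&` [set x | B (f x)]^°) by exact: openI Ao (open_interior _).
exists (A `&` [set x | B (f x)]^°); split=> // k.
apply: (Ck_comp Co (B := B)) => //; first by move=> x [_ /interior_subset].
by apply: CkS (fA k); exact: subIsetl.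
Qed.

Lemma smooth_near_comp V N p q z (f : V -> 'rV[R]_N)
    (g : 'rV[R]_N -> 'M[R]_(p, q)) :
  smooth_near z f -> smooth_near (f z) g -> smooth_near z (fun x => g (f x)).
Proof.
move=> sf /smooth_near_mxP sg; apply/smooth_near_mxP => i j.
exact: (smooth_near_comp_scalar sf (sg i j)).
Qed.

Lemma smooth_near_mulmxr V p q r z (A : V -> 'M[R]_(p, q)) (B : 'M[R]_(q, r)) :
  smooth_near z A -> smooth_near z (fun x => A x *m B).
Proof. by move=> sA; apply: smooth_near_mulmx sA _; exact: smooth_near_cst. Qed.

Lemma derive_entry V p q (M : V -> 'M[R]_(p, q)) z v i j : differentiable M z ->
  'D_v M z i j = 'D_v (fun x => M x i j : R^o) z.
Proof.
by move=> dM; rewrite derive_mx ?mxE //; exact: diff_derivable.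
Qed.

Lemma differentiable_entry V p q (M : V -> 'M[R]_(p, q)) z i j :
  differentiable M z -> differentiable (fun x => M x i j : R^o) z.
Proof.
move=> dM; apply: (@differentiable_comp _ _ _ _ M (@coordmx p q i j)) => //.
exact/linear_differentiable/continuous_coordmx.
Qed.

Lemma derive_mulmx V p q r (A : V -> 'M[R]_(p, q)) (B : V -> 'M[R]_(q, r)) z v :
  smooth_near z A -> smooth_near z B ->
  'D_v (fun x => A x *m B x) z = 'D_v A z *m B z + A z *m 'D_v B z.
Proof.
move=> sA sB; have [dA dB] := (smooth_near_diff sA, smooth_near_diff sB).
have dAB := smooth_near_diff (smooth_near_mulmx sA sB).
apply/matrixP => i j; rewrite derive_entry // !mxE.
have -> : (fun x => (A x *m B x) i j) =
    \sum_k ((fun x => A x i k) * (fun x => B x k j) : V -> R^o).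
  by apply/funext => x; rewrite mxE fct_sumE.
rewrite -big_split /= derive_sum => [|k]; last first.
  by apply: derivableM; exact/diff_derivable/differentiable_entry.
apply: eq_bigr => k _; rewrite deriveM; try
  exact/diff_derivable/differentiable_entry.
rewrite !derive_entry // addrC; congr (_ + _); exact: mulrC.
Qed.

Lemma jacobianE N p (f : 'rV[R]_N -> 'rV[R]_p) z (M : 'M[R]_(N, p)) :
  differentiable f z -> (forall v, 'D_v f z = v *m M) -> 'J f z = M.
Proof.
move=> df fM; apply/row_matrixP => i; rewrite !rowE -fM.
by rewrite deriveEjacobian.
Qed.

Lemma near_eq_jacobian N p (f g : 'rV[R]_N -> 'rV[R]_p) z :
  (\forall x \near z, f x = g x) -> differentiable f z -> 'J f z = 'J g z.
Proof.
move=> fg df; apply: jacobianE => // v; have [dg _] := near_eq_differentiable fg df.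
by rewrite (near_eq_derive _ fg) deriveEjacobian.
Qed.

Lemma smooth_near_jacobian N p (f : 'rV[R]_N -> 'rV[R]_p) z :
  smooth_near z f -> smooth_near z (fun x => 'J f x).
Proof.
move=> sf; have sfo := smooth_near_open sf.
have : smooth_near z (fun x => \matrix_i 'D_(delta_mx 0 i) f x).
  by apply: smooth_near_rows => i; exact: smooth_near_derive.
apply: smooth_near_eq; near=> x; apply/row_matrixP => i.
rewrite rowK rowE deriveEjacobian //; apply: smooth_near_diff.
exact: (near sfo x).
Unshelve. all: by end_near. Qed.

Lemma jacobian_comp N p q (f : 'rV[R]_N -> 'rV[R]_p) (g : 'rV[R]_p -> 'rV[R]_q) z :
  differentiable f z -> differentiable g (f z) ->
  'J (fun x => g (f x)) z = 'J f z *m 'J g (f z).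
Proof.
move=> df dg; apply: jacobianE => [|v]; first exact: differentiable_comp.
by rewrite derive_comp // mulmxA -!deriveEjacobian.
Qed.

Lemma derive_mulmxr V p q r (A : V -> 'M[R]_(p, q)) (B : 'M[R]_(q, r)) z v :
  differentiable A z -> 'D_v (fun x => A x *m B) z = 'D_v A z *m B.
Proof.
by move=> dA; apply: (derive_linear (L := mulmxr B)) => //; exact: continuous_linear_mx.
Qed.

End SmoothNear.

(** * Lipschitz bounds and the symmetry of second derivatives *)

Section InverseFunction.
Context {R : realType}.
Implicit Types V W : normedModType R.

Lemma near_forall (T : topologicalType) (I : finType) (P : I -> T -> Prop)
    (z : T) : (forall i, \forall x \near z, P i x) ->
  \forall x \near z, forall i, P i x.
Proof. by move=> H; exact: filter_forall. Qed.

Lemma ler_mxnorm_entry p q (A : 'M[R]_(p, q)) i j : `|A i j| <= `|A|.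
Proof.
by rewrite [leRHS]/Num.Def.normr /= mx_normrE; exact: (le_bigmax _ _ (i, j)).
Qed.

Lemma mxnorm_le p q (A : 'M[R]_(p, q)) c : 0 <= c ->
  (forall i j, `|A i j| <= c) -> `|A| <= c.
Proof.
move=> c0 Ac; by rewrite /Num.Def.normr /= mx_normrE bigmax_le // => -[i j] _.
Qed.

Lemma mxnormM_le p q r (A : 'M[R]_(p, q)) (B : 'M[R]_(q, r)) :
  `|A *m B| <= q%:R * `|A| * `|B|.
Proof.
apply: mxnorm_le => [|i j]; first by rewrite !mulr_ge0.
rewrite mxE (le_trans (ler_norm_sum _ _ _)) //.
have -> : q%:R * `|A| * `|B| = \sum_(k < q) `|A| * `|B|.
  by rewrite sumr_const card_ord -[RHS]mulr_natl mulrA.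
by apply: ler_sum => k _; rewrite normrM ler_pM ?ler_mxnorm_entry.
Qed.

Lemma ball_segment V (z x y : V) (e c : R) : 0 <= c <= 1 ->
  ball z e x -> ball z e y -> ball z e (x + c *: (y - x)).
Proof.
move=> /andP[c0 c1]; rewrite -ball_normE /= => zx zy.
have -> : z - (x + c *: (y - x)) = (1 - c) *: (z - x) + c *: (z - y).
  rewrite scalerBl scale1r -addrA [- _ + _]addrC -scalerBr.
  have -> : z - y - (z - x) = - (y - x) by rewrite opprB addrC subrKA opprB.
  by rewrite scalerN -[RHS]addrA -opprD.
rewrite (le_lt_trans (ler_normD _ _)) // !normrZ (ger0_norm c0).
rewrite ger0_norm ?subr_ge0 //.
have e1 : (1 - c) * `|z - x| <= (1 - c) * e.
  by rewrite ler_wpM2l ?subr_ge0 // ltW.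
have [c00|c00] := eqVneq c 0; first by rewrite c00 subr0 mul1r mul0r addr0.
have : c * `|z - y| < c * e by rewrite ltr_pM2l // lt0r c00.
lra.
Qed.

Lemma lipschitz_ball N p q (f : 'rV[R]_N -> 'M[R]_(p, q)) z e c :
  (forall x, ball z e x -> differentiable f x) ->
  (forall x i, ball z e x -> `|'D_(delta_mx 0 i) f x| <= c) ->
  forall x y, ball z e x -> ball z e y -> `|f x - f y| <= N%:R * c * `|x - y|.
Proof.
move=> df Df x y zx zy.
have [->|N0] := eqVneq x y; first by rewrite !subrr !normr0 mulr0.
(* For N = 0 there is no partial derivative to witness 0 <= c, hence the case split. *)
have c0 : 0 <= N%:R * c.
  case: N f z x y df Df zx zy N0 => [|N] f z x y df Df zx zy N0.
    by rewrite mul0r.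
  by rewrite mulr_ge0 // (le_trans _ (Df x 0 zx)).
apply: mxnorm_le => [|i j]; first by rewrite mulr_ge0.
have dfij t : 0 <= t <= 1 ->
    differentiable (fun x => f x i j : R^o) (y + t *: (x - y)).
  by move=> t01; exact/differentiable_entry/df/ball_segment.
have [t [t01]] := mvt_segment dfij; rewrite subrKC !mxE => ->.
have zt := ball_segment t01 zy zx.
rewrite -derive_entry; last exact: df.
set u := x - y; set w := y + t *: u.
have -> : 'D_u f w = \sum_k u 0 k *: 'D_(delta_mx 0 k) f w.
  rewrite deriveE; last exact: df.
  rewrite {1}[u]row_sum_delta linear_sum; apply: eq_bigr => k _.
  by rewrite linearZ /= deriveE //; exact: df.
rewrite summxE (le_trans (ler_norm_sum _ _ _)) //.
have -> : N%:R * c * `|u| = \sum_(k < N) c * `|u|.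
  by rewrite sumr_const card_ord -[RHS]mulr_natl mulrA.
apply: ler_sum => k _; rewrite mxE normrM mulrC ler_pM ?ler_mxnorm_entry //.
by apply: le_trans (ler_mxnorm_entry _ _ _) (Df _ _ zt).
Qed.

Lemma smooth_near_lipschitz N p q (f : 'rV[R]_N -> 'M[R]_(p, q)) z :
  smooth_near z f -> exists L e : R, [/\ 0 <= L, 0 < e &
    forall x y, ball z e x -> ball z e y -> `|f x - f y| <= L * `|x - y|].
Proof.
(* A sum over all coordinates bounds every partial derivative near z; the summand 1 leaves room for
   continuity. *)
move=> sf; pose c := \sum_(i < N) (`|'D_(delta_mx 0 i) f z| + 1).
have ic i : `|'D_(delta_mx 0 i) f z| + 1 <= c.
  by rewrite /c (bigD1 i) //= lerDl; apply: sumr_ge0 => k _; rewrite addr_ge0.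
have Dc i : \forall x \near z, `|'D_(delta_mx 0 i) f x| <= c.
  have := smooth_near_cont (smooth_near_derive (delta_mx 0 i) sf).
  move=> /cvgr_norm_le /(_ (`|'D_(delta_mx 0 i) f z| + 1)) H.
  have /H : `|'D_(delta_mx 0 i) f z| < `|'D_(delta_mx 0 i) f z| + 1.
    by rewrite ltrDl.
  by apply: filterS => x /le_trans; apply.
have sfo := smooth_near_open sf; have Dfc := near_forall Dc.
have : \forall x \near z, smooth_near x f /\
    forall i, `|'D_(delta_mx 0 i) f x| <= c.
  by near=> x; split; [exact: (near sfo x)|exact: (near Dfc x)].
move=> /nbhs_ballP[e /= e0 He]; exists (N%:R * c), e; split => //.
  by rewrite mulr_ge0 // sumr_ge0 // => i _; rewrite addr_ge0.
apply: lipschitz_ball => [x /He[/smooth_near_diff]//|x i /He[_]]; exact.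
Unshelve. all: by end_near. Qed.

(** The mean value theorem is applied twice: to the increment of f by s w along s v, then to 'D_v f
    along s w. The bound on p - z keeps p in the ball where the second derivatives are
    controlled. *)
Lemma second_difference N (f : 'rV[R]_N -> R^o) z v w (e : R) (s : R) :
  (forall x, ball z e x -> smooth_near x f) -> 0 < s ->
  s * (`|v| + `|w|) < e ->
  exists p, `|p - z| <= s * (`|v| + `|w|) /\
    f (z + s *: v + s *: w) - f (z + s *: v) - (f (z + s *: w) - f z) =
    s * s * 'D_w (fun x => 'D_v f x) p.
Proof.
move=> sf s0 se.
have inb (a b : R) : 0 <= a <= 1 -> 0 <= b <= 1 ->
    `|z + a *: (s *: v) + b *: (s *: w) - z| <= s * (`|v| + `|w|).
  move=> /andP[a0 a1] /andP[b0 b1].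
  rewrite -[z + _ + _]addrA [z + _]addrC addrK (le_trans (ler_normD _ _)) // !normrZ mulrDr.
  by rewrite (gtr0_norm s0) !ger0_norm // lerD // ler_piMl // mulr_ge0 // ltW.
have inB a b : 0 <= a <= 1 -> 0 <= b <= 1 ->
    ball z e (z + a *: (s *: v) + b *: (s *: w)).
  move=> a01 b01; rewrite -ball_normE /= distrC.
  exact: le_lt_trans (inb _ _ a01 b01) se.
have le01 : 0 <= (0 : R) <= 1 by rewrite lexx ler01.
have le11 : 0 <= (1 : R) <= 1 by rewrite lexx ler01.
pose phi x : R^o := f (x + s *: w) - f x.
have dsf a b : 0 <= a <= 1 -> 0 <= b <= 1 ->
    smooth_near (z + a *: (s *: v) + b *: (s *: w)) f.
  by move=> a01 b01; exact/sf/inB.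
have d1 a : 0 <= a <= 1 ->
    differentiable (fun x => f (x + s *: w)) (z + a *: (s *: v)).
  move=> a01; apply: differentiable_comp => //=.
  by apply: smooth_near_diff; have := dsf a 1 a01 le11; rewrite scale1r.
have d2 a : 0 <= a <= 1 -> differentiable f (z + a *: (s *: v)).
  move=> a01; apply: smooth_near_diff.
  by have := dsf a 0 a01 le01; rewrite scale0r addr0.
have [|a [a01 Ea]] := @mvt_segment _ _ phi z (s *: v).
  by move=> a a01; exact: differentiableB (d1 a a01) (d2 a a01).
rewrite -/(phi (z + s *: v)) -/(phi z) Ea.
rewrite deriveB; try exact/diff_derivable/d1; try exact/diff_derivable/d2.
rewrite (derive_comp (f := fun y => y + s *: w)) //; last first.
  by apply: smooth_near_diff; have := dsf a 1 a01 le11; rewrite scale1r.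
have -> : 'D_(s *: v) (fun y => y + s *: w) (z + a *: (s *: v)) = s *: v.
  by rewrite deriveD // derive_id derive_cst addr0.
have Ds x : smooth_near x f -> 'D_(s *: v) f x = s * 'D_v f x.
  move=> /smooth_near_diff dfx.
  by have := deriveDir v 0 s dfx; rewrite derive0 !addr0.
have ds b : 0 <= b <= 1 -> differentiable (fun x => 'D_v f x)
    (z + a *: (s *: v) + b *: (s *: w)).
  by move=> b01; apply/smooth_near_diff/smooth_near_derive/dsf.
have [b [b01 Eb]] := mvt_segment ds.
rewrite !Ds; last 2 first.
- by have := dsf a 0 a01 le01; rewrite scale0r addr0.
- by have := dsf a 1 a01 le11; rewrite scale1r.
exists (z + a *: (s *: v) + b *: (s *: w)); split; first exact: inb.
rewrite -mulrBr Eb.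
have := deriveDir w 0 s (ds b b01); rewrite derive0 !addr0 => ->.
by rewrite mulrA.
Qed.

(** The second difference is symmetric in v and w, so the two mixed derivatives take a common value
    at two points p and q near z. Continuity then bounds their difference at z by any d > 0. *)
Lemma schwarz N (f : 'rV[R]_N -> R^o) z v w : smooth_near z f ->
  'D_w (fun x => 'D_v f x) z = 'D_v (fun x => 'D_w f x) z.
Proof.
move=> sf; apply/eqP; rewrite -subr_eq0 -normr_le0; apply/ler_addgt0Pr => d d0; rewrite add0r.
pose a x := 'D_w (fun x => 'D_v f x) x; pose b x := 'D_v (fun x => 'D_w f x) x.
have ca := smooth_near_cont (smooth_near_derive w (smooth_near_derive v sf)).
have cb := smooth_near_cont (smooth_near_derive v (smooth_near_derive w sf)).
have : \forall x \near z, [/\ smooth_near x f, `|a z - a x| <= d / 2 &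
    `|b z - b x| <= d / 2].
  have d20 : 0 < d / 2 by rewrite divr_gt0.
  move/cvgrPdist_le: ca => /(_ _ d20) ca; move/cvgrPdist_le: cb => /(_ _ d20) cb.
  have sfo := smooth_near_open sf; near=> x.
  by split; [exact: (near sfo x)|exact: (near ca x)|exact: (near cb x)].
move=> /nbhs_ballP[e /= e0 He].
(* The summand 1 makes the denominator positive and the next inequality strict. *)
pose s := e / (`|v| + `|w| + 1).
have s0 : 0 < s by rewrite divr_gt0 // ltr_wpDl.
have se : s * (`|v| + `|w|) < e.
  rewrite /s mulrAC ltr_pdivrMr; last by rewrite ltr_wpDl.
  by rewrite ltr_pM2l // ltrDl.
have sfe x : ball z e x -> smooth_near x f by move=> /He[].
have [p [pz Ep]] := second_difference sfe s0 se.
have se' : s * (`|w| + `|v|) < e by rewrite [`|w| + _]addrC.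
have [q [qz Eq]] := second_difference sfe s0 se'.
have inB x : `|x - z| <= s * (`|v| + `|w|) -> ball z e x.
  by move=> xz; rewrite -ball_normE /= distrC (le_lt_trans xz).
have [_ pa _] := He _ (inB _ pz).
rewrite [`|w| + _]addrC in qz.
have [_ _ qb] := He _ (inB _ qz).
have ss : s * s != 0 by rewrite mulf_neq0 // gt_eqF.
have : a p = b q.
  have H (u1 u2 u3 u4 : R) : u1 - u2 - (u3 - u4) = u1 - u3 - (u2 - u4) by ring.
  rewrite H (addrAC z (s *: v)) in Ep.
  exact: (mulfI ss (etrans (esym Ep) Eq)).
move=> pq; rewrite pq in pa.
have H (A B C : R) : A - C - (B - C) = A - B by ring.
change (`|a z - b z| <= d); rewrite -(H (a z) (b z) (b q)) (splitr d).
by apply: (le_trans (ler_normB _ _)); exact: lerD pa qb.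
Unshelve. all: by end_near. Qed.

(** Derivatives are taken in the whole space, so [Ck] constrains the function at each point of A
    separately. This lets neighborhoods that depend on the point be combined into a statement about
    a set. *)
Lemma Ck_points V W k (A : set V) (f : V -> W) :
  Ck k A f <-> forall x, A x -> Ck k [set x] f.
Proof.
elim: k f => [|k IH] f /=.
  by split=> [cf x Ax _ -> //|cf x Ax]; [exact: cf|exact: (cf x Ax)].
split=> [[df Df] x Ax|H]; first split=> [_ ->|v]; first exact: df.
  by move/IH: (Df v); exact.
by split=> [x Ax|v]; [exact: (H x Ax).1|apply/IH => x Ax; exact: (H x Ax).2].
Qed.

Lemma Ck_entries V p q k (A : set V) (M : V -> 'M[R]_(p, q)) : open A ->
  (forall i j, Ck k A (fun x => M x i j : R^o)) -> Ck k A M.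
Proof.
move=> Ao CM.
have Ck0 : Ck k A (fun _ : V => 0 : 'M[R]_(p, q)) by exact: Ck_cst.
have CkSum (I : Type) (r : seq I) (F : I -> V -> 'M[R]_(p, q)) :
    (forall i, Ck k A (F i)) -> Ck k A (fun x => \sum_(i <- r) F i x).
  move=> CF; elim: r => [|i r IH].
    by apply: Ck_eq Ck0 => // x _; rewrite big_nil.
  by apply: Ck_eq (Ck_add Ao (CF i) IH) => // x _; rewrite big_cons.
apply: (Ck_eq (f := fun x => \sum_i \sum_j M x i j *: delta_mx i j)) => //.
  by move=> x _; rewrite -matrix_sum_delta.
apply: (CkSum) => i; apply: (CkSum) => j.
pose L := fun a : R^o => a *: (delta_mx i j : 'M[R]_(p, q)).
have Ll : linear L by move=> a x y; rewrite /L scalerDl scalerA.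
pose LM := GRing.isLinear.Build _ _ _ _ _ Ll.
pose LL : {linear R^o -> 'M[R]_(p, q)} := HB.pack L LM.
apply: (@Ck_lin _ _ _ _ _ _ (fun x => M x i j) LL) => //.
exact: scalel_continuous.
Qed.

End InverseFunction.

(** * Inverse function theorem *)

(** Joins the norm and the completeness of matrices, as needed for Banach's fixed point theorem. *)
HB.instance Definition _ (R : realType) (m n : nat) := Complete.on 'M[R]_(m, n).

Section InverseFunctionTheorem.
Context {R : realType}.

(** The map x - f x B has derivative 0 at z, since B inverts the Jacobian there; its partial
    derivatives are therefore as small as wanted nearby. *)
Lemma near_identity_contraction N (f : 'rV[R]_N -> 'rV[R]_N) z
    (B := invmx ('J f z)) :
  smooth_near z f -> 'J f z \in unitmx ->
  exists e : R, [/\ 0 < e,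
    forall x, ball z e x -> smooth_near x f /\ 'J f x \in unitmx &
    forall x y, ball z e x -> ball z e y ->
      `|(x - f x *m B) - (y - f y *m B)| <= 2^-1 * `|x - y|].
Proof.
move=> sf uJ; pose phi x := x - f x *m B.
have sphi : smooth_near z phi.
  exact: smooth_near_sub (smooth_near_id _) (smooth_near_mulmxr _ sf).
have Dphi0 v : 'D_v phi z = 0.
  have dfB := smooth_near_diff (smooth_near_mulmxr B sf).
  rewrite deriveB; [|by []|exact: diff_derivable].
  have df := smooth_near_diff sf.
  by rewrite derive_id derive_mulmxr // deriveEjacobian // mulmxK // subrr.
(* [lipschitz_ball] multiplies the bound on the partial derivatives by N, and N c is at most 1/2. *)
pose c : R := (2 * N.+1%:R)^-1.
have c0 : 0 < c by rewrite invr_gt0 mulr_gt0.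
have Dc i : \forall x \near z, `|'D_(delta_mx 0 i) phi x| <= c.
  have := smooth_near_cont (smooth_near_derive (delta_mx 0 i) sphi).
  move=> /cvgr_norm_le /(_ c); rewrite Dphi0 normr0; exact.
have Dfc := near_forall Dc.
have spo := smooth_near_open sphi; have sfo := smooth_near_open sf.
have uo := near_unitmx (smooth_near_jacobian sf) uJ.
have : \forall x \near z, [/\ smooth_near x f, 'J f x \in unitmx,
    smooth_near x phi & forall i, `|'D_(delta_mx 0 i) phi x| <= c].
  near=> x; split; [exact: (near sfo x)|exact: (near uo x)|
    exact: (near spo x)|exact: (near Dfc x)].
move=> /nbhs_ballP[e /= e0 He]; exists e; split; first exact: e0.
  by move=> x /He[sx ux _ _]; split.
move=> x y zx zy.
have d1 x' : ball z e x' -> differentiable phi x'.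
  by move=> /He[_ _ s _]; exact: smooth_near_diff s.
have d2 x' i : ball z e x' -> `|'D_(delta_mx 0 i) phi x'| <= c.
  by move=> /He[_ _ _ H]; exact: H.
apply: (le_trans (lipschitz_ball d1 d2 zx zy)).
rewrite ler_wpM2r // /c invfM mulrCA ler_piMr ?invr_ge0 //.
by rewrite ler_pdivrMr // mul1r ler_nat.
Unshelve. all: by end_near. Qed.

Lemma Ck_smooth_near (V W : normedModType R) k (A : set V) (f : V -> W) :
  (forall x, A x -> smooth_near x f) -> Ck k A f.
Proof.
move=> sf; apply/Ck_points => x /sf[B [_ Bx /(_ k)]].
by apply: CkS => y ->.
Qed.

Section LocalInverse.
Context (N : nat) (f : 'rV[R]_N -> 'rV[R]_N) (z : 'rV[R]_N) (e : R).
Let B := invmx ('J f z).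
Hypothesis uJ : 'J f z \in unitmx.
Hypothesis e0 : 0 < e.
Hypothesis ball_ok :
  forall x, ball z e x -> smooth_near x f /\ 'J f x \in unitmx.
Hypothesis ball_contraction : forall x y, ball z e x -> ball z e y ->
  `|(x - f x *m B) - (y - f y *m B)| <= 2^-1 * `|x - y|.

Let subrACA (a b c d : 'rV[R]_N) : a - b - (c - d) = a - c - (b - d).
Proof. by apply/rowP => i; rewrite !mxE; ring. Qed.

(** The radii fit together: a contraction by 1/2 shrinks e/2 to e/4, and a target in [Y] shifts the
    result by less than e/4, so the Newton map sends [U] to itself. *)
Let U : set 'rV[R]_N := closed_ball_ Num.Def.normr z (e / 2).
Let Y : set 'rV[R]_N := [set y : 'rV[R]_N | `|(y - f z) *m B| < e / 4].

Let U_ball x : U x -> ball z e x.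
Proof.
rewrite /U /closed_ball_ /= -ball_normE /= => /le_lt_trans; apply.
by rewrite ltr_pdivrMr // mulr_natr mulr2n ltrDl.
Qed.

Let Uz : U z.
Proof. by rewrite /U /closed_ball_ /= subrr normr0 divr_ge0 // ltW. Qed.

(** At most half of the distance x - y is absorbed by the contraction; the rest must appear in (f x
    - f y) B. *)
Let f_expanding x y : ball z e x -> ball z e y ->
  `|x - y| <= 2 * `|(f x - f y) *m B|.
Proof.
move=> zx zy; have := ball_contraction zx zy.
have -> : x - f x *m B - (y - f y *m B) = (x - y) - (f x - f y) *m B.
  by rewrite mulmxBl; exact: subrACA.
move=> H; have := ler_distD ((f x - f y) *m B) (x - y) 0.
rewrite !subr0 => H'; lra.
Qed.

(** The solution is the fixed point of the Newton map with the Jacobian frozen at z; [U] is closed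
    so that Banach's theorem applies inside it. *)
Let solution y : Y y -> exists x, U x /\ f x = y.
Proof.
move=> Yy; pose T (x : 'rV[R]_N) : 'rV[R]_N := x - f x *m B + y *m B.
have TU : {homo T : x / U x >-> U x}.
  move=> x Ux; rewrite /U /closed_ball_ /= distrC.
  have := ball_contraction (U_ball Ux) (U_ball Uz).
  have -> : T x - z =
      (x - f x *m B - (z - f z *m B)) + (y - f z) *m B.
    rewrite /T mulmxBl; move: (f x *m B) (f z *m B) (y *m B) => a b c.
    by apply/rowP => i; rewrite !mxE; ring.
  move: Ux Yy; rewrite /U /Y /closed_ball_ /= distrC => Ux Yy H.
  rewrite (le_trans (ler_normD _ _)) //; lra.
pose q : {nonneg R} := NngNum (ltW (divr_gt0 ltr01 (ltr0Sn R 1))).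
have ctr : is_contraction (mkfun_fun TU).
  exists q; split; first by rewrite /= ltr_pdivrMr // mul1r ltr1n.
  move=> [x x'] /= [Ux Ux']; rewrite /mkfun.
  have := ball_contraction (U_ball Ux) (U_ball Ux').
  have -> : T x - T x' = x - f x *m B - (x' - f x' *m B).
    rewrite /T; move: (f x *m B) (f x' *m B) (y *m B) => a b c.
    by apply/rowP => i; rewrite !mxE; ring.
  by rewrite div1r.
have [|x Ux xT] := banach_fixed_point ctr (@closed_closed_ball_ _ _ _ _).
  by exists z.
exists x; split=> //.
have {}xT : x = x - f x *m B + y *m B := xT.
have E : f x *m B = y *m B.
  move: xT; move: (f x *m B) (y *m B) => a b /rowP H.
  by apply/rowP => i; have := H i; rewrite !mxE; lra.
exact: (can_inj (mulmxKV uJ) E).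
Qed.

(** The default z is returned where no solution exists; on [Y] a solution exists, and by
    [f_expanding] it is the only one in [U]. *)
Let g (y : 'rV[R]_N) : 'rV[R]_N := xget z [set x : 'rV[R]_N | U x /\ f x = y].

Let gP y : Y y -> U (g y) /\ f (g y) = y.
Proof.
move=> /solution[x xP]; rewrite /g.
by case: xgetP => [x' -> //|/(_ x)].
Qed.

Let g_lipschitz y y' : Y y -> Y y' ->
  `|g y - g y'| <= 2 * N%:R * `|B| * `|y - y'|.
Proof.
move=> /gP[Uy fy] /gP[Uy' fy'].
have := f_expanding (U_ball Uy) (U_ball Uy'); rewrite fy fy'.
move=> /le_trans; apply.
have -> : 2 * N%:R * `|B| * `|y - y'| = 2 * (N%:R * `|y - y'| * `|B|) by ring.
by rewrite ler_wpM2l //; exact: mxnormM_le.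
Qed.

Let Y_open : open Y.
Proof.
have c : continuous (fun y : 'rV[R]_N => `|(y - f z) *m B|).
  move=> y; have sy : smooth_near y (fun y : 'rV[R]_N => (y - f z) *m B).
    apply: smooth_near_mulmxr.
    exact: smooth_near_sub (smooth_near_id _) (smooth_near_cst _ _).
  exact: (cvg_norm (smooth_near_cont sy)).
exact: (open_comp _ (@open_lt R (e / 4))).
Qed.

Let g_cont y : Y y -> {for y, continuous g}.
Proof.
move=> Yy; apply/(@cvgrPdist_lt _ _ _ (nbhs y)) => d d0.
pose K := 2 * N%:R * `|B| + 1.
have K0 : 0 < K by rewrite ltr_wpDl // !mulr_ge0.
have Yn : \forall y' \near y, Y y' := open_nbhs_nbhs (conj Y_open Yy).
have yd : \forall y' \near y, `|y - y'| < d / K.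
  by apply: (@cvgr_dist_lt _ _ _ (nbhs y)) => //; rewrite divr_gt0.
near=> y'; apply: (le_lt_trans (g_lipschitz Yy (near Yn y' _))) => //.
have := near yd y'; rewrite ltr_pdivlMr // => /(_ _) H.
apply: le_lt_trans (H _) => //.
by rewrite mulrC ler_wpM2l // lerDl.
Unshelve. all: by end_near. Qed.

Let g_diff y : Y y -> differentiable g y /\
  forall v, 'D_v g y = v *m invmx ('J f (g y)).
Proof.
move=> Yy; have [Ux fx] := gP Yy; set x := g y in Ux fx *.
have [sf uJx] := ball_ok (U_ball Ux); have df := smooth_near_diff sf.
set M := invmx _.
have := @differentiable_eps R _ _ g y (mulmxr M) (@continuous_linear_mx _ _ _ _ _).
move=> [|dg Dg]; last by split=> // v; rewrite deriveE // Dg.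
move=> eps eps0; pose K := 2 * N%:R * `|B| + 1.
have K0 : 0 < K by rewrite ltr_wpDl // !mulr_ge0.
(* An error eps / c for f becomes N |M| K / c times eps for g, and c exceeds N |M| K. *)
pose c := N%:R * `|M| * K + 1.
have c0 : 0 < c by rewrite ltr_wpDl // !mulr_ge0 // ltW.
have /eqaddoP /(_ (eps / c)) fe := diff_locally df.
have {}fe := fe (divr_gt0 eps0 c0).
have /nbhs_ballP[d /= d0 Hd] := fe.
have kd : \forall k \near (0 : 'rV[R]_N), `|k| < d / K.
  by apply: nbhs0_lt; rewrite divr_gt0.
have Yn : \forall k \near (0 : 'rV[R]_N), Y (k + y).
  have := open_nbhs_nbhs (conj Y_open Yy) : \forall y' \near y, Y y'.
  by rewrite (near_shift 0) subr0.
near=> k; have Yk : Y (k + y) by exact: (near Yn k).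
have [_ fk] := gP Yk.
set h := g (k + y) - x.
have hle : `|h| <= K * `|k|.
  have := g_lipschitz Yk Yy; rewrite -/x -/h addrK => /le_trans; apply.
  by rewrite ler_wpM2r // lerDl.
have : `|(f \o shift x - (cst (f x) + 'd f x)) h| <= eps / c * `|h|.
  apply: Hd; rewrite -ball_normE /= sub0r normrN (le_lt_trans hle) //.
  by rewrite mulrC -ltr_pdivlMr //; exact: (near kd k).
rewrite !fctE /= opprD addrA subrK fk fx addrK -deriveE // deriveEjacobian //.
move=> kh.
have -> : h - mulmxr M k = - ((k - h *m 'J f x) *m M).
  by rewrite mulmxBl mulmxK // opprB.
rewrite normrN (le_trans (mxnormM_le _ _)) //.
have : N%:R * `|k - h *m 'J f x| * `|M| <= N%:R * (eps / c * (K * `|k|)) * `|M|.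
  rewrite ler_wpM2r // ler_wpM2l //; apply: (le_trans kh).
  by rewrite ler_wpM2l // divr_ge0 // ltW.
move=> /le_trans; apply.
have -> : N%:R * (eps / c * (K * `|k|)) * `|M| =
  (N%:R * `|M| * K / c) * (eps * `|k|) by ring.
rewrite ler_piMl // ?mulr_ge0 // ?ltW //.
by rewrite ltr_pdivrMr // mul1r ltrDl.
Unshelve. all: by end_near. Qed.

(** Bootstrap: by [g_diff] the derivative of g is a smooth function of g itself, so each order of
    differentiability yields the next. *)
Let g_smooth k : Ck k Y g.
Proof.
elim: k => [|k IH]; first exact: g_cont.
split=> [y /g_diff[]//|v].
apply: (Ck_eq (f := fun y => v *m invmx ('J f (g y)))) => //.
  by move=> y Yy; have [_ ->] := g_diff Yy.
apply: Ck_entries => // i j.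
pose h x : R^o := (v *m invmx ('J f x)) i j.
apply: (@Ck_comp R _ _ k Y (ball z e) g h) => //.
  by move=> y /gP[/U_ball].
apply: Ck_smooth_near => x /ball_ok[sf uJx].
have : smooth_near x (fun x => v *m invmx ('J f x)).
  apply: smooth_near_mulmx; first exact: smooth_near_cst.
  exact: smooth_near_invmx (smooth_near_jacobian sf) uJx.
by move=> /smooth_near_mxP; exact.
Qed.

Lemma local_inverse : exists h, [/\ smooth_near (f z) h,
  \forall x \near z, h (f x) = x & \forall y \near f z, f (h y) = y].
Proof.
have Yfz : Y (f z) by rewrite /Y /= subrr mul0mx normr0 divr_gt0.
have sf : smooth_near z f by have [] := ball_ok (ballxx z e0).
have Yn : \forall y \near f z, Y y := open_nbhs_nbhs (conj Y_open Yfz).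
exists g; split.
- exists Y; split; [exact: Y_open|exact: Yfz|exact: g_smooth].
- have Yf : \forall x \near z, Y (f x) := smooth_near_cont sf Yn.
  have zn : \forall x \near z, ball z e x by exact: nbhsx_ballx.
  near=> x; have Yfx : Y (f x) by exact: (near Yf x).
  have [Ux fx] := gP Yfx.
  have bx : ball z e x by exact: (near zn x).
  apply/eqP; rewrite -subr_eq0 -normr_le0.
  by rewrite (le_trans (f_expanding (U_ball Ux) bx)) // fx subrr mul0mx normr0 mulr0.
- near=> y; have Yy : Y y by exact: (near Yn y).
  by have [] := gP Yy.
Unshelve. all: by end_near. Qed.

End LocalInverse.

Theorem inverse_function N (f : 'rV[R]_N -> 'rV[R]_N) z :
  smooth_near z f -> 'J f z \in unitmx -> local_diffeo z f.
Proof.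
move=> sf uJ; split=> //.
have [e [e0 eo ec]] := near_identity_contraction sf uJ.
exact: (local_inverse uJ e0 eo ec).
Qed.

End InverseFunctionTheorem.

(** * Submersions *)

Section Submersion.
Context {R : realType}.

Lemma complete_cols N p (M : 'M[R]_(N, p)) : \rank M = p ->
  exists q (K : 'M[R]_(N, q)), (p + q)%N = N /\ \rank (row_mx M K) = N.
Proof.
move=> rM; pose C := row_base (M^T)^C%MS.
exists (\rank (M^T)^C%MS), C^T; split.
  by rewrite mxrank_compl mxrank_tr rM subnKC // -rM rank_leq_row.
rewrite -mxrank_tr tr_row_mx trmxK -addsmxE.
rewrite (adds_eqmx (eqmx_refl _) (eq_row_base _)).
exact/eqP/addsmx_compl_full.
Qed.

Lemma derive_row_mx (V : normedModType R) p q r (A : V -> 'M[R]_(p, q))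
    (B : V -> 'M[R]_(p, r)) z v : smooth_near z A -> smooth_near z B ->
  'D_v (fun x => row_mx (A x) (B x)) z = row_mx ('D_v A z) ('D_v B z).
Proof.
move=> sA sB.
have dAB := smooth_near_diff (smooth_near_row_mx sA sB).
have [dA dB] := (smooth_near_diff sA, smooth_near_diff sB).
apply/matrixP => i j; rewrite derive_entry //.
case: (fintype.splitP j) => k jk.
  have -> : j = lshift r k by exact: val_inj.
  by rewrite row_mxEl derive_entry //; under eq_fun do rewrite row_mxEl.
have -> : j = rshift q k by exact: val_inj.
by rewrite row_mxEr derive_entry //; under eq_fun do rewrite row_mxEr.
Qed.

Lemma jacobian_row_mx N p q (f : 'rV[R]_N -> 'rV[R]_p)
    (g : 'rV[R]_N -> 'rV[R]_q) z : smooth_near z f -> smooth_near z g ->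
  'J (fun x => row_mx (f x) (g x)) z = row_mx ('J f z) ('J g z).
Proof.
move=> sf sg; apply: jacobianE => [|v].
  exact: smooth_near_diff (smooth_near_row_mx sf sg).
rewrite derive_row_mx // mul_mx_row -!deriveEjacobian //; exact: smooth_near_diff.
Qed.

Lemma smooth_near_mulr N p (K : 'M[R]_(N, p)) (z : 'rV[R]_N) :
  smooth_near z (fun x => x *m K).
Proof. exact: smooth_near_mulmxr (smooth_near_id _). Qed.

Lemma jacobian_mulr N p (K : 'M[R]_(N, p)) (z : 'rV[R]_N) :
  'J (fun x => x *m K) z = K.
Proof.
apply: jacobianE => [|v]; first exact: smooth_near_diff (smooth_near_mulr _ _).
by rewrite derive_mulmxr ?derive_id.
Qed.

Lemma local_diffeo_rank N M (f : 'rV[R]_N -> 'rV[R]_M) z : M = N ->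
  smooth_near z f -> \rank ('J f z) = N -> local_diffeo z f.
Proof.
move=> E; subst M => sf rJ; apply: inverse_function => //.
by rewrite -row_free_unit; apply/eqP.
Qed.

Lemma submersion_chart N p (c : 'rV[R]_N -> 'rV[R]_p) z :
  smooth_near z c -> \rank ('J c z) = p ->
  exists q (K : 'M[R]_(N, q)), (p + q)%N = N /\
    local_diffeo z (fun x => row_mx (c x) (x *m K)).
Proof.
move=> sc rc; have [q [K [pq rK]]] := complete_cols rc.
exists q, K; split=> //; apply: local_diffeo_rank => //.
  exact: smooth_near_row_mx sc (smooth_near_mulr _ _).
by rewrite jacobian_row_mx ?jacobian_mulr //; exact: smooth_near_mulr.
Qed.

Lemma near_comp (V W : normedModType R) z (f : V -> W) (P : W -> Prop) :
  smooth_near z f -> (\forall y \near f z, P y) -> \forall x \near z, P (f x).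
Proof. by move=> /smooth_near_cont cf Pn; exact: cf Pn. Qed.

Lemma inverse_jacobian N M (f : 'rV[R]_N -> 'rV[R]_M) (g : 'rV[R]_M -> 'rV[R]_N)
    z : smooth_near z f -> smooth_near (f z) g ->
  (\forall x \near z, g (f x) = x) ->
  \forall x \near z, 'J f x *m 'J g (f x) = 1%:M.
Proof.
move=> sf sg gf; have gf2 := near_join gf.
have sfo := smooth_near_open sf.
have sgo : \forall x \near z, smooth_near (f x) g.
  exact: near_comp sf (smooth_near_open sg).
near=> x.
have sfx : smooth_near x f by exact: (near sfo x).
have sgx : smooth_near (f x) g by exact: (near sgo x).
have gfx : \forall y \near x, g (f y) = y by exact: (near gf2 x).
have [dfx dgx] := (smooth_near_diff sfx, smooth_near_diff sgx).
rewrite -jacobian_comp // (near_eq_jacobian gfx); last first.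
  exact: differentiable_comp.
by apply: jacobianE => [|v]; [exact: smooth_near_diff (smooth_near_id _)|
  rewrite derive_id mulmx1].
Unshelve. all: by end_near. Qed.

(** The chart completes c by linear coordinates; the section freezes these at their value at z. *)
Lemma local_section N p (c : 'rV[R]_N -> 'rV[R]_p) z :
  smooth_near z c -> \rank ('J c z) = p ->
  exists s : 'rV[R]_p -> 'rV[R]_N, [/\ smooth_near (c z) s, s (c z) = z &
    \forall y \near c z, c (s y) = y].
Proof.
move=> sc rc; have [q [K [pq [sPhi [Psi [sPsi PsiPhi PhiPsi]]]]]] :=
  submersion_chart sc rc.
pose w (y : 'rV[R]_p) := row_mx y (z *m K).
have sw y : smooth_near y w.
  exact: smooth_near_row_mx (smooth_near_id _) (smooth_near_cst _ _).
exists (fun y => Psi (w y)); split.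
- exact: smooth_near_comp (sw _) sPsi.
- exact: nbhs_singleton PsiPhi.
- have H : \forall y \near c z,
      row_mx (c (Psi (w y))) (Psi (w y) *m K) = w y.
    exact: near_comp (sw _) PhiPsi.
  near=> y; have : row_mx (c (Psi (w y))) (Psi (w y) *m K) = w y.
    exact: (near H y).
  by case/eq_row_mx.
Unshelve. all: by end_near. Qed.

(** The norm is a maximum of entries and need not be differentiable, so the sum of squares [psi]
    replaces it: psi' <= C psi, hence psi multiplied by [expR (- C * t)] does not exceed its initial
    value 0. *)
Lemma gronwall_zero p q (phi : R -> 'M[R]_(p, q)) (L : R) : 0 <= L ->
  (forall t : R, 0 <= t <= 1 -> differentiable phi t) ->
  (forall t : R, 0 <= t <= 1 -> `|'D_1 phi t| <= L * `|phi t|) ->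
  phi 0 = 0 -> phi 1 = 0.
Proof.
move=> L0 dphi Dphi phi0.
pose psi (t : R) : R := \sum_i \sum_j phi t i j ^+ 2.
(* Each of the p q summands of psi' is at most 2 L psi. *)
pose C : R := p%:R * (q%:R * (2 * L)).
have nle t i j : `|phi t i j| <= `|phi t| by exact: ler_mxnorm_entry.
have psi_ge t : `|phi t| ^+ 2 <= psi t.
  have [/mx_norm_eq0|] := eqVneq (mx_norm (phi t)) 0.
    move=> ->; rewrite normr0 expr0n /=; apply: sumr_ge0 => i _.
    by apply: sumr_ge0 => j _; exact: sqr_ge0.
  move=> /mx_norm_neq0[[i j] /=]; rewrite -[mx_norm _]/(`|phi t|) => ->.
  rewrite real_normK ?num_real // /psi (bigD1 i) //= (bigD1 j) //= -addrA.
  rewrite lerDl addr_ge0 //; apply: sumr_ge0 => k _; first exact: sqr_ge0.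
  by apply: sumr_ge0 => l _; exact: sqr_ge0.
pose dpsi (t : R) : R := \sum_i \sum_j 2 * phi t i j * ('D_1 phi t) i j.
have is_dpsi (t : R) : 0 <= t <= 1 -> is_derive t 1 psi (dpsi t).
  move=> t01; have dp := dphi t t01.
  have -> : psi = \sum_i \sum_j ((fun t => phi t i j) ^+ 2 : R -> R).
    by apply/funext => s; rewrite /psi fct_sumE; apply: eq_bigr => i _;
      rewrite fct_sumE.
  apply: is_derive_sum => i; apply: is_derive_sum => j.
  have dij : is_derive t 1 (fun t => phi t i j : R) (('D_1 phi t) i j).
    rewrite derive_entry //; apply/derivableP/diff_derivable.
    exact: differentiable_entry.
  by apply: is_derive_eq; rewrite expr1.
have dpsi_le (t : R) : 0 <= t <= 1 -> dpsi t <= C * psi t.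
  move=> t01.
  have -> : C * psi t = \sum_(i < p) \sum_(j < q) 2 * L * psi t.
    by rewrite !sumr_const !card_ord -[RHS]mulr_natl -[X in _ = _ * X]mulr_natl /C
      -!mulrA.
  apply: ler_sum => i _; apply: ler_sum => j _.
  apply: (@le_trans _ _ (2 * (`|phi t| * (L * `|phi t|)))).
    rewrite -mulrA ler_wpM2l // (le_trans (ler_norm _)) // normrM.
    apply: ler_pM => //.
    exact: le_trans (ler_mxnorm_entry _ _ _) (Dphi t t01).
  by rewrite -!mulrA ler_wpM2l // mulrCA ler_wpM2l // -expr2.
pose E (t : R) : R := psi t * expR (- C * t).
pose dE (t : R) : R := (dpsi t - C * psi t) * expR (- C * t).
have is_dE (t : R) : 0 <= t <= 1 -> is_derive t 1 E (dE t).
  move=> t01; have dp := is_dpsi t t01.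
  have de : is_derive t 1 (fun t : R => expR (- C * t)) (expR (- C * t) * - C).
    have dl : is_derive t 1 (fun t : R => - C * t) (- C).
      by apply: is_derive_eq; rewrite [LHS]mulr1.
    exact: (@is_derive1_comp R expR (fun t : R => - C * t) t _ _ _ dl).
  apply: is_derive_eq; rewrite /dE /GRing.scale /=; ring.
have [|t|c] := @MVT_segment R E dE 0 1 ler01.
- by move=> t; rewrite in_itv /= => /andP[t0 t1]; apply: is_dE; rewrite !ltW.
- apply: derivable_within_continuous => {}t; rewrite in_itv /= => t01.
  by have [] := is_dE t t01.
rewrite in_itv /= subr0 mulr1 => c01 E01.
have dE0 : dE c <= 0.
  by rewrite /dE pmulr_lle0 ?expR_gt0 // subr_le0 dpsi_le.
have psi0 : psi 0 = 0.
  rewrite /psi phi0 big1 // => i _; rewrite big1 // => j _.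
  by rewrite mxE expr0n.
have : E 1 <= 0 by move: E01 dE0; rewrite /E psi0 mul0r subr0 => ->.
rewrite /E pmulr_lle0 ?expR_gt0 // => psi1.
have := le_trans (psi_ge 1) psi1.
by move=> H; apply/eqP; rewrite -normr_eq0 -sqrf_eq0 eq_le H sqr_ge0.
Qed.

Lemma nbhs_ball_shrink (V : normedModType R) (z : V) (A : set V) :
  (\forall x \near z, A x) -> exists e : R, 0 < e /\ forall x, ball z e x -> A x.
Proof. by move=> /nbhs_ballP[e /= e0 H]; exists e. Qed.

(** In the chart given by c and complementary linear coordinates a fibre is an affine slice, so two
    of its points are joined by a segment. The inverse chart maps the segment to a path in the fibre
    with bounded speed. *)
Lemma fibre_path N p (c : 'rV[R]_N -> 'rV[R]_p) z (A : set 'rV[R]_N) :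
  smooth_near z c -> \rank ('J c z) = p -> (\forall x \near z, A x) ->
  exists K d : R, [/\ 0 <= K, 0 < d & forall x x',
    ball z d x -> ball z d x' -> c x = c x' ->
    exists gam : R -> 'rV[R]_N, [/\ gam 0 = x, gam 1 = x' &
      forall t : R, 0 <= t <= 1 -> [/\ A (gam t), differentiable gam t,
        `|'D_1 gam t| <= K & 'D_1 gam t *m 'J c (gam t) = 0]]].
Proof.
move=> sc rc nA; have [q [M [pq [sPhi [Psi [sPsi PsiPhi PhiPsi]]]]]] :=
  submersion_chart sc rc.
pose Phi x := row_mx (c x) (x *m M).
have Psiz : Psi (Phi z) = z := nbhs_singleton PsiPhi.
have JJ : \forall w \near Phi z, 'J Psi w *m 'J Phi (Psi w) = 1%:M.
  apply: inverse_jacobian sPsi _ PhiPsi; rewrite Psiz; exact: sPhi.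
have JPhi : \forall w \near Phi z,
    'J Phi (Psi w) = row_mx ('J c (Psi w)) M.
  have sco : \forall w \near Phi z, smooth_near (Psi w) c.
    have H : \forall x \near Psi (Phi z), smooth_near x c.
      by rewrite Psiz; exact: smooth_near_open sc.
    exact: near_comp sPsi H.
  near=> w; have s1 : smooth_near (Psi w) c by exact: (near sco w).
  by rewrite jacobian_row_mx // ?jacobian_mulr //; exact: smooth_near_mulr.
have An : \forall w \near Phi z, A (Psi w).
  by apply: near_comp sPsi _; rewrite Psiz; exact: nA.
have Jb : \forall w \near Phi z, `|'J Psi w| <= `|'J Psi (Phi z)| + 1.
  have := smooth_near_cont (smooth_near_jacobian sPsi).
  by move=> /cvgr_norm_le; apply; rewrite ltrDl.
have so := smooth_near_open sPsi.
have : \forall w \near Phi z, [/\ A (Psi w), smooth_near w Psi,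
    `|'J Psi w| <= `|'J Psi (Phi z)| + 1 &
    'J Psi w *m row_mx ('J c (Psi w)) M = 1%:M].
  near=> w; split; [exact: (near An w)|exact: (near so w)|exact: (near Jb w)|].
  have <- : 'J Phi (Psi w) = row_mx ('J c (Psi w)) M by exact: (near JPhi w).
  exact: (near JJ w).
move=> /nbhs_ball_shrink[e [e0 He]].
have Phie : \forall x \near z, ball (Phi z) e (Phi x).
  by apply: near_comp sPhi _; exact: nbhsx_ballx.
have : \forall x \near z, ball (Phi z) e (Phi x) /\ Psi (Phi x) = x.
  by near=> x; split; [exact: (near Phie x)|exact: (near PsiPhi x)].
move=> /nbhs_ball_shrink[d [d0 Hd]].
(* Both ends of the segment lie within e of [Phi z], so its length is at most 2 e; the last factor
   bounds the Jacobian of the inverse chart. *)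
exists ((p + q)%:R * (2 * e) * (`|'J Psi (Phi z)| + 1)), d; split => //.
  by rewrite !mulr_ge0 ?addr_ge0 // ltW.
move=> x x' /Hd[bx Px] /Hd[bx' Px'] cxx'.
pose v := Phi x' - Phi x.
exists (fun t : R => Psi (Phi x + t *: v)); split.
- by rewrite scale0r addr0.
- by rewrite scale1r /v subrKC.
move=> t t01; set w := Phi x + t *: v.
have [Aw sw Jw JJw] := He _ (ball_segment t01 bx bx').
have dl := is_diff_affine (Phi x) v t; have dw := smooth_near_diff sw.
have Dg : 'D_1 (fun t : R => Psi (Phi x + t *: v)) t = v *m 'J Psi w.
  have -> := derive_comp (f := fun s : R => Phi x + s *: v) 1 _ dw => //.
  by rewrite derive_affine scale1r deriveEjacobian.
split=> //.
- apply: (@differentiable_comp _ _ _ _ (fun t : R => Phi x + t *: v) Psi) => //.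
- rewrite Dg (le_trans (mxnormM_le _ _)) //; apply: ler_pM => //.
  apply: ler_wpM2l => //.
  move: bx bx'; rewrite -!ball_normE /= => bx bx'.
  have -> : v = (Phi z - Phi x) - (Phi z - Phi x').
    by rewrite opprB addrC subrKA.
  by rewrite (le_trans (ler_normB _ _)) // mulr_natl mulr2n lerD // ltW.
- rewrite Dg -mulmxA; move: JJw; rewrite mul_mx_row.
  have -> : (1%:M : 'M[R]_(p + q)) =
      row_mx (col_mx 1%:M 0) (col_mx 0 1%:M) by
    rewrite scalar_mx_block block_mxEh.
  move=> /eq_row_mx[-> _].
  have -> : v = row_mx 0 (x' *m M - x *m M).
    by rewrite /v /Phi cxx' opp_row_mx add_row_mx subrr.
  by rewrite mul_row_col mul0mx mulmx0 addr0.
Unshelve. all: by end_near. Qed.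

(** Gronwall along the paths of [fibre_path]. The radius d is fixed before g and L are given, so
    that g may depend on the point where the path starts, as it does in [fibre_constant]. *)
Lemma fibre_vanish N p (c : 'rV[R]_N -> 'rV[R]_p) z (A : set 'rV[R]_N) :
  smooth_near z c -> \rank ('J c z) = p -> (\forall x \near z, A x) ->
  exists d : R, 0 < d /\
    forall a b (g : 'rV[R]_N -> 'M[R]_(a, b)) (L : R), 0 <= L ->
    (forall x, A x -> differentiable g x /\
      forall v, v *m 'J c x = 0 -> `|'D_v g x| <= L * `|v| * `|g x|) ->
    forall x x', ball z d x -> ball z d x' -> c x = c x' -> g x = 0 ->
    g x' = 0.
Proof.
move=> sc rc nA; have [K [d [K0 d0 H]]] := fibre_path sc rc nA.
exists d; split=> // a b g L L0 gA x x' bx bx' cxx' gx0.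
have [gam [g0 g1 Hg]] := H x x' bx bx' cxx'; rewrite -g1.
apply: (@gronwall_zero _ _ (fun t => g (gam t)) (L * K)) => //; last by rewrite g0.
- exact: mulr_ge0.
- by move=> t /Hg[At dt _ _]; apply: differentiable_comp => //; exact: (gA _ At).1.
move=> t /Hg[At dt Dt Jt]; have [dg Dg] := gA _ At.
rewrite derive_comp //; apply: (le_trans (Dg _ Jt)).
by rewrite ler_wpM2r // ler_wpM2l.
Qed.

(** This is [fibre_vanish] with constant 0, applied to g minus its value at x. *)
Lemma fibre_factor N p (c : 'rV[R]_N -> 'rV[R]_p) (s : 'rV[R]_p -> 'rV[R]_N)
    z a b (g : 'rV[R]_N -> 'M[R]_(a, b)) :
  smooth_near z c -> \rank ('J c z) = p ->
  smooth_near (c z) s -> s (c z) = z -> (\forall y \near c z, c (s y) = y) ->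
  smooth_near z g ->
  (\forall x \near z, forall v, v *m 'J c x = 0 -> 'D_v g x = 0) ->
  \forall x \near z, g (s (c x)) = g x.
Proof.
move=> sc rc ss sz cs sg Dg; have sgo := smooth_near_open sg.
pose A x := smooth_near x g /\ forall v, v *m 'J c x = 0 -> 'D_v g x = 0.
have nA : \forall x \near z, A x.
  by near=> x; split; [exact: (near sgo x)|exact: (near Dg x)].
have [d [d0 H]] := fibre_vanish sc rc nA.
have b1 : \forall x \near z, ball z d x by exact: nbhsx_ballx.
have b2 : \forall x \near z, ball z d (s (c x)).
  apply: near_comp (smooth_near_comp sc ss) _; rewrite sz.
  exact: nbhsx_ballx.
have b3 : \forall x \near z, c (s (c x)) = c x by exact: near_comp sc cs.
near=> x; apply/eqP; rewrite -subr_eq0; apply/eqP.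
apply: (H _ _ (fun y => g y - g x) 0 _ _ x (s (c x))) => //; last 4 first.
- exact: (near b1 x).
- exact: (near b2 x).
- by apply/esym; exact: (near b3 x).
- by rewrite subrr.
move=> y [sy Dy]; have dy := smooth_near_diff sy.
have dgx : differentiable (fun y => g y - g x) y.
  exact: smooth_near_diff (smooth_near_sub sy (smooth_near_cst _ _)).
split=> // v /Dy Dv0.
rewrite deriveB; [|exact: diff_derivable|exact: derivable_cst].
by rewrite derive_cst Dv0 subr0 normr0 !mul0r.
Unshelve. all: by end_near. Qed.

(** Zeros of g are known on the single fibre through z, so the derivative is computed along a curve
    that stays in this fibre: a line in the chart, carried back by the inverse chart. *)
Lemma fibre_tangent N p (c : 'rV[R]_N -> 'rV[R]_p) z a b
    (g : 'rV[R]_N -> 'M[R]_(a, b)) :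
  smooth_near z c -> \rank ('J c z) = p -> smooth_near z g ->
  (\forall x \near z, c x = c z -> g x = 0) ->
  \forall x \near z, c x = c z -> forall v, v *m 'J c x = 0 -> 'D_v g x = 0.
Proof.
move=> sc rc sg g0; have [q [M [pq [sPhi [Psi [sPsi PsiPhi PhiPsi]]]]]] :=
  submersion_chart sc rc.
pose Phi x := row_mx (c x) (x *m M).
have Psiz : Psi (Phi z) = z := nbhs_singleton PsiPhi.
have JJ := inverse_jacobian sPhi sPsi PsiPhi.
have sco := smooth_near_open sc; have sgo := smooth_near_open sg.
have g0' : \forall w \near Phi z, lsubmx w = c z -> g (Psi w) = 0.
  have H : \forall w \near Phi z, c (Psi w) = c z -> g (Psi w) = 0.
    have H : \forall x \near Psi (Phi z), c x = c z -> g x = 0.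
      by rewrite Psiz; exact: g0.
    exact: near_comp sPsi H.
  near=> w => wz.
  have E : row_mx (c (Psi w)) (Psi w *m M) = w by exact: (near PhiPsi w).
  have Hw : c (Psi w) = c z -> g (Psi w) = 0 by exact: (near H w).
  by apply: Hw; rewrite -wz -E row_mxKl E.
have g0n := near_comp sPhi (near_join g0').
have sPsio := near_comp sPhi (smooth_near_open sPsi).
near=> x => cx v vJ.
have sgx : smooth_near x g by exact: (near sgo x).
have scx : smooth_near x c by exact: (near sco x).
have sPx : smooth_near (Phi x) Psi by exact: (near sPsio x).
have Px : Psi (Phi x) = x by exact: (near PsiPhi x).
have JJx : 'J Phi x *m 'J Psi (Phi x) = 1%:M by exact: (near JJ x).
have gx : \forall w \near Phi x, lsubmx w = c z -> g (Psi w) = 0.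
  exact: (near g0n x).
(* This is v read in the chart; its first block vanishes because v is tangent to the fibre. *)
pose u : 'rV[R]_(p + q) := row_mx 0 (v *m M).
have uv : u *m 'J Psi (Phi x) = v.
  rewrite -[RHS]mulmx1 -JJx mulmxA; congr (_ *m _).
  rewrite jacobian_row_mx ?jacobian_mulr //; last exact: smooth_near_mulr.
  by rewrite mul_mx_row vJ.
have dPx : differentiable Psi (Phi x + 0 *: u).
  by rewrite scale0r addr0; exact: smooth_near_diff.
have d1 : differentiable (fun t : R => Psi (Phi x + t *: u)) 0.
  exact: (@differentiable_comp _ _ _ _ (fun t : R => Phi x + t *: u) Psi).
have Dg : 'D_1 (fun t : R => Psi (Phi x + t *: u)) 0 = v.
  have -> := derive_comp (f := fun s : R => Phi x + s *: u) 1 _ dPx => //.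
  rewrite derive_affine scale1r scale0r addr0 deriveEjacobian //.
  exact: smooth_near_diff.
have dgx : differentiable g (Psi (Phi x + 0 *: u)).
  by rewrite scale0r addr0 Px; exact: smooth_near_diff.
have := derive_comp (f := fun t : R => Psi (Phi x + t *: u)) 1 d1 dgx.
rewrite Dg scale0r addr0 Px => <-.
have -> : 'D_1 (fun t : R => g (Psi (Phi x + t *: u))) 0 = 'D_1 (cst 0) (0 : R).
  apply: near_eq_derive.
  have la : (fun t : R => Phi x + t *: u) @ (0 : R) --> Phi x.
    have dc : differentiable (fun t : R => Phi x + t *: u) (0 : R) by [].
    have := differentiable_continuous dc.
    by rewrite /prop_for /continuous_at [X in _ --> X](_ : _ = Phi x) // scale0r addr0.
  have H : \forall t \near (0 : R), lsubmx (Phi x + t *: u) = c z ->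
      g (Psi (Phi x + t *: u)) = 0 := la _ gx.
  near=> t.
  have Ht : lsubmx (Phi x + t *: u) = c z -> g (Psi (Phi x + t *: u)) = 0.
    exact: (near H t).
  rewrite Ht //; rewrite -cx /Phi /u scale_row_mx scaler0 add_row_mx addr0.
  by rewrite row_mxKl.
exact: derive_cst.
Unshelve. all: by end_near. Qed.

End Submersion.

(** * Codistributions *)

Section Codistributions.
Context {R : realType}.

(** The Moore-Penrose right inverse of a matrix of full row rank; it depends smoothly on M. *)
Definition rinv k N (M : 'M[R]_(k, N)) : 'M[R]_(N, k) := M^T *m invmx (M *m M^T).

Lemma row_sqr_eq0 N (u : 'rV[R]_N) : u *m u^T = 0 -> u = 0.
Proof.
move=> /matrixP /(_ 0 0); rewrite !mxE => /eqP.
rewrite psumr_eq0 => [/allP H|i _]; last by rewrite mxE -expr2 sqr_ge0.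
apply/rowP => i; have := H i (mem_index_enum i).
by rewrite !mxE /= -expr2 sqrf_eq0 => /eqP.
Qed.

Lemma gram_unit k N (M : 'M[R]_(k, N)) : row_free M -> M *m M^T \in unitmx.
Proof.
move=> fM; rewrite -row_free_unit; apply: inj_row_free => v vMM.
have : v *m M *m (v *m M)^T = 0 by rewrite trmx_mul !mulmxA -[v *m M *m _]mulmxA vMM mul0mx.
by move=> /row_sqr_eq0 vM; apply: (row_free_inj fM); rewrite vM mul0mx.
Qed.

Lemma mul_rinv k N (M : 'M[R]_(k, N)) : row_free M -> M *m rinv M = 1%:M.
Proof. by move=> /gram_unit u; rewrite /rinv mulmxA mulmxV. Qed.

Lemma smooth_near_rinv (V : normedModType R) k N z (M : V -> 'M[R]_(k, N)) :
  smooth_near z M -> row_free (M z) -> smooth_near z (fun x => rinv (M x)).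
Proof.
move=> sM /gram_unit u; have sT := smooth_near_tr sM.
exact: smooth_near_mulmx sT (smooth_near_invmx (smooth_near_mulmx sM sT) u).
Qed.

Lemma near_row_free (V : normedModType R) k N z (M : V -> 'M[R]_(k, N)) :
  smooth_near z M -> row_free (M z) -> \forall x \near z, row_free (M x).
Proof.
move=> sM /gram_unit u; have sT := smooth_near_tr sM.
have nu := near_unitmx (smooth_near_mulmx sM sT) u.
near=> x; apply: inj_row_free => v vM.
have ux : M x *m (M x)^T \in unitmx by exact: (near nu x).
by rewrite -[v](mulmxK ux) mulmxA vM !mul0mx.
Unshelve. all: by end_near. Qed.

Lemma submx_rinv k N (M : 'M[R]_(k, N)) (w : 'rV[R]_N) : row_free M ->
  (w <= M)%MS -> w = w *m rinv M *m M.
Proof. by move=> fM /submxP[c ->]; rewrite -[c *m M *m _]mulmxA mul_rinv // mulmx1. Qed.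

(** Membership becomes a condition in each nearby cotangent space, which rank arguments can handle;
    [codist_spanE] identifies it with the module span when the rows are independent. *)
Definition pointwise_span k N (z0 : 'rV[R]_N) (M : 'rV[R]_N -> 'M[R]_(k, N)) :=
  [set w : 'rV[R]_N -> 'rV[R]_N | smooth_near z0 w /\
    \forall z \near z0, (w z <= M z)%MS].

Lemma codistribution_pointwise_span k N (z0 : 'rV[R]_N)
    (M : 'rV[R]_N -> 'M[R]_(k, N)) : codistribution z0 (pointwise_span z0 M).
Proof.
split.
- by move=> w [].
- split; first exact: smooth_near_cst.
  by near=> z; exact: sub0mx.
- move=> w w' [sw wM] [sw' wM']; split; first exact: smooth_near_add.
  by near=> z; apply: addmx_sub; [exact: (near wM z)|exact: (near wM' z)].
- move=> g w sg [sw wM]; split; first exact: smooth_near_scale.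
  by near=> z; apply: scalemx_sub; exact: (near wM z).
- move=> w w' [sw wM] ww'; split; first exact: smooth_near_eq ww' sw.
  near=> z; have <- : w z = w' z by exact: (near ww' z).
  exact: (near wM z).
Unshelve. all: by end_near. Qed.

Lemma codistribution_comb k N (z0 : 'rV[R]_N) P
    (b : 'I_k -> 'rV[R]_N -> 'rV[R]_N) (c : 'I_k -> 'rV[R]_N -> R^o) :
  codistribution z0 P -> (forall i, P (b i)) -> (forall i, smooth_near z0 (c i)) ->
  P (fun z => \sum_i c i z *: b i z).
Proof.
move=> [_ P0 PD PZ Peq] Pb sc; elim: (index_enum _) => [|i r IH].
  by apply: Peq P0 _; near=> z; rewrite big_nil.
apply: Peq (PD _ _ (PZ (c i) _ (sc i) (Pb i)) IH) _.
by near=> z; rewrite big_cons.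
Unshelve. all: by end_near. Qed.

(** The smooth right inverse recovers the coefficients, so pointwise membership yields smooth
    coefficients. *)
Lemma codist_spanE k N (z0 : 'rV[R]_N) (b : 'I_k -> 'rV[R]_N -> 'rV[R]_N) :
  (forall i, smooth_near z0 (b i)) -> row_free (\matrix_(i < k) b i z0) ->
  codist_span z0 (range b) = pointwise_span z0 (fun z => \matrix_(i < k) b i z).
Proof.
move=> sb fb; have sM := smooth_near_rows sb.
have fM := near_row_free sM fb.
apply/seteqP; split.
  apply: smallest_sub; first exact: codistribution_pointwise_span.
  move=> _ [i _ <-]; split; first exact: sb.
  near=> z; have -> : b i z = row i (\matrix_(i < k) b i z) by rewrite rowK.
  exact: row_sub.
move=> w [sw wM] P [cP bP].
pose c z := w z *m rinv (\matrix_(i < k) b i z).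
have sc : smooth_near z0 c.
  exact: smooth_near_mulmx sw (smooth_near_rinv sM fb).
have [_ _ _ _ Peq] := cP.
have Pc : P (fun z => \sum_i (c z 0 i : R^o) *: b i z).
  apply: (codistribution_comb cP) => i; first by apply: bP; exists i.
  by move/smooth_near_mxP: sc; exact.
apply: Peq Pc _; near=> z.
have fz : row_free (\matrix_(i < k) b i z) by exact: (near fM z).
have wz : (w z <= \matrix_(i < k) b i z)%MS by exact: (near wM z).
rewrite [RHS](submx_rinv fz wz) mulmx_sum_row.
by apply: eq_bigr => i _; rewrite rowK.
Unshelve. all: by end_near. Qed.

Lemma has_dimP N (z0 : 'rV[R]_N) P r : has_dim z0 P r <->
  exists M : 'rV[R]_N -> 'M[R]_(r, N), [/\ smooth_near z0 M, row_free (M z0) &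
    P = pointwise_span z0 M].
Proof.
split=> [[b [sb /nbhs_singleton fb ->]]|[M [sM fM ->]]].
  exists (fun z => \matrix_(i < r) b i z).
  by split; [exact: smooth_near_rows|exact: fb|exact: codist_spanE].
have ME z : \matrix_(i < r) row i (M z) = M z by apply/row_matrixP => i; rewrite rowK.
have sb i : smooth_near z0 (fun z => row i (M z)) by exact: smooth_near_row.
exists (fun i z => row i (M z)); split; first exact: sb.
- have nf := near_row_free sM fM; near=> z; rewrite ME; exact: (near nf z).
- rewrite codist_spanE ?ME //.
  by congr pointwise_span; apply/funext => z; rewrite ME.
Unshelve. all: by end_near. Qed.

Lemma pointwise_span_dim k l N (z0 : 'rV[R]_N) (M : 'rV[R]_N -> 'M[R]_(k, N))
    (M' : 'rV[R]_N -> 'M[R]_(l, N)) :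
  smooth_near z0 M -> row_free (M z0) ->
  pointwise_span z0 M `<=` pointwise_span z0 M' -> (M z0 <= M' z0)%MS.
Proof.
move=> sM fM MM'; apply/row_subP => i.
have : pointwise_span z0 M (fun z => row i (M z)).
  split; first exact: smooth_near_row.
  by near=> z; exact: row_sub.
by move=> /MM'[_ /nbhs_singleton].
Unshelve. all: by end_near. Qed.

Lemma dform_jacobian N p (f : 'rV[R]_N -> 'rV[R]_p) z i : differentiable f z ->
  dform (fun z => f z 0 i) z = row i ('J f z)^T.
Proof.
move=> df; apply/rowP => j; rewrite [LHS]mxE -derive_entry // deriveEjacobian // -rowE.
by rewrite [LHS]mxE [RHS]mxE [RHS]mxE.
Qed.

Lemma pullbackE N p (f : 'rV[R]_N -> 'rV[R]_p) w z : differentiable f z ->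
  pullback f w z = w (f z) *m ('J f z)^T.
Proof.
move=> df; rewrite mulmx_sum_row /pullback; apply: eq_bigr => i _.
by rewrite dform_jacobian.
Qed.

Lemma contractionE N (v w : 'rV[R]_N -> 'rV[R]_N) z :
  Defs.contraction v w z = (v z *m (w z)^T) 0 0.
Proof. by rewrite /Defs.contraction mxE; apply: eq_bigr => i _; rewrite mxE. Qed.

Lemma schwarz_mx N p q (f : 'rV[R]_N -> 'M[R]_(p, q)) z v w : smooth_near z f ->
  'D_w (fun x => 'D_v f x) z = 'D_v (fun x => 'D_w f x) z.
Proof.
move=> sf; have sDv := smooth_near_derive v sf.
have sDw := smooth_near_derive w sf; have sfo := smooth_near_open sf.
apply/matrixP => i j.
have Dij u : \forall x \near z, ('D_u f x) i j = 'D_u (fun y => f y i j : R^o) x.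
  near=> x; rewrite derive_entry //; apply: smooth_near_diff.
  exact: (near sfo x).
have E u u' (sDu : smooth_near z (fun x => 'D_u f x)) :
    ('D_u' (fun x => 'D_u f x) z) i j =
    'D_u' (fun x => 'D_u (fun y => f y i j : R^o) x) z.
  exact: etrans (derive_entry u' i j (smooth_near_diff sDu))
    (near_eq_derive u' (Dij u)).
have sfij : smooth_near z (fun x => f x i j : R^o) by move/smooth_near_mxP: sf.
exact: etrans (E v w sDv) (etrans (schwarz v w sfij) (esym (E w v sDw))).
Unshelve. all: by end_near. Qed.

Lemma jacobian_row N p (f : 'rV[R]_N -> 'rV[R]_p) z i : differentiable f z ->
  row i ('J f z) = 'D_(delta_mx 0 i) f z.
Proof. by move=> df; rewrite rowE deriveEjacobian. Qed.

(** Differentiating v J f = 0 in direction e_i produces second derivatives of f, and Schwarz turns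
    them into the derivative of the Jacobian along v. In terms of forms, L_v df^i is the
    differential of the contraction of v with df^i, hence 0. *)
Lemma derive_jacobian_kernel N p (f : 'rV[R]_N -> 'rV[R]_p)
    (v : 'rV[R]_N -> 'rV[R]_N) z :
  smooth_near z f -> smooth_near z v -> (\forall x \near z, v x *m 'J f x = 0) ->
  'D_(v z) (fun x => 'J f x) z + 'J v z *m 'J f z = 0.
Proof.
move=> sf sv vJ; have sJ := smooth_near_jacobian sf.
have sfo := smooth_near_open sf.
have [[df dv] dJ] := (smooth_near_diff sf, smooth_near_diff sv, smooth_near_diff sJ).
apply/row_matrixP => i; rewrite row0 linearD /= row_mul jacobian_row //.
have E1 : row i ('D_(v z) (fun x => 'J f x) z) =
    'D_(delta_mx 0 i) (fun x => 'D_(v z) f x) z.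
  rewrite schwarz_mx // rowE -(derive_linear (L := mulmx (delta_mx 0 i))) //;
    last exact: continuous_linear_mx.
  apply: near_eq_derive; near=> x; rewrite /= -rowE jacobian_row //.
  by apply: smooth_near_diff; exact: (near sfo x).
have E2 : 'D_(delta_mx 0 i) (fun x => 'D_(v z) f x) z =
    v z *m 'D_(delta_mx 0 i) (fun x => 'J f x) z.
  rewrite -(derive_linear (L := mulmx (v z))) //; last exact: continuous_linear_mx.
  apply: near_eq_derive; near=> x; rewrite /= deriveEjacobian //.
  by apply: smooth_near_diff; exact: (near sfo x).
rewrite E1 E2 addrC -derive_mulmx // (near_eq_derive _ vJ).
exact: derive_cst.
Unshelve. all: by end_near. Qed.

End Codistributions.

(** * Forms of the system and their coefficients over df *)

Section SystemForms.
Context {R : realType} (n m : nat) (f : 'rV[R]_(n + m) -> 'rV[R]_n)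
  (z0 : 'rV[R]_(n + m)).
Hypothesis sf : smooth_near z0 f.
Hypothesis rJ : \rank ('J f z0) = n.

Let JT z := ('J f z)^T.

Let sJT : smooth_near z0 JT.
Proof. exact: smooth_near_tr (smooth_near_jacobian sf). Qed.

Let fJT : row_free (JT z0).
Proof. by rewrite /row_free /JT mxrank_tr rJ. Qed.

Lemma pointwise_span_near k N (y : 'rV[R]_N) (M M' : 'rV[R]_N -> 'M[R]_(k, N)) :
  (\forall z \near y, M z = M' z) -> pointwise_span y M = pointwise_span y M'.
Proof.
move=> MM'; apply/seteqP; split=> w [sw wM]; split=> //; near=> z.
  have <- : M z = M' z by exact: (near MM' z).
  exact: (near wM z).
have -> : M z = M' z by exact: (near MM' z).
exact: (near wM z).
Unshelve. all: by end_near. Qed.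

Lemma df_matrix : \forall z \near z0, \matrix_(i < n) df f i z = JT z.
Proof.
have sfo := smooth_near_open sf; near=> z; apply/row_matrixP => i.
rewrite rowK /df dform_jacobian //; apply: smooth_near_diff.
exact: (near sfo z).
Unshelve. all: by end_near. Qed.

Lemma span_dfE : span_df f z0 = pointwise_span z0 JT.
Proof.
rewrite /span_df codist_spanE; last 2 first.
- move=> i; have H := df_matrix.
  apply: smooth_near_eq (smooth_near_row i sJT); near=> z.
  have <- : \matrix_(i < n) df f i z = JT z by exact: (near H z).
  by rewrite rowK.
- by rewrite (nbhs_singleton df_matrix).
exact: pointwise_span_near df_matrix.
Unshelve. all: by end_near. Qed.

Lemma lsubmx_mul k (A : 'M[R]_(k, n + m)) : lsubmx A = A *m col_mx 1%:M 0.
Proof. by rewrite -[in RHS](hsubmxK A) mul_row_col mulmx1 mulmx0 addr0. Qed.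

Lemma rsubmx_mul k (A : 'M[R]_(k, n + m)) : rsubmx A = A *m col_mx 0 1%:M.
Proof. by rewrite -[in RHS](hsubmxK A) mul_row_col mulmx1 mulmx0 add0r. Qed.

Lemma jacobian_lsubmx (z : 'rV[R]_(n + m)) :
  'J (fun z : 'rV[R]_(n + m) => lsubmx z) z = col_mx 1%:M 0.
Proof. by under eq_fun do rewrite lsubmx_mul; exact: jacobian_mulr. Qed.

Lemma dx_matrix z : \matrix_(i < n) @dx R n m i z = row_mx 1%:M 0.
Proof.
apply/row_matrixP => i; rewrite rowK /dx dform_jacobian.
  by rewrite jacobian_lsubmx tr_col_mx trmx1 trmx0.
exact: smooth_near_diff (smooth_near_lsubmx (smooth_near_id _)).
Qed.

Lemma span_dxE : @span_dx R n m z0 =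
  pointwise_span z0 (fun=> row_mx 1%:M 0 : 'M[R]_(n, n + m)).
Proof.
rewrite /span_dx codist_spanE.
- by apply: pointwise_span_near; near=> z; exact: dx_matrix.
- move=> i; have -> : @dx R n m i = fun=> row i (row_mx 1%:M 0).
    by apply/funext => z; rewrite -(dx_matrix z) rowK.
  exact: smooth_near_cst.
- rewrite dx_matrix; apply: inj_row_free => v.
  by rewrite mul_mx_row mulmx1 -row_mx0 => /eq_row_mx[].
Unshelve. all: by end_near. Qed.

Lemma sub_dx (w : 'rV[R]_(n + m)) :
  (w <= (row_mx 1%:M 0 : 'M[R]_(n, n + m)))%MS = (rsubmx w == 0).
Proof.
apply/idP/eqP => [/submxP[c ->]|w0].
  by rewrite mul_mx_row mulmx0 row_mxKr.
apply/submxP; exists (lsubmx w).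
by rewrite mul_mx_row mulmx0 mulmx1 -[LHS]hsubmxK w0.
Qed.

Lemma annihilator_dfP v : annihilator z0 (span_df f z0) v <->
  smooth_near z0 v /\ \forall z \near z0, v z *m 'J f z = 0.
Proof.
rewrite span_dfE; split=> [[sv H]|[sv vJ]]; split=> //.
  have H0 i : \forall z \near z0, (v z *m 'J f z) 0 i = 0.
    have := H (fun z => row i (JT z)); case.
      split; first exact: smooth_near_row.
      by near=> z; exact: row_sub.
    move=> e e0 He; exists e => // z /He.
    by rewrite contractionE tr_row trmxK colE mulmxA -colE mxE.
  have H1 := near_forall H0; near=> z; apply/rowP => i; rewrite [RHS]mxE.
  have Hz : forall i, (v z *m 'J f z) 0 i = 0 by exact: (near H1 z).
  exact: Hz.
move=> w [sw wJ]; near=> z; rewrite contractionE.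
have /submxP[c ->] : (w z <= JT z)%MS by exact: (near wJ z).
have vz : v z *m 'J f z = 0 by exact: (near vJ z).
by rewrite trmx_mul trmxK mulmxA vz mul0mx mxE.
Unshelve. all: by end_near. Qed.

(** Since L_v df^i = 0 for v tangent to the fibres of f, only the coefficients are differentiated.
    P_2^+ can therefore be studied through coefficient functions B. *)
Lemma Lie_coefficients v (B : 'rV[R]_(n + m) -> 'rV[R]_n) w :
  smooth_near z0 v -> (\forall z \near z0, v z *m 'J f z = 0) ->
  smooth_near z0 B -> (\forall z \near z0, w z = B z *m JT z) ->
  \forall z \near z0, Lie_derivative v w z = v z *m 'J B z *m JT z.
Proof.
move=> sv vJ sB wB; have sfo := smooth_near_open sf.
have svo := smooth_near_open sv; have sBo := smooth_near_open sB.
have [vJo wBo] := (near_join vJ, near_join wB); near=> z.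
have sfz : smooth_near z f by exact: (near sfo z).
have svz : smooth_near z v by exact: (near svo z).
have sBz : smooth_near z B by exact: (near sBo z).
have vJz : \forall x \near z, v x *m 'J f x = 0 by exact: (near vJo z).
have wBz : \forall x \near z, B x *m JT x = w x.
  have H : \forall x \near z, w x = B x *m JT x by exact: (near wBo z).
  by near=> x; apply/esym; exact: (near H x).
have sJz := smooth_near_jacobian sfz; have sTz := smooth_near_tr sJz.
have sBJ := smooth_near_mulmx sBz sTz.
have dw := smooth_near_diff (smooth_near_eq wBz sBJ).
have Dw : 'D_(v z) w z = 'D_(v z) (fun x => B x *m JT x) z.
  exact: esym (near_eq_derive _ wBz).
rewrite /Lie_derivative -(deriveEjacobian (v z) dw) Dw.
rewrite (derive_mulmx _ sBz sTz) -(nbhs_singleton wBz).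
rewrite deriveEjacobian; last exact: smooth_near_diff.
rewrite -[RHS]addr0 -addrA; congr (_ + _).
have dJ := smooth_near_diff sJz.
have tr_lin : 'D_(v z) (fun x => ('J f x)^T) z = ('D_(v z) (fun x => 'J f x) z)^T.
  apply: (derive_linear (L := (@trmx R (n + m) n : {linear _ -> _}))) => //.
  exact: continuous_linear_mx.
rewrite tr_lin -mulmxA -mulmxDr -trmx_mul -linearD /=.
by rewrite derive_jacobian_kernel // trmx0 mulmx0.
Unshelve. all: by end_near. Qed.

Lemma coefficients w : pointwise_span z0 JT w ->
  exists B, smooth_near z0 B /\ \forall z \near z0, w z = B z *m JT z.
Proof.
move=> [sw wJ]; exists (fun z => w z *m rinv (JT z)); split.
  exact: smooth_near_mulmx sw (smooth_near_rinv sJT fJT).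
have fo := near_row_free sJT fJT; near=> z.
by apply: submx_rinv; [exact: (near fo z)|exact: (near wJ z)].
Unshelve. all: by end_near. Qed.

Local Notation Q := (next_plus f z0 (@span_dx R n m z0)).

Lemma rsubmx_JT (b : 'rV[R]_n) z :
  rsubmx (b *m JT z) = b *m (dsubmx ('J f z))^T.
Proof.
by rewrite /JT -{1}(vsubmxK ('J f z)) tr_col_mx mul_mx_row row_mxKr.
Qed.

(** The hypothesis on B removes the du part of the form B df, which puts it into span{dx}. *)
Lemma next_plus_gen (B : 'rV[R]_(n + m) -> 'rV[R]_n) : smooth_near z0 B ->
  (\forall z \near z0, B z *m (dsubmx ('J f z))^T = 0) ->
  Q (fun z => B z *m JT z).
Proof.
move=> sB B0 P [_ genP]; apply: genP; rewrite span_dxE span_dfE.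
have sBJ := smooth_near_mulmx sB sJT; split; split=> //; near=> z.
  have Bz : B z *m (dsubmx ('J f z))^T = 0 by exact: (near B0 z).
  by rewrite sub_dx rsubmx_JT Bz.
exact: submxMl.
Unshelve. all: by end_near. Qed.

Lemma next_plus_invariant v w : smooth_near z0 v ->
  (\forall z \near z0, v z *m 'J f z = 0) -> Q w -> Q (Lie_derivative v w).
Proof.
move=> sv vJ Qw P [[cP iP] genP]; apply: (iP); first exact/annihilator_dfP.
by apply: (Qw P); split.
Qed.

(** Induction principle for P_2^+: the closure conditions make the forms with coefficients in [C] an
    invariant codistribution, and the last one puts the generators into it. *)
Lemma next_plus_min (C : set ('rV[R]_(n + m) -> 'rV[R]_n)) :
  C (fun=> 0) ->
  (forall B B', C B -> C B' -> C (fun z => B z + B' z)) ->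
  (forall (g : 'rV[R]_(n + m) -> R^o) B, smooth_near z0 g -> C B ->
     C (fun z => g z *: B z)) ->
  (forall v B, smooth_near z0 v -> (\forall z \near z0, v z *m 'J f z = 0) ->
     smooth_near z0 B -> C B -> C (fun z => v z *m 'J B z)) ->
  (forall B, smooth_near z0 B ->
     (\forall z \near z0, B z *m (dsubmx ('J f z))^T = 0) -> C B) ->
  forall w, Q w -> exists B, [/\ smooth_near z0 B, C B &
    \forall z \near z0, w z = B z *m JT z].
Proof.
move=> C0 CD CZ CL Cgen w Qw.
pose P w := exists B, [/\ smooth_near z0 B, C B &
    \forall z \near z0, w z = B z *m JT z].
apply: (Qw P); split; last first.
  move=> {Qw} {}w []; rewrite span_dxE span_dfE => -[sw wx] wJ.
  have [B [sB wB]] := coefficients wJ; exists B; split=> //.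
  apply: Cgen => //; near=> z.
  have : (w z <= (row_mx 1%:M 0 : 'M[R]_(n, n + m)))%MS by exact: (near wx z).
  have -> : w z = B z *m JT z by exact: (near wB z).
  rewrite sub_dx rsubmx_JT.
  by move=> /eqP.
split; first split.
- move=> w1 [B [sB _ wB]].
  apply: smooth_near_eq (smooth_near_mulmx sB sJT).
  by near=> z; apply/esym; exact: (near wB z).
- exists (fun=> 0); split=> //; first exact: smooth_near_cst.
  by near=> z; rewrite mul0mx.
- move=> w1 w2 [B1 [s1 C1 E1]] [B2 [s2 C2 E2]].
  exists (fun z => B1 z + B2 z); split; [exact: smooth_near_add|exact: CD|].
  near=> z; rewrite mulmxDl; congr (_ + _); first exact: (near E1 z).
  exact: (near E2 z).
- move=> g w1 sg [B1 [s1 C1 E1]].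
  exists (fun z => g z *: B1 z); split; [exact: smooth_near_scale|exact: CZ|].
  near=> z; rewrite -scalemxAl; congr (_ *: _); exact: (near E1 z).
- move=> w1 w2 [B1 [s1 C1 E1]] w12; exists B1; split=> //; near=> z.
  have <- : w1 z = w2 z by exact: (near w12 z).
  exact: (near E1 z).
move=> v w1 /annihilator_dfP[sv vJ] [B1 [s1 C1 E1]].
exists (fun z => v z *m 'J B1 z); split.
- exact: smooth_near_mulmx sv (smooth_near_jacobian s1).
- exact: CL.
- exact: Lie_coefficients.
Unshelve. all: by end_near. Qed.

End SystemForms.

(** * Necessity *)

Section Necessity.
Context {R : realType} (n m : nat) (f : 'rV[R]_(n + m) -> 'rV[R]_n)
  (z0 : 'rV[R]_(n + m)).
Hypothesis sf : smooth_near z0 f.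
Hypothesis rJ : \rank ('J f z0) = n.
Hypothesis fz0 : f z0 = lsubmx z0.

Local Notation Q := (next_plus f z0 (@span_dx R n m z0)).
Local Notation P2 := (codist_seq f z0 1).

(** Coefficients c(z) G(f z) are differentiated along a fibre of f through c only, because f, and
    with it G(f z), is constant there. Hence forms with such coefficients are invariant. *)
Lemma next_plus_sub k (G : 'rV[R]_n -> 'M[R]_(k, n)) :
  smooth_near (f z0) G -> row_free (G (f z0)) ->
  (\forall z \near z0, forall b : 'rV[R]_n,
     b *m (dsubmx ('J f z))^T = 0 -> (b <= G (f z))%MS) ->
  forall w, Q w -> exists B, [/\ smooth_near z0 B,
    \forall z \near z0, (B z <= G (f z))%MS &
    \forall z \near z0, w z = B z *m ('J f z)^T].
Proof.
move=> sG fG kerG w; pose Gf z := G (f z).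
have sGf : smooth_near z0 Gf by exact: smooth_near_comp sf sG.
have fGf := near_row_free sGf fG.
apply: (next_plus_min sf rJ (C := fun B => \forall z \near z0, (B z <= G (f z))%MS)).
- by near=> z; exact: sub0mx.
- move=> B B' BG BG'; near=> z; apply: addmx_sub; first exact: (near BG z).
  exact: (near BG' z).
- move=> g B _ BG; near=> z; apply: scalemx_sub; exact: (near BG z).
- move=> v B sv vJ sB BG.
  pose c z := B z *m rinv (Gf z).
  have sc : smooth_near z0 c.
    exact: smooth_near_mulmx sB (smooth_near_rinv sGf fG).
  have BE : \forall z \near z0, c z *m Gf z = B z.
    near=> z; apply/esym/submx_rinv; first exact: (near fGf z).
    exact: (near BG z).
  have BEo := near_join BE; have sco := smooth_near_open sc.
  have sGfo := smooth_near_open sGf; have sBo := smooth_near_open sB.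
  have sfo := smooth_near_open sf.
  have sGo : \forall z \near z0, smooth_near (f z) G.
    exact: near_comp sf (smooth_near_open sG).
  near=> z.
  have scz : smooth_near z c by exact: (near sco z).
  have sGfz : smooth_near z Gf by exact: (near sGfo z).
  have sBz : smooth_near z B by exact: (near sBo z).
  have sfz : smooth_near z f by exact: (near sfo z).
  have sGz : smooth_near (f z) G by exact: (near sGo z).
  have BEz : \forall x \near z, c x *m Gf x = B x by exact: (near BEo z).
  have vz : v z *m 'J f z = 0 by exact: (near vJ z).
  rewrite -(deriveEjacobian (v z) (smooth_near_diff sBz)).
  rewrite -(near_eq_derive (v z) BEz) (derive_mulmx (v z) scz sGfz).
  rewrite (derive_comp (v z) (smooth_near_diff sfz) (smooth_near_diff sGz)).
  rewrite (deriveEjacobian (v z) (smooth_near_diff sfz)) vz derive0 mulmx0 addr0.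
  exact: submxMl.
- move=> B sB B0; near=> z.
  have H : forall b : 'rV[R]_n,
     b *m (dsubmx ('J f z))^T = 0 -> (b <= G (f z))%MS by exact: (near kerG z).
  by apply: H; exact: (near B0 z).
Unshelve. all: by end_near. Qed.

Lemma pullback_lsubmx (w : 'rV[R]_n -> 'rV[R]_n) (z : 'rV[R]_(n + m)) :
  pullback (fun z : 'rV[R]_(n + m) => lsubmx z) w z = row_mx (w (lsubmx z)) 0.
Proof.
rewrite pullbackE; last first.
  exact: smooth_near_diff (smooth_near_lsubmx (smooth_near_id _)).
by rewrite jacobian_lsubmx tr_col_mx trmx1 trmx0 mul_mx_row mulmx1 mulmx0.
Qed.

Lemma smooth_near_pullback_lsubmx (w : 'rV[R]_n -> 'rV[R]_n) :
  smooth_near (f z0) w ->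
  smooth_near z0 (pullback (fun z : 'rV[R]_(n + m) => lsubmx z) w).
Proof.
move=> sw; have -> : pullback (fun z : 'rV[R]_(n + m) => lsubmx z) w =
    fun z => row_mx (w (lsubmx z)) 0.
  by apply/funext => z; exact: pullback_lsubmx.
apply: smooth_near_row_mx; last exact: smooth_near_cst.
apply: smooth_near_comp (smooth_near_lsubmx (smooth_near_id _)) _.
by rewrite -fz0.
Qed.

(** The bound by G is first known at the points f z. A section of f carries it to all states near f
    z0, and at an equilibrium these are the points [lsubmx z] at which P_2 is evaluated. *)
Lemma backward_shift_dim k (G : 'rV[R]_n -> 'M[R]_(k, n)) d :
  smooth_near (f z0) G -> row_free (G (f z0)) ->
  (\forall z \near z0, forall b : 'rV[R]_n,
     b *m (dsubmx ('J f z))^T = 0 -> (b <= G (f z))%MS) ->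
  has_dim z0 P2 d -> (d <= k)%N.
Proof.
move=> sG fG kerG /has_dimP[M [sM fM P2M]].
pose G' (z : 'rV[R]_(n + m)) := row_mx (G (lsubmx z)) (0 : 'M[R]_(k, m)).
have P2G : P2 `<=` pointwise_span z0 G'.
  apply: smallest_sub; first exact: codistribution_pointwise_span.
  move=> _ [w [sw Qw] <-]; split; first exact: smooth_near_pullback_lsubmx.
  have [B [sB BG wB]] := next_plus_sub sG fG kerG Qw.
  have fJ := near_row_free (smooth_near_tr (smooth_near_jacobian sf)).
  have {}fJ : \forall z \near z0, row_free ('J f z)^T.
    by apply: fJ; rewrite /row_free mxrank_tr rJ.
  have sfo := smooth_near_open sf.
  have wGf : \forall z \near z0, (w (f z) <= G (f z))%MS.
    near=> z; have fJz : row_free ('J f z)^T by exact: (near fJ z).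
    have sfz : smooth_near z f by exact: (near sfo z).
    have wBz : pullback f w z = B z *m ('J f z)^T by exact: (near wB z).
    move: wBz; rewrite pullbackE; last exact: smooth_near_diff.
    by move=> /(row_free_inj fJz) ->; exact: (near BG z).
  have [s [ss sz fs]] := local_section sf rJ.
  have wG : \forall y \near f z0, (w y <= G y)%MS.
    have H : \forall y \near f z0, (w (f (s y)) <= G (f (s y)))%MS.
      have H : \forall z \near s (f z0), (w (f z) <= G (f z))%MS by rewrite sz.
      exact: near_comp ss H.
    near=> y; have fsy : f (s y) = y by exact: (near fs y).
    rewrite -fsy; exact: (near H y).
  have wGl : \forall z \near z0, (w (lsubmx z) <= G (lsubmx z))%MS.
    have H : \forall y \near lsubmx z0, (w y <= G y)%MS by rewrite -fz0.
    exact: near_comp (smooth_near_lsubmx (smooth_near_id _)) H.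
  near=> z; rewrite pullback_lsubmx /G'.
  have /submxP[c ->] : (w (lsubmx z) <= G (lsubmx z))%MS by exact: (near wGl z).
  by apply/submxP; exists c; rewrite mul_mx_row mulmx0.
have := pointwise_span_dim sM fM; rewrite -P2M => /(_ _ _ P2G) MG.
have := mxrankS MG; rewrite (eqP fM) => /leq_trans; apply.
exact: rank_leq_row.
Unshelve. all: by end_near. Qed.

(** The rows of G are the differentials of xbar_2. Moving ubar_1 alone leaves xbar_2^+ fixed and
    moves xbar_1^+ with full rank n1, so a vector b that kills f_u has no component along the
    differentials of xbar_1. *)
Lemma triangular_form_kernel n1 n2 m1 m2
    (Phix : 'rV[R]_n -> 'rV[R]_(n1 + n2))
    (Phiu : 'rV[R]_(n + m) -> 'rV[R]_(m1 + m2))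
    (f2 : 'rV[R]_(n2 + n1 + m2) -> 'rV[R]_n2)
    (f1 : 'rV[R]_(n2 + n1 + m2 + m1) -> 'rV[R]_n1)
    (xb1 := fun z : 'rV[R]_(n + m) => lsubmx (Phix (lsubmx z)))
    (xb2 := fun z : 'rV[R]_(n + m) => rsubmx (Phix (lsubmx z)))
    (arg2 := fun z => row_mx (row_mx (xb2 z) (xb1 z)) (rsubmx (Phiu z)))
    (arg1 := fun z => row_mx (arg2 z) (lsubmx (Phiu z))) :
  local_diffeo (f z0) Phix ->
  input_transformation (lsubmx z0) (rsubmx z0) Phiu ->
  smooth_near (arg2 z0) f2 -> smooth_near (arg1 z0) f1 ->
  (\forall z \near z0, rsubmx (Phix (f z)) = f2 (arg2 z) /\
        lsubmx (Phix (f z)) = f1 (arg1 z)) ->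
  (\forall p \near arg1 z0, \rank (dsubmx ('J f1 p)) = n1) ->
  let G y := (rsubmx ('J Phix y))^T in
  [/\ smooth_near (f z0) G, row_free (G (f z0)) &
   \forall z \near z0, forall b : 'rV[R]_n,
     b *m (dsubmx ('J f z))^T = 0 -> (b <= G (f z))%MS].
Proof.
move=> [sP [Psix [sPsix PsP PPs]]] [sPu [Psiu [sPsiu PuPs PsPu]]] sf2 sf1 fE rf1 G.
rewrite hsubmxK in sPu sPsiu PuPs PsPu *.
have sG : smooth_near (f z0) G.
  exact: smooth_near_tr (smooth_near_rsubmx (smooth_near_jacobian sP)).
have JJ1 := inverse_jacobian sP sPsix PsP.
have fPz : Psix (Phix (f z0)) = f z0 := nbhs_singleton PsP.
have JJ2 : 'J Psix (Phix (f z0)) *m 'J Phix (f z0) = 1%:M.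
  have sP' : smooth_near (Psix (Phix (f z0))) Phix by rewrite fPz.
  by have := nbhs_singleton (inverse_jacobian sPsix sP' PPs); rewrite fPz.
have fG : row_free (G (f z0)).
  apply: inj_row_free => v vG.
  have : row_mx 0 v *m ('J Phix (f z0))^T = 0.
    by rewrite -{1}(hsubmxK ('J Phix (f z0))) tr_row_mx mul_row_col mul0mx add0r.
  move=> /(congr1 (mulmx^~ ('J Psix (Phix (f z0)))^T)).
  by rewrite -mulmxA -trmx_mul JJ2 trmx1 mulmx1 mul0mx -row_mx0 => /eq_row_mx[].
split=> //.
(* The computation takes place in the coordinates (x, ubar), where ubar_1 can be varied alone; [Z]
   leads back to (x, u). *)
pose w0 := row_mx (lsubmx z0) (Phiu z0).
pose Z (w : 'rV[R]_(n + (m1 + m2))) := row_mx (lsubmx w) (Psiu w).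
pose a2 (w : 'rV[R]_(n + (m1 + m2))) :=
  row_mx (row_mx (rsubmx (Phix (lsubmx w))) (lsubmx (Phix (lsubmx w))))
    (rsubmx (rsubmx w)).
pose a1 w := row_mx (a2 w) (lsubmx (rsubmx w)).
have Zw0 : Z w0 = z0.
  by rewrite /Z /w0 row_mxKl (nbhs_singleton PuPs) hsubmxK.
have a2w0 : a2 w0 = arg2 z0 by rewrite /a2 /w0 row_mxKl row_mxKr.
have a1w0 : a1 w0 = arg1 z0 by rewrite /a1 a2w0 /w0 row_mxKr.
have sid (w : 'rV[R]_(n + (m1 + m2))) := smooth_near_id w.
have sZ : smooth_near w0 Z.
  exact: smooth_near_row_mx (smooth_near_lsubmx (sid _)) sPsiu.
have sfZ : smooth_near (Z w0) f by rewrite Zw0.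
have sPfZ : smooth_near (f (Z w0)) Phix by rewrite Zw0.
have sfZw := smooth_near_comp sZ sfZ.
have sPl : smooth_near (lsubmx w0) Phix by rewrite /w0 row_mxKl -fz0.
have sPlw := smooth_near_comp (smooth_near_lsubmx (sid w0)) sPl.
have sa2 : smooth_near w0 a2.
  apply: smooth_near_row_mx.
    by apply: smooth_near_row_mx; [exact: smooth_near_rsubmx|exact: smooth_near_lsubmx].
  exact: smooth_near_rsubmx (smooth_near_rsubmx (sid _)).
have sa1 : smooth_near w0 a1.
  exact: smooth_near_row_mx sa2 (smooth_near_lsubmx (smooth_near_rsubmx (sid _))).
have sf2a : smooth_near (a2 w0) f2 by rewrite a2w0.
have sf1a : smooth_near (a1 w0) f1 by rewrite a1w0.
pose H (w : 'rV[R]_(n + (m1 + m2))) := Phix (f (Z w)).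
have HE : \forall w \near w0, H w = row_mx (f1 (a1 w)) (f2 (a2 w)).
  have fEZ : \forall w \near w0, rsubmx (Phix (f (Z w))) = f2 (arg2 (Z w)) /\
      lsubmx (Phix (f (Z w))) = f1 (arg1 (Z w)).
    have fEz : \forall z \near Z w0, rsubmx (Phix (f z)) = f2 (arg2 z) /\
      lsubmx (Phix (f z)) = f1 (arg1 z) by rewrite Zw0.
    exact: near_comp sZ fEz.
  near=> w.
  have Pw : Phiu (Z w) = rsubmx w by exact: (near PsPu w).
  have [E2 E1] : rsubmx (Phix (f (Z w))) = f2 (arg2 (Z w)) /\
      lsubmx (Phix (f (Z w))) = f1 (arg1 (Z w)) by exact: (near fEZ w).
  have A2 : arg2 (Z w) = a2 w by rewrite /arg2 /a2 /xb1 /xb2 Pw /Z row_mxKl.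
  have A1 : arg1 (Z w) = a1 w by rewrite /arg1 /a1 A2 Pw.
  by rewrite /H -[LHS]hsubmxK E1 E2 A1 A2.
have sH : smooth_near w0 H by exact: smooth_near_comp sfZw sPfZ.
have [HEo sHo] := (near_join HE, smooth_near_open sH).
have [sZo sa2o] := (smooth_near_open sZ, smooth_near_open sa2).
have [sa1o sPsiuo] := (smooth_near_open sa1, smooth_near_open sPsiu).
have sPlwo := smooth_near_open sPlw.
have sPlo := near_comp (smooth_near_lsubmx (sid w0)) (smooth_near_open sPl).
have sfZo := near_comp sZ (smooth_near_open sfZ).
have sPfZo := near_comp sfZw (smooth_near_open sPfZ).
have sf2o := near_comp sa2 (smooth_near_open sf2a).
have sf1o := near_comp sa1 (smooth_near_open sf1a).
have rf1o : \forall w \near w0, \rank (dsubmx ('J f1 (a1 w))) = n1.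
  have rf1' : \forall p \near a1 w0, \rank (dsubmx ('J f1 p)) = n1 by rewrite a1w0.
  exact: near_comp sa1 rf1'.
have HK : \forall w \near w0, exists E : 'M[R]_(m1, m),
    E *m dsubmx ('J f (Z w)) *m rsubmx ('J Phix (f (Z w))) = 0 /\
    \rank (E *m dsubmx ('J f (Z w)) *m lsubmx ('J Phix (f (Z w)))) = n1.
  near=> w.
  have HEw : \forall x \near w, H x = row_mx (f1 (a1 x)) (f2 (a2 x)).
    exact: (near HEo w).
  have sZw : smooth_near w Z by exact: (near sZo w).
  have sPsiuw : smooth_near w Psiu by exact: (near sPsiuo w).
  have sa1w : smooth_near w a1 by exact: (near sa1o w).
  have sa2w : smooth_near w a2 by exact: (near sa2o w).
  have sPlww : smooth_near w (fun x => Phix (lsubmx x)) by exact: (near sPlwo w).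
  have sfw : smooth_near (Z w) f by exact: (near sfZo w).
  have sPw : smooth_near (f (Z w)) Phix by exact: (near sPfZo w).
  have sf2w : smooth_near (a2 w) f2 by exact: (near sf2o w).
  have sf1w : smooth_near (a1 w) f1 by exact: (near sf1o w).
  have rw : \rank (dsubmx ('J f1 (a1 w))) = n1 by exact: (near rf1o w).
  have sPx : smooth_near (lsubmx w) Phix by exact: (near sPlo w).
  (* This is the derivative of u with respect to ubar_1 at fixed x and ubar_2. *)
  pose E := usubmx (dsubmx ('J Psiu w)); exists E.
  suff HEE : E *m dsubmx ('J f (Z w)) *m 'J Phix (f (Z w)) =
      row_mx (dsubmx ('J f1 (a1 w))) 0.
    move: HEE; rewrite -{1}(hsubmxK ('J Phix (f (Z w)))) mul_mx_row.
    by move=> /eq_row_mx[-> ->].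
  apply/row_matrixP => i; pose s : 'rV[R]_m1 := delta_mx 0 i.
  pose e : 'rV[R]_(n + (m1 + m2)) := row_mx 0 (row_mx s 0).
  have Dl : 'D_e (fun x : 'rV[R]_(n + (m1 + m2)) => lsubmx x) w = 0.
    under eq_fun do rewrite lsubmx_mul.
    by rewrite derive_mulmxr // derive_id -lsubmx_mul row_mxKl.
  have Dr : 'D_e (fun x : 'rV[R]_(n + (m1 + m2)) => rsubmx x) w = row_mx s 0.
    under eq_fun do rewrite rsubmx_mul.
    by rewrite derive_mulmxr // derive_id -rsubmx_mul row_mxKr.
  have slw := smooth_near_lsubmx (sid w); have srw := smooth_near_rsubmx (sid w).
  have DZ : 'D_e Z w = row_mx 0 (s *m E).
    rewrite derive_row_mx // Dl deriveEjacobian; last exact: smooth_near_diff.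
    congr row_mx; rewrite -[in LHS](vsubmxK ('J Psiu w)) mul_row_col mul0mx add0r.
    by rewrite -[in LHS](vsubmxK (dsubmx _)) mul_row_col mul0mx addr0.
  have DPl : 'D_e (fun x => Phix (lsubmx x)) w = 0.
    rewrite (derive_comp e (smooth_near_diff slw) (smooth_near_diff sPx)).
    by rewrite Dl derive0.
  have Da2 : 'D_e a2 w = 0.
    have sl := smooth_near_lsubmx sPlww; have sr := smooth_near_rsubmx sPlww.
    rewrite (derive_row_mx e (smooth_near_row_mx sr sl) (smooth_near_rsubmx srw)).
    rewrite (derive_row_mx e sr sl).
    have -> : 'D_e (fun x => rsubmx (Phix (lsubmx x))) w = 0.
      under eq_fun do rewrite rsubmx_mul.
      by rewrite (derive_mulmxr _ e (smooth_near_diff sPlww)) DPl mul0mx.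
    have -> : 'D_e (fun x => lsubmx (Phix (lsubmx x))) w = 0.
      under eq_fun do rewrite lsubmx_mul.
      by rewrite (derive_mulmxr _ e (smooth_near_diff sPlww)) DPl mul0mx.
    have -> : 'D_e (fun x : 'rV[R]_(n + (m1 + m2)) => rsubmx (rsubmx x)) w = 0.
      under eq_fun do rewrite rsubmx_mul.
      rewrite (derive_mulmxr _ e (smooth_near_diff srw)) Dr.
      by rewrite -rsubmx_mul row_mxKr.
    by rewrite !row_mx0.
  have Da1 : 'D_e a1 w = row_mx 0 s.
    rewrite (derive_row_mx e sa2w (smooth_near_lsubmx srw)) Da2; congr row_mx.
    under eq_fun do rewrite lsubmx_mul.
    rewrite (derive_mulmxr _ e (smooth_near_diff srw)) Dr.
    by rewrite -lsubmx_mul row_mxKl.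
  have DH1 : 'D_e H w = s *m E *m dsubmx ('J f (Z w)) *m 'J Phix (f (Z w)).
    have sfZx := smooth_near_comp sZw sfw.
    rewrite /H (derive_comp e (smooth_near_diff sfZx) (smooth_near_diff sPw)).
    rewrite (deriveEjacobian _ (smooth_near_diff sPw)); congr (_ *m _).
    rewrite (derive_comp e (smooth_near_diff sZw) (smooth_near_diff sfw)) DZ.
    rewrite (deriveEjacobian _ (smooth_near_diff sfw)).
    by rewrite -{1}(vsubmxK ('J f (Z w))) mul_row_col mul0mx add0r.
  have DH2 : 'D_e H w = row_mx (s *m dsubmx ('J f1 (a1 w))) 0.
    have sf1x := smooth_near_comp sa1w sf1w.
    have sf2x := smooth_near_comp sa2w sf2w.
    rewrite (near_eq_derive e HEw) (derive_row_mx e sf1x sf2x); congr row_mx.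
      rewrite (derive_comp e (smooth_near_diff sa1w) (smooth_near_diff sf1w)) Da1.
      rewrite (deriveEjacobian _ (smooth_near_diff sf1w)).
      by rewrite -{1}(vsubmxK ('J f1 (a1 w))) mul_row_col mul0mx add0r.
    rewrite (derive_comp e (smooth_near_diff sa2w) (smooth_near_diff sf2w)) Da2.
    exact: derive0.
  rewrite !rowE !mulmxA -/s mul_mx_row mulmx0.
  exact: etrans (esym DH1) DH2.
pose W z := row_mx (lsubmx z) (Phiu z).
have sW : smooth_near z0 W.
  exact: smooth_near_row_mx (smooth_near_lsubmx (smooth_near_id _)) sPu.
have HKz := near_comp sW HK; have JJz := near_comp sf JJ1.
near=> z => b b0.
have [E [E2 E1]] : exists E : 'M[R]_(m1, m),
    E *m dsubmx ('J f (Z (W z))) *m rsubmx ('J Phix (f (Z (W z)))) = 0 /\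
    \rank (E *m dsubmx ('J f (Z (W z))) *m lsubmx ('J Phix (f (Z (W z))))) = n1.
  exact: (near HKz z).
have ZW : Z (W z) = z.
  rewrite /Z /W row_mxKl.
  have -> : Psiu (row_mx (lsubmx z) (Phiu z)) = rsubmx z by exact: (near PuPs z).
  exact: hsubmxK.
rewrite ZW in E1 E2.
have PS : 'J Phix (f z) *m 'J Psix (Phix (f z)) = 1%:M by exact: (near JJz z).
set P := 'J Phix (f z) in E1 E2 PS *; set S := 'J Psix _ in PS.
(* The coefficients of the same form in the basis given by the differentials of xbar_1 and
   xbar_2. *)
pose b' := b *m S^T.
have bE : b = b' *m P^T by rewrite /b' -mulmxA -trmx_mul PS trmx1 mulmx1.
have bE' : b = lsubmx b' *m (lsubmx P)^T + rsubmx b' *m (rsubmx P)^T.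
  by rewrite {1}bE -{1}(hsubmxK b') -{1}(hsubmxK P) tr_row_mx mul_row_col.
have : lsubmx b' *m (E *m dsubmx ('J f z) *m lsubmx P)^T = 0.
  have := congr1 (mulmx^~ E^T) b0; rewrite mul0mx -mulmxA -trmx_mul {1}bE'.
  rewrite mulmxDl -[lsubmx b' *m _ *m _]mulmxA -[rsubmx b' *m _ *m _]mulmxA.
  by rewrite -!trmx_mul E2 trmx0 mulmx0 addr0.
have fF : row_free (E *m dsubmx ('J f z) *m lsubmx P)^T.
  by rewrite /row_free mxrank_tr E1.
rewrite -[RHS](mul0mx _ (E *m dsubmx ('J f z) *m lsubmx P)^T).
move=> /(row_free_inj fF) b1.
by rewrite bE' b1 mul0mx add0r /G submxMl.
Unshelve. all: by end_near. Qed.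

End Necessity.

(** * Left kernels of the input Jacobian *)

Section LeftKernels.
Context {R : realType}.

Lemma near_derive_bound N p q (f : 'rV[R]_N -> 'M[R]_(p, q)) z :
  smooth_near z f -> exists c : R, 0 <= c /\
    \forall x \near z, forall v, `|'D_v f x| <= c * `|v|.
Proof.
move=> sf; pose c := \sum_(i < N) (`|'D_(delta_mx 0 i) f z| + 1).
exists c; split; first by apply: sumr_ge0 => i _; rewrite addr_ge0.
have Dc i : \forall x \near z,
    `|'D_(delta_mx 0 i) f x| <= `|'D_(delta_mx 0 i) f z| + 1.
  have := smooth_near_cont (smooth_near_derive (delta_mx 0 i) sf).
  by move=> /cvgr_norm_le; apply; rewrite ltrDl.
have Dfc := near_forall Dc; have sfo := smooth_near_open sf.
near=> x => v; have sfx : smooth_near x f by exact: (near sfo x).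
have Dx : forall i, `|'D_(delta_mx 0 i) f x| <= `|'D_(delta_mx 0 i) f z| + 1.
  exact: (near Dfc x).
have dfx := smooth_near_diff sfx.
have -> : 'D_v f x = \sum_k v 0 k *: 'D_(delta_mx 0 k) f x.
  rewrite (deriveE v dfx) {1}[v]row_sum_delta linear_sum; apply: eq_bigr => k _.
  by rewrite linearZ /= (deriveE _ dfx).
rewrite (le_trans (ler_norm_sum _ _ _)) // /c mulr_suml.
apply: ler_sum => k _; rewrite normrZ mulrC.
by apply: ler_pM => //; exact: ler_mxnorm_entry.
Unshelve. all: by end_near. Qed.

Lemma row_free_col_mx k N (A : 'M[R]_(k, N)) (b : 'rV[R]_N) :
  row_free A -> ~~ (b <= A)%MS -> row_free (col_mx A b).
Proof.
move=> fA bA; apply: inj_row_free => v.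
rewrite -[v]hsubmxK mul_row_col; set v1 := lsubmx v; set v2 := rsubmx v => E.
have v20 : v2 0 0 = 0.
  apply/eqP; apply: contraNT bA => n0.
  have v2b : v2 *m b = v2 0 0 *: b.
    rewrite [v2 in LHS](_ : _ = (v2 0 0)%:M) ?mul_scalar_mx //.
    by apply/matrixP => i j; rewrite !ord1 !mxE eqxx.
  have -> : b = (- (v2 0 0)^-1 *: v1) *m A.
    rewrite -scalemxAl scaleNr -scalerN; apply: (scalerI n0).
    rewrite scalerA mulfV // scale1r -v2b; apply/eqP.
    by rewrite -addr_eq0 addrC E.
  exact: submxMl.
have v200 : v2 = 0 by apply/matrixP => i j; rewrite !ord1 v20 mxE.
move: E; rewrite v200 mul0mx addr0 => E.
by rewrite (row_free_inj fA (etrans E (esym (mul0mx _ A)))) row_mx0.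
Qed.

Lemma row_selection p q (A : 'M[R]_(p, q)) k : \rank A = k ->
  exists U : 'M[R]_(k, p), row_free (U *m A).
Proof.
move=> <-; have /submxP[U E] : (row_base A <= A)%MS by rewrite eq_row_base.
by exists U; rewrite -E row_base_free.
Qed.

Lemma submx_rank_eq p p' q (A : 'M[R]_(p, q)) (B : 'M[R]_(p', q)) :
  (A <= B)%MS -> \rank A = \rank B -> (B <= A)%MS.
Proof. by move=> AB rAB; rewrite -(geq_leqif (mxrank_leqif_sup AB)) rAB. Qed.

Variables (n m : nat) (f : 'rV[R]_(n + m) -> 'rV[R]_n) (z0 : 'rV[R]_(n + m)).
Hypothesis sf : smooth_near z0 f.
Hypothesis rJ : \rank ('J f z0) = n.
Variable rho : nat.
Hypothesis rfu : \forall z \near z0, \rank (dsubmx ('J f z)) = rho.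

Local Notation Q := (next_plus f z0 (@span_dx R n m z0)).
Local Notation fu z := (dsubmx ('J f z)).
Let JT z := ('J f z)^T.

Variable r : nat.
Hypothesis dimQ : has_dim z0 Q r.

Let sJT : smooth_near z0 JT.
Proof. exact: smooth_near_tr (smooth_near_jacobian sf). Qed.

Let fJT : row_free (JT z0).
Proof. by rewrite /row_free /JT mxrank_tr rJ. Qed.

Lemma next_plus_basis : exists B : 'rV[R]_(n + m) -> 'M[R]_(r, n),
  [/\ smooth_near z0 B, row_free (B z0) &
    Q = pointwise_span z0 (fun z => B z *m JT z)].
Proof.
have /has_dimP[M [sM fM QM]] := dimQ.
pose B z := M z *m rinv (JT z).
have sB : smooth_near z0 B.
  exact: smooth_near_mulmx sM (smooth_near_rinv sJT fJT).
have rowM i : \forall z \near z0, (row i (M z) <= JT z)%MS.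
  have Qi : Q (fun z => row i (M z)).
    rewrite QM; split; first exact: smooth_near_row.
    by near=> z; exact: row_sub.
  have [w [_ _ wE]] : exists w, [/\ smooth_near z0 w, [set: 'rV_(n + m) -> 'rV_n] w &
      \forall z \near z0, row i (M z) = w z *m JT z].
    (* For the class of all coefficients, minimality says that P_2^+ lies in span{df}. *)
    by apply: (next_plus_min sf rJ (C := setT)) Qi.
  near=> z; have -> : row i (M z) = w z *m JT z by exact: (near wE z).
  exact: submxMl.
have rowsM := near_forall rowM; have fo := near_row_free sJT fJT.
have ME : \forall z \near z0, M z = B z *m JT z.
  near=> z; have H : forall i, (row i (M z) <= JT z)%MS by exact: (near rowsM z).
  have fz : row_free (JT z) by exact: (near fo z).
  by apply/row_matrixP => i; rewrite /B !row_mul -submx_rinv.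
exists B; split=> //.
  rewrite /row_free eqn_leq rank_leq_row /= -{1}(eqP fM) (nbhs_singleton ME).
  exact: mxrankM_maxl.
by rewrite QM; exact: pointwise_span_near.
Unshelve. all: by end_near. Qed.

Section Basis.
Variable B : 'rV[R]_(n + m) -> 'M[R]_(r, n).
Hypothesis sB : smooth_near z0 B.
Hypothesis fB : row_free (B z0).
Hypothesis QB : Q = pointwise_span z0 (fun z => B z *m JT z).

Let coefficient_sub (b : 'rV[R]_(n + m) -> 'rV[R]_n) :
  Q (fun z => b z *m JT z) -> \forall z \near z0, (b z <= B z)%MS.
Proof.
rewrite QB => -[_ H]; have fo := near_row_free sJT fJT; near=> z.
have fz : row_free (JT z) by exact: (near fo z).
rewrite -(submxMfree (b z) (B z) fz); exact: (near H z).
Unshelve. all: by end_near. Qed.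

(** The orthogonal projector onto the tangent space of the fibre of f. Its rows are finitely many
    smooth fields that span this space. *)
Let kernel_proj (z : 'rV[R]_(n + m)) := 1%:M - rinv (JT z) *m JT z.

Let kernel_projE : \forall z \near z0,
  (kernel_proj z *m 'J f z = 0) /\
  (forall v : 'rV[R]_(n + m), v *m 'J f z = 0 -> v *m kernel_proj z = v).
Proof.
have fo := near_row_free sJT fJT; near=> z.
have fz : row_free (JT z) by exact: (near fo z).
have uz := gram_unit fz; rewrite /kernel_proj /rinv; split=> [|v vJ].
  rewrite mulmxBl mul1mx -[X in _ - X *m _]mulmxA -mulmxA.
  rewrite [_ *m _ *m 'J f z](_ : _ = 1%:M); last first.
    by rewrite -mulmxA -[X in _ *m (_ *m X)]trmxK mulVmx.
  by rewrite mulmx1 trmxK subrr.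
by rewrite mulmxBr mulmx1 !mulmxA trmxK vJ !mul0mx subr0.
Unshelve. all: by end_near. Qed.

(** Invariance is a statement about one field at a time, on a neighborhood depending on it. Used for
    the finitely many rows of [kernel_proj], it gives one neighborhood for all tangent vectors v. *)
Let derive_sub : \forall z \near z0, forall v : 'rV[R]_(n + m),
  v *m 'J f z = 0 -> ('D_v B z <= B z)%MS.
Proof.
have sK : smooth_near z0 kernel_proj.
  apply: smooth_near_sub; first exact: smooth_near_cst.
  exact: smooth_near_mulmx (smooth_near_rinv sJT fJT) sJT.
have sBo := smooth_near_open sB; have KE := kernel_projE.
have H (ij : 'I_r * 'I_(n + m)) : \forall z \near z0,
    (row ij.1 ('D_(row ij.2 (kernel_proj z)) B z) <= B z)%MS.
  case: ij => i j /=; pose v z := row j (kernel_proj z); pose b z := row i (B z).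
  have sv : smooth_near z0 v by exact: smooth_near_row.
  have vJ : \forall z \near z0, v z *m 'J f z = 0.
    near=> z; rewrite /v -row_mul.
    have [-> _] : (kernel_proj z *m 'J f z = 0) /\
      (forall v : 'rV[R]_(n + m), v *m 'J f z = 0 -> v *m kernel_proj z = v).
      exact: (near KE z).
    exact: row0.
  have sb : smooth_near z0 b by exact: smooth_near_row.
  have Qb : Q (fun z => b z *m JT z).
    rewrite QB; split; first exact: smooth_near_mulmx.
    by near=> z; rewrite -row_mul; exact: row_sub.
  have QL := next_plus_invariant sf rJ sv vJ Qb.
  have bE : \forall z \near z0, b z *m JT z = b z *m JT z by near=> z.
  have LE := Lie_coefficients sf sv vJ sb bE.
  have QL' : Q (fun z => (v z *m 'J b z) *m JT z).
    move: QL; rewrite QB => -[sL LB]; split; first exact: smooth_near_eq LE sL.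
    near=> z; have <- : Lie_derivative v (fun z => b z *m JT z) z =
      v z *m 'J b z *m JT z by exact: (near LE z).
    exact: (near LB z).
  have vbB := coefficient_sub QL'.
  have sbo := smooth_near_open sb; near=> z.
  have sbz : smooth_near z b by exact: (near sbo z).
  have sBz : smooth_near z B by exact: (near sBo z).
  have -> : row i ('D_(row j (kernel_proj z)) B z) = v z *m 'J b z.
    rewrite -(deriveEjacobian _ (smooth_near_diff sbz)) /b.
    under eq_fun do rewrite rowE.
    rewrite rowE -(derive_linear (L := mulmx (delta_mx 0 i))) //.
      exact: continuous_linear_mx.
    exact: smooth_near_diff.
  exact: (near vbB z).
have Hall := near_forall H; near=> z => v vJ.
have [_ KP] : (kernel_proj z *m 'J f z = 0) /\
    (forall v : 'rV[R]_(n + m), v *m 'J f z = 0 -> v *m kernel_proj z = v).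
  exact: (near KE z).
have Hz : forall ij : 'I_r * 'I_(n + m),
    (row ij.1 ('D_(row ij.2 (kernel_proj z)) B z) <= B z)%MS.
  exact: (near Hall z).
have sBz : smooth_near z B by exact: (near sBo z).
have dB := smooth_near_diff sBz.
rewrite -(KP v vJ) mulmx_sum_row (deriveE _ dB) linear_sum.
apply: summx_sub => j _; rewrite linearZ /=; apply: scalemx_sub.
by rewrite -(deriveE _ dB); apply/row_subP => i; exact: (Hz (i, j)).
Unshelve. all: by end_near. Qed.

(** Along a fibre the derivative of B has the form X B with X bounded, so the row space of B cannot
    move. Gronwall is applied to [B x *m cokermx (B z)], which vanishes at x = z. *)
Let fibre_constant : exists d : R, 0 < d /\
  forall z z', ball z0 d z -> ball z0 d z' -> f z = f z' -> (B z' <= B z)%MS.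
Proof.
have [c [c0 Dc]] := near_derive_bound sB.
pose c' := `|rinv (B z0)| + 1.
have Rb : \forall z \near z0, `|rinv (B z)| <= c'.
  have := smooth_near_cont (smooth_near_rinv sB fB).
  by move=> /cvgr_norm_le; apply; rewrite ltrDl.
have sBo := smooth_near_open sB; have fBo := near_row_free sB fB.
have DB := derive_sub.
pose A z := [/\ smooth_near z B, row_free (B z), `|rinv (B z)| <= c',
  forall v, `|'D_v B z| <= c * `|v| &
  forall v : 'rV[R]_(n + m), v *m 'J f z = 0 -> ('D_v B z <= B z)%MS].
have nA : \forall z \near z0, A z.
  near=> z; split; [exact: (near sBo z)|exact: (near fBo z)|exact: (near Rb z)|
    exact: (near Dc z)|exact: (near DB z)].
have [d [d0 H]] := fibre_vanish sf rJ nA; exists d; split=> // z z' bz bz' fzz'.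
rewrite submxE; apply/eqP.
pose L := r%:R * (n%:R * c * c').
apply: (H _ _ (fun x => B x *m cokermx (B z)) L _ _ z z' bz bz' fzz').
- by rewrite !mulr_ge0 // addr_ge0.
- move=> x [sBx fBx Rx Dx DBx]; have sg := smooth_near_mulmxr (cokermx (B z)) sBx.
  split; first exact: smooth_near_diff sg.
  move=> v vJ; rewrite (derive_mulmxr _ v (smooth_near_diff sBx)).
  have -> : 'D_v B x = 'D_v B x *m rinv (B x) *m B x.
    have /submxP[X ->] := DBx v vJ.
    by rewrite -[X *m B x *m _]mulmxA mul_rinv // mulmx1.
  rewrite -mulmxA (le_trans (mxnormM_le _ _)) // ler_wpM2r //.
  rewrite /L -!mulrA ler_wpM2l // (le_trans (mxnormM_le _ _)) //.
  rewrite -!mulrA ler_wpM2l //.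
  rewrite [c' * _]mulrC mulrA.
  by apply: ler_pM => //; exact: Dx.
- exact: mulmx_coker.
Unshelve. all: by end_near. Qed.

(** Constant rank makes the orthogonal projector onto the left kernel smooth, so its rows are
    coefficients of generators of P_2^+. *)
Lemma left_kernel_sub : \forall z \near z0, forall b : 'rV[R]_n,
  b *m (fu z)^T = 0 -> (b <= B z)%MS.
Proof.
(* [U] picks rho independent combinations of the rows of f_u at z0; by constant rank they span the
   row space of f_u at nearby points as well. *)
have [U fU] := row_selection (nbhs_singleton rfu).
pose G z := U *m fu z; pose P z := 1%:M - rinv (G z) *m G z.
have sfu : smooth_near z0 (fun z => fu z).
  exact: smooth_near_dsubmx (smooth_near_jacobian sf).
have sG : smooth_near z0 G by exact: smooth_near_mulmx (smooth_near_cst _ _) sfu.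
have sP : smooth_near z0 P.
  apply: smooth_near_sub; first exact: smooth_near_cst.
  exact: smooth_near_mulmx (smooth_near_rinv sG fU) sG.
have fG := near_row_free sG fU.
have PE : \forall z \near z0, P z *m (fu z)^T = 0 /\
    forall b : 'rV[R]_n, b *m (fu z)^T = 0 -> b *m P z = b.
  near=> z; have fGz : row_free (G z) by exact: (near fG z).
  have rz : \rank (fu z) = rho by exact: (near rfu z).
  have /submxP[X EX] : (fu z <= G z)%MS.
    by apply: submx_rank_eq; rewrite ?submxMl // rz; exact/eqP.
  have uz := gram_unit fGz; split=> [|b bz].
    have PG : P z *m (G z)^T = 0.
      by rewrite /P mulmxBl mul1mx -mulmxA mulmxKV // subrr.
    by rewrite EX trmx_mul mulmxA PG mul0mx.
  by rewrite /P /rinv mulmxBr mulmx1 /G trmx_mul !mulmxA bz !mul0mx subr0.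
have PB i : \forall z \near z0, (row i (P z) <= B z)%MS.
  apply: coefficient_sub; apply: next_plus_gen => //.
    exact: smooth_near_row.
  near=> z; rewrite -row_mul.
  have [-> _] : P z *m (fu z)^T = 0 /\
    forall b : 'rV[R]_n, b *m (fu z)^T = 0 -> b *m P z = b by exact: (near PE z).
  exact: row0.
have PBo := near_forall PB; near=> z => b bz.
have [_ bP] : P z *m (fu z)^T = 0 /\
    forall b : 'rV[R]_n, b *m (fu z)^T = 0 -> b *m P z = b by exact: (near PE z).
have PBz : forall i, (row i (P z) <= B z)%MS by exact: (near PBo z).
rewrite -(bP b bz) (submx_trans (submxMl _ _)) //; exact/row_subP.
Unshelve. all: by end_near. Qed.

(** The points may repeat, so several vectors can come from one left kernel; [N] controls how close
    to z0 the points are. *)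
Definition kernel_family (N : set 'rV[R]_(n + m)) (y : 'rV[R]_n) k
    (zs : 'I_k -> 'rV[R]_(n + m)) (al : 'M[R]_(k, n)) :=
  row_free al /\ forall i, [/\ N (zs i), f (zs i) = y &
    row i al *m (fu (zs i))^T = 0].

(** By [fibre_constant] the spaces spanned by B at the points of one fibre agree, so all vectors of
    the family lie in the r-dimensional space at its first point. *)
Lemma kernel_family_bound : exists d : R, 0 < d /\ forall y k zs (al : 'M[R]_(k, n)),
  kernel_family (ball z0 d) y zs al -> (k <= r)%N.
Proof.
have [d [d0 Bd]] := fibre_constant.
have [e [e0 Ke]] := nbhs_ball_shrink left_kernel_sub.
have m0 : 0 < Num.min d e by rewrite lt_min d0 e0.
exists (Num.min d e); split=> // y [//|k] zs al [fal H].
have bd i : ball z0 d (zs i).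
  have [bz _ _] := H i; apply: le_ball bz; by rewrite ge_min lexx ?orbT.
have be i : ball z0 e (zs i).
  have [bz _ _] := H i; apply: le_ball bz; by rewrite ge_min lexx ?orbT.
have : (al <= B (zs 0))%MS.
  apply/row_subP => i; have [_ fi ai] := H i; have [_ f0 _] := H 0.
  apply: submx_trans (Ke _ (be i) _ ai) _.
  by apply: Bd => //; rewrite fi f0.
move=> /mxrankS; rewrite (eqP fal) => /leq_trans; apply; exact: rank_leq_row.
Qed.

(** A largest family is taken over z0. The forms whose coefficients on that fibre lie in the span of
    [al] are an invariant codistribution containing the generators, hence contain P_2^+; evaluation
    at z0 puts the r rows of B into the span. *)
Lemma kernel_family_exists (N : set 'rV[R]_(n + m)) : (\forall z \near z0, N z) ->
  exists k zs (al : 'M[R]_(k, n)), (r <= k)%N /\ kernel_family N (f z0) zs al.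
Proof.
move=> nN; pose F k := exists zs (al : 'M[R]_(k, n)), kernel_family N (f z0) zs al.
have F0 : exists k, `[< F k >].
  exists 0%N; apply/asboolP; exists (fun=> z0), 0; split; last by case.
  by rewrite /row_free mxrank0.
have Fn k : `[< F k >] -> (k <= n)%N.
  move=> /asboolP[zs [al [fal _]]].
  by have := rank_leq_col al; rewrite (eqP fal).
case: (ex_maxnP F0 Fn) => k /asboolP[zs [al [fal H]]] kmax.
exists k, zs, al; split=> //.
have maxal z (b : 'rV[R]_n) : N z -> f z = f z0 -> b *m (fu z)^T = 0 ->
    (b <= al)%MS.
  move=> Nz fz bz; apply: contraT => nb.
  have : `[< F (k + 1)%N >].
    apply/asboolP; exists (fun i => match fintype.split i with
      inl j => zs j | inr _ => z end), (col_mx al b).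
    split; first exact: row_free_col_mx.
    move=> i; case: (fintype.splitP i) => j ij.
      have [? ? ?] := H j; have -> : i = lshift 1 j by exact: val_inj.
      by rewrite rowKu.
    have -> : i = rshift k j by exact: val_inj.
    by rewrite rowKd ord1 row_id.
  by move=> /kmax; rewrite addn1 ltnn.
(* The condition concerns the fibre through z0 alone. Invariance still holds by [fibre_tangent],
   since the derivatives are taken along that fibre. *)
have QC w : Q w -> exists B', [/\ smooth_near z0 B',
    \forall z \near z0, f z = f z0 -> B' z *m cokermx al = 0 &
    \forall z \near z0, w z = B' z *m JT z].
  apply: (next_plus_min sf rJ
    (C := fun B' => \forall z \near z0, f z = f z0 -> B' z *m cokermx al = 0)).
  - by near=> z; rewrite mul0mx.
  - move=> B1 B2 H1 H2; near=> z => fz; rewrite mulmxDl.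
    have h1 : f z = f z0 -> B1 z *m cokermx al = 0 by exact: (near H1 z).
    have h2 : f z = f z0 -> B2 z *m cokermx al = 0 by exact: (near H2 z).
    by rewrite h1 // h2 // addr0.
  - move=> g B1 _ H1; near=> z => fz; rewrite -scalemxAl.
    have h1 : f z = f z0 -> B1 z *m cokermx al = 0 by exact: (near H1 z).
    by rewrite h1 // scaler0.
  - move=> v B1 sv vJ sB1 H1.
    have T := fibre_tangent sf rJ (smooth_near_mulmxr (cokermx al) sB1) H1.
    have sB1o := smooth_near_open sB1; near=> z => fz.
    have Tz : f z = f z0 -> forall v : 'rV[R]_(n + m), v *m 'J f z = 0 ->
      'D_v (fun x => B1 x *m cokermx al) z = 0 by exact: (near T z).
    have vz : v z *m 'J f z = 0 by exact: (near vJ z).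
    have sBz : smooth_near z B1 by exact: (near sB1o z).
    rewrite -(deriveEjacobian _ (smooth_near_diff sBz)).
    rewrite -(derive_mulmxr _ _ (smooth_near_diff sBz)).
    exact: Tz.
  - move=> B1 sB1 B10; near=> z => fz; apply/eqP; rewrite -submxE.
    by apply: (maxal z) => //; [exact: (near nN z)|exact: (near B10 z)].
have : (B z0 <= al)%MS.
  apply/row_subP => i.
  have Qi : Q (fun z => row i (B z) *m JT z).
    rewrite QB; split.
      exact: smooth_near_mulmx (smooth_near_row i sB) sJT.
    by near=> z; rewrite -row_mul; exact: row_sub.
  have [B1 [_ /nbhs_singleton B1a /nbhs_singleton BE]] := QC _ Qi.
  by rewrite (row_free_inj fJT BE) submxE B1a.
by move=> /mxrankS; rewrite (eqP fB) (eqP fal).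
Unshelve. all: by end_near. Qed.

End Basis.
End LeftKernels.

(** * Functions constant along the inputs *)

Section Retraction.
Context {R : realType}.

Lemma rank_mul_kernel p q k (M : 'M[R]_(p, q)) (A : 'M[R]_(q, k)) (v : 'rV[R]_p) :
  \rank (M *m A) = \rank M -> v *m M *m A = 0 -> v *m M = 0.
Proof.
move=> rMA vMA.
have : (kermx M <= kermx (M *m A))%MS.
  by apply/sub_kermxP; rewrite mulmxA mulmx_ker mul0mx.
move=> /submx_rank_eq H; apply/sub_kermxP; apply: submx_trans (H _).
  by apply/sub_kermxP; rewrite mulmxA.
by rewrite !mxrank_ker rMA.
Qed.

Lemma rank_block_triangular a b c k (X : 'M[R]_(a, c)) (Y : 'M[R]_(b, c))
    : \rank Y = c -> (k = a + c)%N ->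
  \rank (row_mx (col_mx 1%:M 0) (col_mx X Y) : 'M[R]_(a + b, a + c)) = k.
Proof.
move=> rY ->; apply/eqP; rewrite -mxrank_tr -/(row_free _) -block_mxEh tr_block_mx.
apply: inj_row_free => v; rewrite -[v]hsubmxK mul_row_block trmx1 trmx0 mulmx1.
rewrite mulmx0 add0r -row_mx0 => /eq_row_mx[E1 E2].
have fY : row_free Y^T by rewrite /row_free mxrank_tr rY.
have v2 : rsubmx v = 0 by apply: (row_free_inj fY); rewrite E2 mul0mx.
by move: E1; rewrite v2 mul0mx addr0 => ->; exact: row_mx0.
Qed.

Lemma submx_one_sub p k l (A : 'M[R]_(p, k)) (X : 'M[R]_(k, l)) (B : 'M[R]_(l, k)) :
  A *m (1%:M - X *m B) = 0 -> (A <= B)%MS.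
Proof.
by rewrite mulmxBr mulmx1 mulmxA => /eqP; rewrite subr_eq0 => /eqP ->; exact: submxMl.
Qed.

Lemma mul_one_sub_tr p k l (A : 'M[R]_(p, k)) (X : 'M[R]_(k, l)) (B : 'M[R]_(l, k))
    (b : 'rV[R]_k) :
  (B <= A)%MS -> b *m A^T = 0 -> b *m (1%:M - X *m B)^T = b.
Proof.
move=> /submxP[Y ->] bA; rewrite linearB /= trmx1 mulmxBr mulmx1 !trmx_mul.
by rewrite !mulmxA bA !mul0mx subr0.
Qed.

Lemma near_rank (V : normedModType R) p q z (M : V -> 'M[R]_(p, q)) :
  smooth_near z M -> \rank (M z) = q -> \forall x \near z, \rank (M x) = q.
Proof.
move=> sM rM; have fT : row_free (M z)^T by rewrite /row_free mxrank_tr rM.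
have H := near_row_free (smooth_near_tr sM) fT; near=> x.
have : row_free (M x)^T by exact: (near H x).
by rewrite /row_free mxrank_tr => /eqP.
Unshelve. all: by end_near. Qed.

Variables (n m : nat) (f : 'rV[R]_(n + m) -> 'rV[R]_n) (z0 : 'rV[R]_(n + m)).
Hypothesis sf : smooth_near z0 f.
Local Notation fu z := (dsubmx ('J f z)).

Lemma jacobian_lsub_row_mx p (g : 'rV[R]_(n + m) -> 'rV[R]_p) z :
  smooth_near z g ->
  'J (fun z => row_mx (lsubmx z) (g z)) z =
  row_mx (col_mx 1%:M 0) (col_mx (usubmx ('J g z)) (dsubmx ('J g z))).
Proof.
move=> sg; have sl := smooth_near_lsubmx (smooth_near_id z).
by rewrite jacobian_row_mx // jacobian_lsubmx vsubmxK.
Qed.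

Lemma rank_lsub_row_mx p (g : 'rV[R]_(n + m) -> 'rV[R]_p) z :
  smooth_near z g -> \rank (dsubmx ('J g z)) = p ->
  \rank ('J (fun z => row_mx (lsubmx z) (g z)) z) = (n + p)%N.
Proof.
by move=> sg rg; rewrite jacobian_lsub_row_mx //; exact: rank_block_triangular.
Qed.

Lemma lsub_row_mx_kernel p (g : 'rV[R]_(n + m) -> 'rV[R]_p) z
    (v : 'rV[R]_(n + m)) :
  smooth_near z g -> v *m 'J (fun z => row_mx (lsubmx z) (g z)) z = 0 ->
  lsubmx v = 0 /\ rsubmx v *m dsubmx ('J g z) = 0.
Proof.
move=> sg; rewrite jacobian_lsub_row_mx // -{1}[v]hsubmxK mul_mx_row !mul_row_col.
rewrite mulmx1 mulmx0 addr0 -row_mx0 => /eq_row_mx[E1].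
by rewrite E1 mul0mx add0r.
Qed.

(** For fixed x the function h depends on u through g only; this is [fibre_factor] for the map (x,u)
    -> (x, g(x,u)). *)
Lemma partial_factor p q (g : 'rV[R]_(n + m) -> 'rV[R]_p)
    (h : 'rV[R]_(n + m) -> 'rV[R]_q) (c := fun z => row_mx (lsubmx z) (g z)) :
  smooth_near z0 g -> \rank (dsubmx ('J g z0)) = p -> smooth_near z0 h ->
  (\forall z \near z0, forall u : 'rV[R]_m, u *m dsubmx ('J g z) = 0 ->
    u *m dsubmx ('J h z) = 0) ->
  exists s : 'rV[R]_(n + p) -> 'rV[R]_(n + m),
  [/\ smooth_near (c z0) s, s (c z0) = z0,
    \forall y \near c z0, c (s y) = y &
    \forall z \near z0, h (s (c z)) = h z].
Proof.
move=> sg rg sh gh.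
have sc : smooth_near z0 c.
  exact: smooth_near_row_mx (smooth_near_lsubmx (smooth_near_id _)) sg.
have rc := rank_lsub_row_mx sg rg.
have [s [ss sz cs]] := local_section sc rc; exists s; split=> //.
apply: (fibre_factor sc rc ss sz cs sh).
have [sgo sho] := (smooth_near_open sg, smooth_near_open sh).
near=> z => v vJ.
have sgz : smooth_near z g by exact: (near sgo z).
have shz : smooth_near z h by exact: (near sho z).
have ghz : forall u : 'rV[R]_m, u *m dsubmx ('J g z) = 0 ->
    u *m dsubmx ('J h z) = 0 by exact: (near gh z).
have [v1 v2] := lsub_row_mx_kernel sgz vJ.
rewrite (deriveEjacobian _ (smooth_near_diff shz)).
by rewrite -[v]hsubmxK -['J h z]vsubmxK mul_row_col v1 mul0mx add0r ghz.
Unshelve. all: by end_near. Qed.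

Variable rho : nat.
Hypothesis rfu : \forall z \near z0, \rank (fu z) = rho.

Let w (z : 'rV[R]_(n + m)) := row_mx (lsubmx z) (f z).

Let sw z : smooth_near z f -> smooth_near z w.
Proof.
exact: smooth_near_row_mx (smooth_near_lsubmx (smooth_near_id _)).
Qed.

(** By constant rank, rho combinations f A of the components of f determine f for given x. [Z] at
    (x,y) solves f A = y A for the input, which is possible nearby even if y is not reachable from
    x. *)
Lemma retraction : exists Z : 'rV[R]_(n + n) -> 'rV[R]_(n + m),
  [/\ smooth_near (w z0) Z, Z (w z0) = z0,
    \forall y \near w z0, lsubmx (Z y) = lsubmx y &
    \forall z \near z0, f (Z (w z)) = f z].
Proof.
have sfu : smooth_near z0 (fun z => fu z).
  exact: smooth_near_dsubmx (smooth_near_jacobian sf).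
have rT : \rank (fu z0)^T = rho by rewrite mxrank_tr (nbhs_singleton rfu).
have [U fU] := row_selection rT; pose A := U^T.
have rA : \rank (fu z0 *m A) = rho.
  by rewrite -mxrank_tr trmx_mul trmxK; exact/eqP.
pose g z := f z *m A.
have sg : smooth_near z0 g by exact: smooth_near_mulmxr.
have sfo := smooth_near_open sf.
have Jg z : smooth_near z f -> dsubmx ('J g z) = fu z *m A.
  move=> sfz; have -> : 'J g z = 'J f z *m A.
    apply: jacobianE => [|v].
      exact: smooth_near_diff (smooth_near_mulmxr _ sfz).
    rewrite (derive_mulmxr _ v (smooth_near_diff sfz)).
    by rewrite (deriveEjacobian v (smooth_near_diff sfz)) mulmxA.
  by rewrite mul_dsub_mx.
have rAo := near_rank (smooth_near_mulmxr A sfu) rA.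
have kg : \forall z \near z0, forall u : 'rV[R]_m, u *m dsubmx ('J g z) = 0 ->
    u *m fu z = 0.
  near=> z => u; rewrite Jg; last exact: (near sfo z).
  rewrite mulmxA; apply: rank_mul_kernel.
  have -> : \rank (fu z *m A) = rho by exact: (near rAo z).
  by apply/esym; exact: (near rfu z).
have [|s [ss sz cs fs]] := partial_factor sg _ sf kg; first by rewrite Jg.
pose a (y : 'rV[R]_(n + n)) := row_mx (lsubmx y) (rsubmx y *m A).
have sa y : smooth_near y a.
  apply: smooth_near_row_mx; first exact: smooth_near_lsubmx (smooth_near_id _).
  exact: smooth_near_mulmxr (smooth_near_rsubmx (smooth_near_id _)).
have aw z : a (w z) = row_mx (lsubmx z) (g z) by rewrite /a /w row_mxKl row_mxKr.
exists (fun y => s (a y)); split.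
- by apply: smooth_near_comp (sa _) _; rewrite aw.
- by rewrite aw.
- have H : \forall y \near w z0, row_mx (lsubmx (s (a y))) (g (s (a y))) = a y.
    have H : \forall y \near a (w z0), row_mx (lsubmx (s y)) (g (s y)) = y.
      by rewrite aw.
    exact: near_comp (sa _) H.
  near=> y; have : row_mx (lsubmx (s (a y))) (g (s (a y))) = a y.
    exact: (near H y).
  by case/eq_row_mx.
- by near=> z; rewrite aw; exact: (near fs z).
Unshelve. all: by end_near. Qed.

Section Equation.
Variable Z : 'rV[R]_(n + n) -> 'rV[R]_(n + m).
Hypothesis sZ : smooth_near (w z0) Z.
Hypothesis Zw0 : Z (w z0) = z0.
Hypothesis lZ : \forall y \near w z0, lsubmx (Z y) = lsubmx y.
Hypothesis fZ : \forall z \near z0, f (Z (w z)) = f z.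

(** A zero (x,y) of h near [w z0] is a pair with y = f(x,u), u being the input chosen by Z, because
    Z keeps x. *)
Let h (y : 'rV[R]_(n + n)) := rsubmx y - f (Z y).

Lemma retraction_equation_smooth : smooth_near (w z0) h.
Proof.
apply: smooth_near_sub (smooth_near_rsubmx (smooth_near_id _)) _.
by apply: smooth_near_comp sZ _; rewrite Zw0.
Qed.

(** Differentiating h (w z) = 0 in u gives the second claim. For the third, h_y = 1 - X f_u with f_u
    taken at Z (w z); with the second claim this puts the row space of f_u at z into the one at Z (w
    z), and equal ranks make them equal, so h_y^T does not change a left kernel vector at z. *)
Lemma retraction_equation : \forall z \near z0, [/\ h (w z) = 0,
  fu z *m dsubmx ('J h (w z)) = 0 &
  forall b : 'rV[R]_n, b *m (fu z)^T = 0 -> b *m (dsubmx ('J h (w z)))^T = b].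
Proof.
have sh := retraction_equation_smooth.
have hw : \forall z \near z0, h (w z) = 0.
  near=> z; have E : f (Z (w z)) = f z by exact: (near fZ z).
  by rewrite /h E /w row_mxKr subrr.
have hwo := near_join hw; have sfo := smooth_near_open sf.
have sho := near_comp (sw sf) (smooth_near_open sh).
have lZo := near_comp (sw sf) (near_join lZ).
have sZo := near_comp (sw sf) (smooth_near_open sZ).
have sZw := smooth_near_comp (sw sf) sZ.
have sfZo : \forall z \near z0, smooth_near (Z (w z)) f.
  have H : \forall z \near Z (w z0), smooth_near z f by rewrite Zw0.
  exact: near_comp sZw H.
have rZo : \forall z \near z0, \rank (fu (Z (w z))) = rho.
  have H : \forall z \near Z (w z0), \rank (fu z) = rho by rewrite Zw0.
  exact: near_comp sZw H.
near=> z.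
have hwz : \forall x \near z, h (w x) = 0 by exact: (near hwo z).
have sfz : smooth_near z f by exact: (near sfo z).
have shz : smooth_near (w z) h by exact: (near sho z).
have lZz : \forall y \near w z, lsubmx (Z y) = lsubmx y by exact: (near lZo z).
have sZz : smooth_near (w z) Z by exact: (near sZo z).
have sfZz : smooth_near (Z (w z)) f by exact: (near sfZo z).
have rz : \rank (fu z) = rho by exact: (near rfu z).
have rZz : \rank (fu (Z (w z))) = rho by exact: (near rZo z).
have Jw : 'J w z = row_mx (col_mx 1%:M 0) (col_mx (usubmx ('J f z)) (fu z)).
  exact: jacobian_lsub_row_mx.
have fuh : fu z *m dsubmx ('J h (w z)) = 0.
  apply/row_matrixP => i; rewrite row0 row_mul rowE.
  pose e : 'rV[R]_(n + m) := row_mx 0 (delta_mx 0 i).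
  have D0 : 'D_e (fun x => h (w x)) z = 0.
    rewrite (near_eq_derive e hwz); exact: derive_cst.
  move: D0; rewrite (derive_comp e (smooth_near_diff (sw sfz)) (smooth_near_diff shz)).
  rewrite (deriveEjacobian _ (smooth_near_diff (sw sfz))).
  rewrite (deriveEjacobian _ (smooth_near_diff shz)) Jw /e mul_mx_row.
  rewrite !mul_row_col !mul0mx mulmx0 !add0r -{1}['J h (w z)]vsubmxK mul_row_col.
  by rewrite mul0mx add0r.
split=> //; first exact: nbhs_singleton hwz.
(* Z keeps x, so its derivative in y has an input part only. *)
have lsubJZ : dsubmx ('J Z (w z)) *m col_mx 1%:M 0 = 0 :> 'M[R]_(n, n).
  apply/row_matrixP => i; rewrite row0 row_mul rowE.
  pose e : 'rV[R]_(n + n) := row_mx 0 (delta_mx 0 i).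
  have dZ := smooth_near_diff sZz.
  have E1 : 'D_e (fun y => lsubmx (Z y)) (w z) = lsubmx ('D_e Z (w z)).
    under eq_fun do rewrite lsubmx_mul.
    by rewrite (derive_mulmxr _ e dZ) -lsubmx_mul.
  have E2 : 'D_e (fun y : 'rV[R]_(n + n) => lsubmx y) (w z) = 0.
    under eq_fun do rewrite lsubmx_mul.
    by rewrite derive_mulmxr // derive_id -lsubmx_mul row_mxKl.
  have := near_eq_derive e lZz; rewrite E1 E2 (deriveEjacobian _ dZ) lsubmx_mul.
  by rewrite -['J Z (w z)]vsubmxK mul_row_col mul0mx add0r vsubmxK.
have hyE : dsubmx ('J h (w z)) =
    1%:M - rsubmx (dsubmx ('J Z (w z))) *m fu (Z (w z)).
  apply/row_matrixP => i; rewrite linearB /= !rowE.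
  pose e : 'rV[R]_(n + n) := row_mx 0 (delta_mx 0 i).
  have sfZ := smooth_near_comp sZz sfZz.
  have sr := smooth_near_rsubmx (smooth_near_id (w z)).
  have -> : delta_mx 0 i *m dsubmx ('J h (w z)) = 'D_e h (w z).
    rewrite (deriveEjacobian _ (smooth_near_diff shz)).
    by rewrite -{2}['J h (w z)]vsubmxK mul_row_col mul0mx add0r.
  rewrite (deriveB (diff_derivable (smooth_near_diff sr))
    (diff_derivable (smooth_near_diff sfZ))).
  congr (_ - _).
    under eq_fun do rewrite rsubmx_mul.
    by rewrite derive_mulmxr // derive_id -rsubmx_mul row_mxKr mulmx1.
  rewrite (derive_comp e (smooth_near_diff sZz) (smooth_near_diff sfZz)).
  rewrite (deriveEjacobian _ (smooth_near_diff sfZz)).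
  rewrite (deriveEjacobian _ (smooth_near_diff sZz)).
  rewrite -{1}['J Z (w z)]vsubmxK mul_row_col mul0mx add0r.
  rewrite -{1}[dsubmx ('J Z (w z))]hsubmxK lsubmx_mul lsubJZ.
  rewrite -{1}['J f (Z (w z))]vsubmxK -mulmxA mul_row_col mul0mx add0r.
  by [].
move=> b bz.
have fuZ : (fu z <= fu (Z (w z)))%MS.
  exact: submx_one_sub (etrans (congr1 (mulmx (fu z)) (esym hyE)) fuh).
have Zfu : (fu (Z (w z)) <= fu z)%MS.
  exact: submx_rank_eq fuZ (etrans rz (esym rZz)).
exact: etrans (congr1 (fun M => b *m M^T) hyE) (mul_one_sub_tr _ Zfu bz).
Unshelve. all: by end_near. Qed.

End Equation.
End Retraction.

(** * Straightening the kernel directions *)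

Section Dominated.
Context {R : realType} {V : normedModType R}.

Definition dominated p q a b (z : V) (A : V -> 'M[R]_(p, q))
    (g : V -> 'M[R]_(a, b)) :=
  exists c : R, 0 <= c /\ \forall x \near z, `|A x| <= c * `|g x|.

Lemma near_norm_bound p q z (A : V -> 'M[R]_(p, q)) : smooth_near z A ->
  exists c : R, 0 <= c /\ \forall x \near z, `|A x| <= c.
Proof.
move=> /smooth_near_cont sA; exists (`|A z| + 1); split; first by rewrite addr_ge0.
by move: sA => /cvgr_norm_le; apply; rewrite ltrDl.
Qed.

Lemma dominated_mulmxr p q s a b z (A : V -> 'M[R]_(p, q)) (B : V -> 'M[R]_(q, s))
    (g : V -> 'M[R]_(a, b)) :
  smooth_near z B -> dominated z A g -> dominated z (fun x => A x *m B x) g.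
Proof.
move=> /near_norm_bound[d [d0 Bd]] [c [c0 Ac]].
exists (q%:R * c * d); split; first by rewrite !mulr_ge0.
near=> x; rewrite (le_trans (mxnormM_le _ _)) //.
rewrite -!mulrA ler_wpM2l // [d * _]mulrC mulrA.
by apply: ler_pM => //; [exact: (near Ac x)|exact: (near Bd x)].
Unshelve. all: by end_near. Qed.

Lemma dominated_sub p q a b z (A B : V -> 'M[R]_(p, q)) (g : V -> 'M[R]_(a, b)) :
  dominated z A g -> dominated z B g -> dominated z (fun x => A x - B x) g.
Proof.
move=> [c [c0 Ac]] [d [d0 Bd]]; exists (c + d); split; first exact: addr_ge0.
near=> x; rewrite (le_trans (ler_normB _ _)) // mulrDl lerD //.
  exact: (near Ac x).
exact: (near Bd x).
Unshelve. all: by end_near. Qed.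

Lemma dominated_cols p s a b z (A : V -> 'M[R]_(p, s)) (B : 'I_s -> V -> 'cV[R]_p)
    (g : V -> 'M[R]_(a, b)) : (\forall x \near z, forall i j, A x i j = B j x i 0) ->
  (forall j, dominated z (B j) g) -> dominated z A g.
Proof.
move=> AB /(_ _)/cid -/all_sig[c Hc]; exists (\sum_j c j); split.
  by apply: sumr_ge0 => j _; have [] := Hc j.
have Bc : \forall x \near z, forall j, `|B j x| <= c j * `|g x|.
  by apply: near_forall => j; have [] := Hc j.
near=> x; apply: mxnorm_le => [|i j].
  by rewrite mulr_ge0 // sumr_ge0 // => j _; have [] := Hc j.
have -> : A x i j = B j x i 0 by move: i j; exact: (near AB x).
rewrite (le_trans (ler_mxnorm_entry _ _ _)) //.
have /le_trans -> // : `|B j x| <= c j * `|g x| by move: j; exact: (near Bc x).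
rewrite ler_wpM2r // (bigD1 j) //= lerDl.
by apply: sumr_ge0 => k _; have [] := Hc k.
Unshelve. all: by end_near. Qed.

Lemma derive_rows k p (F : 'I_k -> V -> 'rV[R]_p) z v :
  (forall i, smooth_near z (F i)) ->
  'D_v (fun x => \matrix_i F i x) z = \matrix_i 'D_v (F i) z.
Proof.
move=> sF; apply/matrixP => i j.
rewrite (derive_entry v i j (smooth_near_diff (smooth_near_rows sF))).
under eq_fun do rewrite mxE.
by rewrite [RHS]mxE (derive_entry v 0 j (smooth_near_diff (sF i))).
Qed.

End Dominated.

(** * Solving for the label of a leaf, and integrability by Gronwall *)

Section Straightening.
Context {R : realType}.
Variables (n r q : nat) (y0 : 'rV[R]_n) (h : 'rV[R]_(n + n) -> 'rV[R]_n).
Variables (xi : 'I_r -> 'rV[R]_n -> 'rV[R]_n) (al : 'M[R]_(r, n)).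
Variables (S : 'M[R]_(n, q)) (C : 'rV[R]_n -> 'M[R]_(r, n)).
Variable (V : 'rV[R]_n -> 'M[R]_(r + q, n)).
Local Notation hy v := (dsubmx ('J h v)).
Local Notation W y := (dsubmx (V y)).
Hypothesis nq : (r + q = n)%N.
Hypothesis sxi : forall i, smooth_near y0 (xi i).
Hypothesis sh : forall i, smooth_near (row_mx (xi i y0) y0) h.
Hypothesis hxi : forall i, \forall y \near y0, h (row_mx (xi i y) y) = 0.
Hypothesis alh : forall i,
  row i al *m (hy (row_mx (xi i y0) y0))^T = row i al.
Hypothesis sV : smooth_near y0 V.
Hypothesis VM : \forall y \near y0, V y *m row_mx (C y)^T S = 1%:M.
Hypothesis C0 : C y0 = al.
Hypothesis WL : forall i, exists L : R, 0 <= L /\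
  \forall v \near row_mx (xi i y0) y0, `|W (rsubmx v) *m hy v| <= L * `|h v|.

(** P is dual to [al] and satisfies P S = 0, so y0 + t P is transverse to the sought level sets. In
    v = (y, t), y is a state and t a label: [K i] pairs y with the i-th section over y0 + t P, [G]
    keeps one equation for each i, and [Ct] is its derivative in y. *)
Let P := usubmx (V y0).
Let K i (v : 'rV[R]_(n + r)) : 'rV[R]_(n + n) :=
  row_mx (xi i (y0 + rsubmx v *m P)) (lsubmx v).
Let G v : 'rV[R]_r := \row_i (h (K i v) *m (row i al)^T) 0 0.
Let Ct v : 'M[R]_(n, r) := \matrix_(j, i) (hy (K i v) *m (row i al)^T) j 0.
Let v0 : 'rV[R]_(n + r) := row_mx y0 0.

Let K0 i : K i v0 = row_mx (xi i y0) y0.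
Proof. by rewrite /K /v0 row_mxKr row_mxKl mul0mx addr0. Qed.

Let sK i : smooth_near v0 (K i).
Proof.
apply: smooth_near_row_mx (smooth_near_lsubmx (smooth_near_id _)).
apply: smooth_near_comp; last by rewrite /v0 row_mxKr mul0mx addr0.
apply: smooth_near_add (smooth_near_cst _ _) _.
exact: smooth_near_mulmxr (smooth_near_rsubmx (smooth_near_id _)).
Qed.

Let shK i : smooth_near v0 (fun v => h (K i v)).
Proof. by apply: smooth_near_comp (sK i) _; rewrite K0. Qed.

Let sG : smooth_near v0 G.
Proof.
apply: (smooth_near_entries
  (F := fun _ i v => (h (K i v) *m (row i al)^T) 0 0)) => [v i j|i j].
  by rewrite mxE.
by move: (smooth_near_mulmxr (row j al)^T (shK j)) => /smooth_near_mxP.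
Qed.

Let shyK i : smooth_near v0 (fun v => hy (K i v)).
Proof.
have sJ : smooth_near (K i v0) (fun v => hy v).
  by rewrite K0; exact: smooth_near_dsubmx (smooth_near_jacobian (sh i)).
exact: smooth_near_comp (sK i) sJ.
Qed.

Let sCt : smooth_near v0 Ct.
Proof.
apply: (smooth_near_entries
  (F := fun j i v => (hy (K i v) *m (row i al)^T) j 0)) => [v i j|i j].
  by rewrite mxE.
by move: (smooth_near_mulmxr (row j al)^T (shyK j)) => /smooth_near_mxP.
Qed.

Let usubJG : \forall v \near v0, usubmx ('J G v) = Ct v.
Proof.
have shK' : \forall v \near v0, forall i, smooth_near (K i v) h.
  apply: near_forall => i.
  apply: (near_comp (sK i) (P := fun v => smooth_near v h)); rewrite K0.
  exact: smooth_near_open (sh i).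
have sGo := smooth_near_open sG; near=> v.
have shv : forall i, smooth_near (K i v) h by exact: (near shK' v).
have sGv : smooth_near v G by exact: (near sGo v).
apply/matrixP => j i; pose d : 'rV[R]_n := delta_mx 0 j.
pose e : 'rV[R]_(n + r) := row_mx d 0.
pose io (y : 'rV[R]_n) := row_mx y (rsubmx v).
have sio y : smooth_near y io.
  exact: smooth_near_row_mx (smooth_near_id _) (smooth_near_cst _ _).
have iov : io (lsubmx v) = v by exact: hsubmxK.
have Dio : 'D_d io (lsubmx v) = e.
  rewrite (derive_row_mx d (smooth_near_id _) (smooth_near_cst _ _)).
  by rewrite derive_id derive_cst.
have sGio : smooth_near (io (lsubmx v)) G by rewrite iov.
have -> : usubmx ('J G v) j i = ('D_d (fun y => G (io y)) (lsubmx v)) 0 i.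
  rewrite (derive_comp d (smooth_near_diff (sio _)) (smooth_near_diff sGio)).
  rewrite Dio iov (deriveEjacobian _ (smooth_near_diff sGv)) /e.
  rewrite -{2}['J G v]vsubmxK mul_row_col mul0mx addr0 /d -rowE.
  by rewrite [RHS]mxE.
rewrite (derive_entry d 0 i (smooth_near_diff (smooth_near_comp (sio _) sGio))).
pose x := xi i (y0 + rsubmx v *m P); pose A := (row i al)^T.
pose ka (y : 'rV[R]_n) := row_mx x y.
have ska y : smooth_near y ka.
  exact: smooth_near_row_mx (smooth_near_cst _ _) (smooth_near_id _).
have kav : ka (lsubmx v) = K i v by [].
have -> : (fun y => G (io y) 0 i) = (fun y => (h (ka y) *m A) 0 0).
  by apply/funext => y; rewrite mxE /K /io row_mxKr row_mxKl.
have shka : smooth_near (lsubmx v) (fun y => h (ka y)).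
  by apply: smooth_near_comp (ska _) _; rewrite kav.
rewrite -(derive_entry d 0 0 (smooth_near_diff (smooth_near_mulmxr A shka))).
rewrite (derive_mulmxr _ d (smooth_near_diff shka)).
have Dka : 'D_d ka (lsubmx v) = row_mx 0 d.
  rewrite (derive_row_mx d (smooth_near_cst _ _) (smooth_near_id _)).
  by rewrite derive_id derive_cst.
have dh : differentiable h (ka (lsubmx v)) := smooth_near_diff (shv i).
rewrite (derive_comp d (smooth_near_diff (ska _)) dh) Dka.
rewrite (deriveEjacobian _ dh) kav -{1}['J h (K i v)]vsubmxK mul_row_col.
by rewrite mul0mx add0r -mulmxA /d -rowE [RHS]mxE [LHS]mxE.
Unshelve. all: by end_near. Qed.

Let V0 : P *m al^T = 1%:M /\ P *m S = 0.
Proof.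
have := nbhs_singleton VM; rewrite C0 -{1}[V y0]vsubmxK mul_col_row.
by rewrite scalar_mx_block => /eq_block_mx[].
Qed.

Let Ct0 : Ct v0 = al^T.
Proof.
apply/matrixP => j i; rewrite [LHS]mxE K0 -[X in (X *m _) j 0]trmxK -trmx_mul alh.
by rewrite !mxE.
Qed.

(** On the transversal the state is the base point of the sections themselves, and it is reached
    from each of them. *)
Let G0 : \forall t \near (0 : 'rV[R]_r), G (row_mx (y0 + t *m P) t) = 0.
Proof.
have H (i : 'I_r) : \forall t \near (0 : 'rV[R]_r),
    h (row_mx (xi i (y0 + t *m P)) (y0 + t *m P)) = 0.
  have st : smooth_near (0 : 'rV[R]_r) (fun t => y0 + t *m P).
    by apply: smooth_near_add (smooth_near_cst _ _) (smooth_near_mulr _ _).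
  apply: (near_comp st (P := fun y => h (row_mx (xi i y) y) = 0)).
  by rewrite mul0mx addr0.
have {}H := near_forall H; near=> t; apply/rowP => i; rewrite !mxE /K row_mxKl row_mxKr.
have -> : h (row_mx (xi i (y0 + t *m P)) (y0 + t *m P)) = 0.
  by move: i; exact: (near H t).
by apply: big1 => k _; rewrite mxE mul0r.
Unshelve. all: by end_near. Qed.

(** Differentiating [G0] in t gives P Ct + G_t = 0 at [v0], where P Ct = P al^T = 1. So G = 0 can be
    solved for t. *)
Let dsubJG : dsubmx ('J G v0) = - 1%:M.
Proof.
pose io (t : 'rV[R]_r) := row_mx (y0 + t *m P) t.
have st t : smooth_near t (fun t : 'rV[R]_r => y0 + t *m P).
  by apply: smooth_near_add (smooth_near_cst _ _) (smooth_near_mulr _ _).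
have sio t : smooth_near t io.
  exact: smooth_near_row_mx (st t) (smooth_near_id _).
have io0 : io 0 = v0 by rewrite /io mul0mx addr0.
apply/row_matrixP => i; rewrite !rowE; pose d : 'rV[R]_r := delta_mx 0 i.
have Dio : 'D_d io 0 = row_mx (d *m P) d.
  rewrite (derive_row_mx d (st 0) (smooth_near_id _)) derive_id.
  have sP := smooth_near_mulr P (0 : 'rV[R]_r).
  rewrite (deriveD (derivable_cst _ _ _) (diff_derivable (smooth_near_diff sP))).
  by rewrite derive_cst add0r (derive_mulmxr _ d (smooth_near_diff (smooth_near_id _))) derive_id.
have sGio : smooth_near (io 0) G by rewrite io0.
have : 'D_d (fun t => G (io t)) 0 = 0.
  rewrite (near_eq_derive d G0); exact: derive_cst.
rewrite (derive_comp d (smooth_near_diff (sio 0)) (smooth_near_diff sGio)) Dio io0.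
rewrite (deriveEjacobian _ (smooth_near_diff sG)).
rewrite -{1}['J G v0]vsubmxK mul_row_col (nbhs_singleton usubJG) Ct0.
rewrite -mulmxA V0.1 mulmx1 => /eqP; rewrite addrC addr_eq0 => /eqP ->.
by rewrite mulmxN mulmx1.
Qed.

(** The inverse function theorem for (y,t) -> (y, G(y,t)). Local uniqueness and [G0] identify the
    solution on the transversal as t. *)
Let implicit_function : exists psi : 'rV[R]_n -> 'rV[R]_r,
  [/\ smooth_near y0 psi, psi y0 = 0,
    \forall t \near (0 : 'rV[R]_r), psi (y0 + t *m P) = t &
    \forall y \near y0, G (row_mx y (psi y)) = 0].
Proof.
pose c (v : 'rV[R]_(n + r)) := row_mx (lsubmx v) (G v).
have sc : smooth_near v0 c.
  exact: smooth_near_row_mx (smooth_near_lsubmx (smooth_near_id _)) sG.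
have rc : \rank ('J c v0) = (n + r)%N.
  by apply: rank_lsub_row_mx sG _; rewrite dsubJG mxrank_opp mxrank1.
have [_ [Psi [sPsi PsiK cK]]] := local_diffeo_rank erefl sc rc.
have cv0 : c v0 = row_mx y0 0.
  have := nbhs_singleton G0; rewrite mul0mx addr0 => G00.
  by rewrite /c /v0 row_mxKl G00.
pose io (y : 'rV[R]_n) : 'rV[R]_(n + r) := row_mx y 0.
have sio y : smooth_near y io.
  exact: smooth_near_row_mx (smooth_near_id _) (smooth_near_cst _ _).
have sPio : smooth_near y0 (fun y => Psi (io y)).
  by apply: smooth_near_comp (sio y0) _; rewrite /io -cv0.
exists (fun y => rsubmx (Psi (io y))); split.
- exact: smooth_near_rsubmx.
- by rewrite /io -cv0 (nbhs_singleton PsiK) /v0 row_mxKr.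
- pose ka (t : 'rV[R]_r) := row_mx (y0 + t *m P) t.
  have ska t : smooth_near t ka.
    apply: smooth_near_row_mx (smooth_near_id _).
    by apply: smooth_near_add (smooth_near_cst _ _) (smooth_near_mulr _ _).
  have H : \forall t \near (0 : 'rV[R]_r), Psi (c (ka t)) = ka t.
    apply: (near_comp (ska 0) (P := fun v => Psi (c v) = v)).
    by rewrite /ka mul0mx addr0.
  near=> t; have E1 : Psi (c (ka t)) = ka t by exact: (near H t).
  have E2 : G (ka t) = 0 by exact: (near G0 t).
  by move: E1; rewrite /c E2 {1}/ka row_mxKl => ->; rewrite row_mxKr.
- have H : \forall y \near y0, c (Psi (io y)) = io y.
    apply: (near_comp (sio y0) (P := fun v => c (Psi v) = v)).
    by rewrite /io -cv0.
  near=> y; have : c (Psi (io y)) = io y by exact: (near H y).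
  case/eq_row_mx => E1 E2.
  by rewrite -{1}E1 hsubmxK.
Unshelve. all: by end_near. Qed.

Section ImplicitFunction.
Variable psi : 'rV[R]_n -> 'rV[R]_r.
Hypothesis spsi : smooth_near y0 psi.
Hypothesis psi0 : psi y0 = 0.
Hypothesis psiP : \forall t \near (0 : 'rV[R]_r), psi (y0 + t *m P) = t.
Hypothesis Gpsi : \forall y \near y0, G (row_mx y (psi y)) = 0.

Let pt (y : 'rV[R]_n) : 'rV[R]_(n + r) := row_mx y (psi y).

Let spt : smooth_near y0 pt.
Proof. exact: smooth_near_row_mx (smooth_near_id _) spsi. Qed.

Let pt0 : pt y0 = v0.
Proof. by rewrite /pt psi0. Qed.

(** Implicit differentiation. As G_t is invertible, psi' and Ct are killed by the same vectors v. *)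
Let jacobian_psi : \forall y \near y0,
  dsubmx ('J G (pt y)) \in unitmx /\ Ct (pt y) + 'J psi y *m dsubmx ('J G (pt y)) = 0.
Proof.
have sJG : smooth_near v0 (fun v => dsubmx ('J G v)).
  exact: smooth_near_dsubmx (smooth_near_jacobian sG).
have uG : \forall v \near v0, dsubmx ('J G v) \in unitmx.
  by apply: near_unitmx sJG _; rewrite dsubJG -scaleN1r unitmxZ ?unitmx1 ?unitrN1.
have H : \forall v \near v0, [/\ dsubmx ('J G v) \in unitmx, smooth_near v G &
    usubmx ('J G v) = Ct v].
  have sGo := smooth_near_open sG.
  by near=> v; split; [exact: (near uG v)|exact: (near sGo v)|exact: (near usubJG v)].
have Hpt : \forall y \near y0, [/\ dsubmx ('J G (pt y)) \in unitmx,
    smooth_near (pt y) G & usubmx ('J G (pt y)) = Ct (pt y)].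
  apply: (near_comp spt (P := fun v => [/\ dsubmx ('J G v) \in unitmx,
    smooth_near v G & usubmx ('J G v) = Ct v])).
  by rewrite pt0.
have Go := near_join Gpsi; have so := smooth_near_open spsi.
near=> y.
have [uy sGy uCt] : [/\ dsubmx ('J G (pt y)) \in unitmx,
    smooth_near (pt y) G & usubmx ('J G (pt y)) = Ct (pt y)] by exact: (near Hpt y).
have sy : smooth_near y psi by exact: (near so y).
have Gy : \forall x \near y, G (row_mx x (psi x)) = 0 by exact: (near Go y).
split=> //; rewrite -uCt; apply/row_matrixP => i; rewrite row0 rowE.
pose d : 'rV[R]_n := delta_mx 0 i.
have spy : smooth_near y pt := smooth_near_row_mx (smooth_near_id _) sy.
have : 'D_d (fun x => G (pt x)) y = 0.
  rewrite (near_eq_derive d Gy); exact: derive_cst.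
rewrite (derive_comp d (smooth_near_diff spy) (smooth_near_diff sGy)).
rewrite (derive_row_mx d (smooth_near_id _) sy) derive_id.
rewrite (deriveEjacobian _ (smooth_near_diff sGy)).
rewrite (deriveEjacobian _ (smooth_near_diff sy)).
by rewrite -{1}['J G (pt y)]vsubmxK mul_row_col mulmxDr mulmxA.
Unshelve. all: by end_near. Qed.

Let P_jacobian_psi : P *m 'J psi y0 = 1%:M.
Proof.
have [_] := nbhs_singleton jacobian_psi.
rewrite pt0 Ct0 dsubJG mulmxN mulmx1 => /eqP; rewrite subr_eq0 => /eqP <-.
exact: V0.1.
Qed.

Let rank_jacobian_psi : \rank ('J psi y0) = r.
Proof.
apply/eqP; rewrite -mxrank_tr -/(row_free _).
by apply/row_freeP; exists P^T; rewrite -trmx_mul P_jacobian_psi trmx1.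
Qed.

(** All n components of h for every i, of which [G] retains one combination each. Their vanishing is
    the integrability that Frobenius' theorem would provide. *)
Let qh (y : 'rV[R]_n) : 'M[R]_(r, n) := \matrix_i h (K i (pt y)).

Let shpt i : smooth_near y0 (fun y => h (K i (pt y))).
Proof.
have sKpt : smooth_near (pt y0) (K i) by rewrite pt0.
by apply: smooth_near_comp (smooth_near_comp spt sKpt) _; rewrite pt0 K0.
Qed.

Let sqh : smooth_near y0 qh.
Proof. exact: smooth_near_rows. Qed.

Let W_hy_dominated i :
  dominated y0 (fun y => W y *m hy (K i (pt y))) qh.
Proof.
have [L [L0 H]] := WL i; exists L; split=> //.
have sKpt : smooth_near y0 (fun y => K i (pt y)).
  by apply: smooth_near_comp spt _; rewrite pt0.
have {}H : \forall y \near y0,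
    `|W (rsubmx (K i (pt y))) *m hy (K i (pt y))| <= L * `|h (K i (pt y))|.
  apply: (near_comp sKpt
    (P := fun v => `|W (rsubmx v) *m hy v| <= L * `|h v|)).
  by rewrite pt0 K0.
near=> y; have yE : rsubmx (K i (pt y)) = y by rewrite /K /pt row_mxKr row_mxKl.
have Hy : `|W (rsubmx (K i (pt y))) *m hy (K i (pt y))| <= L * `|h (K i (pt y))|.
  exact: (near H y).
rewrite -{1}yE (le_trans Hy) // ler_wpM2l //.
apply: mxnorm_le => // a j; rewrite ord1.
apply: le_trans (ler_mxnorm_entry (qh y) i j).
by rewrite [X in _ <= `|X|]mxE.
Unshelve. all: by end_near. Qed.

Let W_Ct_dominated : dominated y0 (fun y => W y *m Ct (pt y)) qh.
Proof.
apply: (dominated_cols (B := fun i y => W y *m hy (K i (pt y)) *m (row i al)^T)).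
  near=> y => a i; rewrite -mulmxA [LHS]mxE [RHS]mxE; apply: eq_bigr => k _.
  by congr (_ * _); rewrite [LHS]mxE.
by move=> i; apply: dominated_mulmxr (W_hy_dominated i); exact: smooth_near_cst.
Unshelve. all: by end_near. Qed.

Let MV : \forall y \near y0, row_mx (C y)^T S *m V y = 1%:M.
Proof.
near=> y; have VMy : V y *m row_mx (C y)^T S = 1%:M by exact: (near VM y).
move: (V y) (row_mx (C y)^T S) VMy; rewrite nq => A B; exact: mulmx1C.
Unshelve. all: by end_near. Qed.

(* With a = v C^T and b = v S, v = a P' + b W for P' the first rows of V; then
   v Ct = 0 reads a (P' Ct) = - b (W Ct), where P' Ct is close to 1. *)
Let kernel_bound i : exists c : R, 0 <= c /\ \forall y \near y0,
  forall v : 'rV[R]_n, v *m Ct (pt y) = 0 ->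
    `|v *m hy (K i (pt y))| <= c * `|v| * `|qh y|.
Proof.
pose P' y := usubmx (V y); pose D y := P' y *m Ct (pt y).
have sP' : smooth_near y0 P' := smooth_near_usubmx sV.
have sCpt : smooth_near y0 (fun y => Ct (pt y)).
  by apply: smooth_near_comp spt _; rewrite pt0.
have sD : smooth_near y0 D := smooth_near_mulmx sP' sCpt.
have D0 : D y0 = 1%:M by rewrite /D pt0 Ct0; exact: V0.1.
have uD0 : D y0 \in unitmx by rewrite D0 unitmx1.
have uD := near_unitmx sD uD0.
have shpt' : smooth_near y0 (fun y => hy (K i (pt y))).
  have shK' : smooth_near (pt y0) (fun v => hy (K i v)) by rewrite pt0; exact: shyK.
  exact: smooth_near_comp spt shK'.
pose N y := W y *m hy (K i (pt y)) -
  W y *m Ct (pt y) *m (invmx (D y) *m P' y *m hy (K i (pt y))).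
have [c [c0 Nc]] : dominated y0 N qh.
  apply: dominated_sub (W_hy_dominated i) (dominated_mulmxr _ W_Ct_dominated).
  exact: smooth_near_mulmx (smooth_near_mulmx (smooth_near_invmx sD uD0) sP') shpt'.
exists (q%:R * (n%:R * `|S|) * c); split; first by rewrite !mulr_ge0.
near=> y => v vC.
have MVy : row_mx (C y)^T S *m V y = 1%:M by exact: (near MV y).
have uDy : D y \in unitmx by exact: (near uD y).
have Ncy : `|N y| <= c * `|qh y| by exact: (near Nc y).
have vE : v = v *m (C y)^T *m P' y + v *m S *m W y.
  rewrite -{1}[v]mulmx1 -MVy -{1}[V y]vsubmxK mulmxA mul_mx_row.
  by rewrite mul_row_col.
have aE : v *m (C y)^T = - (v *m S *m W y *m Ct (pt y) *m invmx (D y)).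
  have : v *m (C y)^T *m D y + v *m S *m W y *m Ct (pt y) = 0.
    by rewrite /D mulmxA -mulmxDl -vE.
  move=> /eqP; rewrite addr_eq0 => /eqP E.
  by rewrite -[LHS](mulmxK uDy) E mulNmx.
have -> : v *m hy (K i (pt y)) = v *m S *m N y.
  rewrite {1}vE aE /N mulmxDl mulmxBr !mulNmx !mulmxA addrC.
  by [].
rewrite (le_trans (mxnormM_le _ _)) //.
have H1 : `|v *m S| <= n%:R * `|v| * `|S| by exact: mxnormM_le.
have -> : q%:R * (n%:R * `|S|) * c * `|v| * `|qh y| =
  q%:R * ((n%:R * `|v| * `|S|) * (c * `|qh y|)) by ring.
by rewrite -mulrA ler_wpM2l // ler_pM.
Unshelve. all: by end_near. Qed.

(** Along the kernel of psi' the base point y0 + psi(y) P stands still, so only the second argument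
    of h moves. *)
Let derive_qh : \forall y \near y0, differentiable qh y /\
  forall v : 'rV[R]_n, v *m 'J psi y = 0 ->
    'D_v qh y = \matrix_i (v *m hy (K i (pt y))).
Proof.
pose eta (y : 'rV[R]_n) := y0 + psi y *m P.
have seta y : smooth_near y psi -> smooth_near y eta.
  by move=> sy; apply: smooth_near_add (smooth_near_cst _ _) (smooth_near_mulmxr _ sy).
have eta0 : eta y0 = y0 by rewrite /eta psi0 mul0mx addr0.
have kE i : (fun y => K i (pt y)) = (fun y => row_mx (xi i (eta y)) y).
  by apply/funext => y; rewrite /K /pt row_mxKl row_mxKr.
have sxo i : \forall y \near y0, smooth_near (eta y) (xi i).
  apply: (near_comp (seta y0 spsi) (P := fun y => smooth_near y (xi i))).
  by rewrite eta0; exact: smooth_near_open.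
have skpt i : smooth_near y0 (fun y => K i (pt y)).
  by apply: smooth_near_comp spt _; rewrite pt0.
have sho i : \forall y \near y0, smooth_near (K i (pt y)) h.
  apply: (near_comp (skpt i) (P := fun v => smooth_near v h)).
  by rewrite pt0 K0; exact: smooth_near_open.
have [sxo' sho'] := (near_forall sxo, near_forall sho).
have so := smooth_near_open spsi; near=> y.
have sx : forall i, smooth_near (eta y) (xi i) by exact: (near sxo' y).
have shy : forall i, smooth_near (K i (pt y)) h by exact: (near sho' y).
have sy : smooth_near y psi by exact: (near so y).
have sky i : smooth_near y (fun y => K i (pt y)).
  rewrite kE; exact: smooth_near_row_mx (smooth_near_comp (seta y sy) (sx i)) (smooth_near_id _).
have srow i : smooth_near y (fun y => h (K i (pt y))).
  exact: smooth_near_comp (sky i) (shy i).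
have sq : smooth_near y qh by exact: smooth_near_rows.
split=> [|v vJ]; first exact: smooth_near_diff.
rewrite (derive_rows v srow); apply/row_matrixP => i; rewrite !rowK.
rewrite (derive_comp v (smooth_near_diff (sky i)) (smooth_near_diff (shy i))).
rewrite (deriveEjacobian _ (smooth_near_diff (shy i))).
have Deta : 'D_v eta y = 0.
  have sP := smooth_near_mulmxr P sy.
  rewrite (deriveD (derivable_cst _ _ _) (diff_derivable (smooth_near_diff sP))).
  rewrite derive_cst add0r (derive_mulmxr _ v (smooth_near_diff sy)).
  by rewrite (deriveEjacobian _ (smooth_near_diff sy)) vJ mul0mx.
have -> : 'D_v (fun y => K i (pt y)) y = row_mx 0 v.
  rewrite kE (derive_row_mx v (smooth_near_comp (seta y sy) (sx i)) (smooth_near_id _)).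
  rewrite (derive_comp v (smooth_near_diff (seta y sy)) (smooth_near_diff (sx i))).
  rewrite (deriveEjacobian _ (smooth_near_diff (sx i))) Deta mul0mx.
  by rewrite derive_id.
by rewrite -{1}['J h _]vsubmxK mul_row_col mul0mx add0r.
Unshelve. all: by end_near. Qed.

(** The point y0 + psi(y) P of the transversal lies on the level set of y, and h vanishes there for
    every i. The estimate of [kernel_bound] carries this zero along the level set to y. *)
Let qh_vanish : \forall y \near y0, qh y = 0.
Proof.
have /all_sig[c Hc] : forall i, {c : R | 0 <= c /\ \forall y \near y0,
    forall v : 'rV[R]_n, v *m Ct (pt y) = 0 ->
      `|v *m hy (K i (pt y))| <= c * `|v| * `|qh y|}.
  by move=> i; apply: cid; exact: kernel_bound.
have Hc' : \forall y \near y0, forall i (v : 'rV[R]_n), v *m Ct (pt y) = 0 ->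
      `|v *m hy (K i (pt y))| <= c i * `|v| * `|qh y|.
  by apply: near_forall => i; have [] := Hc i.
pose L := \sum_i c i; have L0 : 0 <= L by apply: sumr_ge0 => i _; have [] := Hc i.
pose A y := differentiable qh y /\
  forall v : 'rV[R]_n, v *m 'J psi y = 0 -> `|'D_v qh y| <= L * `|v| * `|qh y|.
have nA : \forall y \near y0, A y.
  have [dq Jp] := (derive_qh, jacobian_psi); near=> y.
  have [dqy Dy] : differentiable qh y /\
      forall v : 'rV[R]_n, v *m 'J psi y = 0 ->
        'D_v qh y = \matrix_i (v *m hy (K i (pt y))) by exact: (near dq y).
  have [_ CJ] : dsubmx ('J G (pt y)) \in unitmx /\
      Ct (pt y) + 'J psi y *m dsubmx ('J G (pt y)) = 0 by exact: (near Jp y).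
  have Hy : forall i (v : 'rV[R]_n), v *m Ct (pt y) = 0 ->
      `|v *m hy (K i (pt y))| <= c i * `|v| * `|qh y| by exact: (near Hc' y).
  split=> // v vJ; rewrite (Dy v vJ); apply: mxnorm_le => [|i j].
    by rewrite !mulr_ge0.
  have vC : v *m Ct (pt y) = 0.
    move: CJ => /eqP; rewrite addr_eq0 => /eqP ->.
    by rewrite mulmxN mulmxA vJ mul0mx oppr0.
  rewrite [X in `|X|]mxE (le_trans (ler_mxnorm_entry _ _ _)) //.
  rewrite (le_trans (Hy i v vC)) // !ler_wpM2r // /L (bigD1 i) //= lerDl.
  by apply: sumr_ge0 => k _; have [] := Hc k.
have [d [d0 H]] := fibre_vanish spsi rank_jacobian_psi nA.
pose eta (y : 'rV[R]_n) := y0 + psi y *m P.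
have seta : smooth_near y0 eta.
  exact: smooth_near_add (smooth_near_cst _ _) (smooth_near_mulmxr _ spsi).
have eta0 : eta y0 = y0 by rewrite /eta psi0 mul0mx addr0.
have b1 : \forall y \near y0, ball y0 d y by exact: nbhsx_ballx.
have b2 : \forall y \near y0, ball y0 d (eta y).
  apply: (near_comp seta (P := ball y0 d)); rewrite eta0; exact: nbhsx_ballx.
have pe : \forall y \near y0, psi (eta y) = psi y.
  apply: (near_comp spsi (P := fun t => psi (y0 + t *m P) = t)).
  by rewrite psi0.
have he : \forall y \near y0, forall i, h (row_mx (xi i (eta y)) (eta y)) = 0.
  apply: near_forall => i.
  apply: (near_comp seta (P := fun y => h (row_mx (xi i y) y) = 0)).
  by rewrite eta0.
near=> y.
have pey : psi (eta y) = psi y by exact: (near pe y).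
have hey : forall i, h (row_mx (xi i (eta y)) (eta y)) = 0 by exact: (near he y).
apply: (H _ _ qh L L0 (fun x (Ax : A x) => Ax) (eta y) y _ _ pey).
- exact: (near b2 y).
- exact: (near b1 y).
- apply/row_matrixP => i; rewrite row0 rowK /K /pt row_mxKl row_mxKr pey; exact: hey.
Unshelve. all: by end_near. Qed.

(** W Ct is O(qh), which is now 0, and psi' is - Ct times the inverse of G_t. *)
Let W_jacobian_psi : \forall y \near y0, W y *m 'J psi y = 0.
Proof.
have [c [_ Wc]] := W_Ct_dominated.
have [Jp q0] := (jacobian_psi, qh_vanish); near=> y.
have [uy CJ] : dsubmx ('J G (pt y)) \in unitmx /\
    Ct (pt y) + 'J psi y *m dsubmx ('J G (pt y)) = 0 by exact: (near Jp y).
have qy : qh y = 0 by exact: (near q0 y).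
have : `|W y *m Ct (pt y)| <= c * `|qh y| by exact: (near Wc y).
rewrite qy normr0 mulr0 normr_le0 => /eqP WC0.
move: CJ => /(congr1 (mulmx (W y))); rewrite mulmxDr WC0 add0r mulmx0 mulmxA => E.
by rewrite -[LHS](mulmxK uy) E mul0mx.
Unshelve. all: by end_near. Qed.

(** Multiplication by V(y0) gives the identity, block by block: P psi' = 1, P S = 0, W psi' = 0 and
    W S = 1. *)
Let rank_chart : \rank (row_mx ('J psi y0) S) = n.
Proof.
have VM0 := nbhs_singleton VM.
have E : V y0 *m row_mx ('J psi y0) S = 1%:M.
  rewrite -{1}[V y0]vsubmxK mul_col_row P_jacobian_psi V0.2.
  rewrite (nbhs_singleton W_jacobian_psi).
  move: VM0; rewrite -{1}[V y0]vsubmxK mul_col_row scalar_mx_block.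
  by move=> /eq_block_mx[_ _ _ ->].
apply/eqP; rewrite eqn_leq rank_leq_row -[X in (X <= _)%N]nq.
by rewrite -{1}(mxrank1 R (r + q)) -E mxrankM_maxr.
Qed.

Lemma implicit_straightening : exists phi : 'rV[R]_n -> 'rV[R]_r,
  [/\ smooth_near y0 phi, \rank (row_mx ('J phi y0) S) = n &
    \forall y \near y0, W y *m 'J phi y = 0].
Proof. by exists psi. Qed.

End ImplicitFunction.

Lemma straightening : exists psi : 'rV[R]_n -> 'rV[R]_r,
  [/\ smooth_near y0 psi, \rank (row_mx ('J psi y0) S) = n &
    \forall y \near y0, W y *m 'J psi y = 0].
Proof.
have [psi [spsi psi0 psiP Gpsi]] := implicit_function.
exact: implicit_straightening psiP Gpsi.
Qed.

End Straightening.

(** * Straightening applied to the left kernels of the system *)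

Section KernelStraightening.
Context {R : realType}.

(** Double annihilator: the transposed columns of [cokermx A] are vectors b with b A^T = 0, hence
    lie in the span of C and are killed by W. *)
Lemma submx_kernel_dual p k l N (A : 'M[R]_(p, N)) (C : 'M[R]_(k, N))
    (W : 'M[R]_(l, N)) :
  (forall b : 'rV[R]_N, b *m A^T = 0 -> (b <= C)%MS) -> W *m C^T = 0 ->
  (W <= A)%MS.
Proof.
move=> AC WC; rewrite submxE; apply/eqP.
have /submxP[X EX] : ((cokermx A)^T <= C)%MS.
  apply/row_subP => i; apply: AC.
  by rewrite -row_mul -trmx_mul mulmx_coker trmx0 row0.
by rewrite -[cokermx A]trmxK EX trmx_mul mulmxA WC mul0mx.
Qed.

(** The constant columns S complete C^T at z, hence also nearby. The lower rows of D are then a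
    smooth frame of the annihilator of C, normalized by S. *)
Lemma dual_frame (V : normedModType R) k N z (C : V -> 'M[R]_(k, N)) :
  smooth_near z C -> row_free (C z) ->
  exists q (S : 'M[R]_(N, q)) (D : V -> 'M[R]_(k + q, N)),
  [/\ (k + q = N)%N, smooth_near z D &
    \forall x \near z, D x *m row_mx (C x)^T S = 1%:M].
Proof.
move=> sC fC; have rC : \rank (C z)^T = k by rewrite mxrank_tr; exact/eqP.
have [q [S [kq rS]]] := complete_cols rC.
pose M x := (row_mx (C x)^T S)^T.
have sM : smooth_near z M.
  apply: smooth_near_tr; apply: smooth_near_row_mx (smooth_near_cst _ _).
  exact: smooth_near_tr.
have fM : row_free (M z) by rewrite /row_free /M mxrank_tr rS kq.
exists q, S, (fun x => (rinv (M x))^T); split=> //.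
  exact: smooth_near_tr (smooth_near_rinv sM fM).
have fMo := near_row_free sM fM; near=> x.
have fMx : row_free (M x) by exact: (near fMo x).
by rewrite -[row_mx _ _]trmxK -trmx_mul mul_rinv // trmx1.
Unshelve. all: by end_near. Qed.

Variables (n m : nat) (f : 'rV[R]_(n + m) -> 'rV[R]_n) (z0 : 'rV[R]_(n + m)).
Hypothesis sf : smooth_near z0 f.
Hypothesis rJ : \rank ('J f z0) = n.
Variable rho : nat.
Hypothesis rfu : \forall z \near z0, \rank (dsubmx ('J f z)) = rho.
Variable r : nat.
Hypothesis dimQ : has_dim z0 (next_plus f z0 (@span_dx R n m z0)) r.

Local Notation fu z := (dsubmx ('J f z)).
Let w (z : 'rV[R]_(n + m)) := row_mx (lsubmx z) (f z).

Let sw z : smooth_near z f -> smooth_near z w.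
Proof.
exact: smooth_near_row_mx (smooth_near_lsubmx (smooth_near_id _)).
Qed.

Section Family.
Variables (d : R) (Z : 'rV[R]_(n + n) -> 'rV[R]_(n + m)).
Variables (zs : 'I_r -> 'rV[R]_(n + m)) (al : 'M[R]_(r, n)).
Let h (v : 'rV[R]_(n + n)) := rsubmx v - f (Z v).
Local Notation hy v := (dsubmx ('J h v)).
Let y0 := f z0.
Hypothesis d0 : 0 < d.
Hypothesis bound : forall y k zs' (al' : 'M[R]_(k, n)),
  kernel_family f (ball z0 d) y zs' al' -> (k <= r)%N.
Let good z := [/\ ball z0 d z, smooth_near z f, \rank ('J f z) = n &
  [/\ h (w z) = 0, fu z *m hy (w z) = 0 &
    forall b : 'rV[R]_n, b *m (fu z)^T = 0 -> b *m (hy (w z))^T = b]].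
Hypothesis fal : row_free al.
Hypothesis goodzs : forall i, \forall z \near zs i, good z.
Hypothesis goodZ : forall i, \forall z \near Z (w (zs i)), good z.
Hypothesis shzs : forall i, smooth_near (w (zs i)) h.
Hypothesis sZzs : forall i, smooth_near (w (zs i)) Z.
Hypothesis lZzs : forall i, \forall v \near w (zs i), lsubmx (Z v) = lsubmx v.
Hypothesis fZzs : forall i, f (Z (w (zs i))) = f (zs i).
Hypothesis fzs : forall i, f (zs i) = y0.
Hypothesis alzs : forall i, row i al *m (fu (zs i))^T = 0.

Section Sections.
Variable sg : 'I_r -> 'rV[R]_n -> 'rV[R]_(n + m).
Hypothesis ssg : forall i, smooth_near y0 (sg i).
Hypothesis sg0 : forall i, sg i y0 = zs i.
Hypothesis fsg : forall i, \forall y \near y0, f (sg i y) = y.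

Let xi i y := lsubmx (sg i y).
(** On the graph, f_u h_y = 0 says that h_y^T maps into the left kernel, and it fixes al_i at y0.
    The rows thus continue the al_i along the sections as left kernel vectors. *)
Let C y : 'M[R]_(r, n) := \matrix_i (row i al *m (hy (row_mx (xi i y) y))^T).

Let sxi i : smooth_near y0 (xi i).
Proof. exact: smooth_near_lsubmx (ssg i). Qed.

Let xi0 i : row_mx (xi i y0) y0 = w (zs i).
Proof. by rewrite /xi sg0 /w fzs. Qed.

Let shxi i : smooth_near (row_mx (xi i y0) y0) h.
Proof. by rewrite xi0. Qed.

Let sxiy i : smooth_near y0 (fun y => row_mx (xi i y) y).
Proof. exact: smooth_near_row_mx (sxi i) (smooth_near_id _). Qed.

Let goodsg i : \forall y \near y0, good (sg i y).
Proof. by apply: (near_comp (ssg i) (P := good)); rewrite sg0. Qed.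

Let hxi i : \forall y \near y0, h (row_mx (xi i y) y) = 0.
Proof.
have [go fo] := (goodsg i, fsg i); near=> y.
have [_ _ _ [hw _ _]] : good (sg i y) by exact: (near go y).
have fy : f (sg i y) = y by exact: (near fo y).
by move: hw; rewrite /w fy.
Unshelve. all: by end_near. Qed.

Let alh i : row i al *m (hy (row_mx (xi i y0) y0))^T = row i al.
Proof.
have [_ _ _ [_ _ H]] := nbhs_singleton (goodzs i).
by rewrite xi0 H.
Qed.

Let sC : smooth_near y0 C.
Proof.
apply: smooth_near_rows => i.
apply: smooth_near_mulmx; first exact: smooth_near_cst.
apply: smooth_near_tr.
have sJ : smooth_near (row_mx (xi i y0) y0) (fun v => hy v).
  exact: smooth_near_dsubmx (smooth_near_jacobian (shxi i)).
exact: smooth_near_comp (sxiy i) sJ.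
Qed.

Let C0 : C y0 = al.
Proof. by apply/row_matrixP => i; rewrite rowK alh. Qed.

(** The rows of C y are r independent left kernel vectors over y; one more independent of them would
    exceed [bound]. *)
Let kernel_sub_C : \forall y \near y0, forall z, ball z0 d z -> f z = y ->
  forall b : 'rV[R]_n, b *m (fu z)^T = 0 -> (b <= C y)%MS.
Proof.
have fC0 : row_free (C y0) by rewrite C0.
have fC := near_row_free sC fC0.
have [go fo] := (near_forall goodsg, near_forall fsg).
near=> y => z bz fz b bfu.
have gy : forall i, good (sg i y) by exact: (near go y).
have fy : forall i, f (sg i y) = y by exact: (near fo y).
have fCy : row_free (C y) by exact: (near fC y).
apply: contraT => bC; suff : (r + 1 <= r)%N by rewrite addn1 ltnn.
apply: (@bound y _ (fun i => match fintype.split i with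
      inl j => sg j y | inr _ => z end) (col_mx (C y) b)).
split; first exact: row_free_col_mx.
move=> i; case: (fintype.splitP i) => j ij; last first.
  have -> : i = rshift r j by exact: val_inj.
  by rewrite rowKd ord1 row_id.
have -> : i = lshift 1 j by exact: val_inj.
have [bj _ _ [_ fh _]] := gy j; rewrite rowKu; split; [exact: bj|exact: fy|].
rewrite rowK -mulmxA -trmx_mul.
have -> : row_mx (xi j y) y = w (sg j y) by rewrite /w fy.
by rewrite fh trmx0 mulmx0.
Unshelve. all: by end_near. Qed.

Let fC0 : row_free (C y0).
Proof. by rewrite C0. Qed.

Section Frame.
Variables (q : nat) (S : 'M[R]_(n, q)) (D : 'rV[R]_n -> 'M[R]_(r + q, n)).
Hypothesis rq : (r + q = n)%N.
Hypothesis sD : smooth_near y0 D.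
Hypothesis DC : \forall y \near y0, D y *m row_mx (C y)^T S = 1%:M.
Local Notation W y := (dsubmx (D y)).

Let WCS : \forall y \near y0, W y *m (C y)^T = 0 /\ W y *m S = 1%:M.
Proof.
near=> y; have : D y *m row_mx (C y)^T S = 1%:M by exact: (near DC y).
rewrite -{1}[D y]vsubmxK mul_col_row scalar_mx_block.
by case/eq_block_mx.
Unshelve. all: by end_near. Qed.

Let W_sub : \forall y \near y0, forall z, ball z0 d z -> f z = y ->
  (W y <= fu z)%MS.
Proof.
have [H1 H2] := (WCS, kernel_sub_C); near=> y => z bz fz.
have [WC _] : W y *m (C y)^T = 0 /\ W y *m S = 1%:M by exact: (near H1 y).
apply: submx_kernel_dual WC => b; move: bz fz b; move: z; exact: (near H2 y).
Unshelve. all: by end_near. Qed.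

(* [W hy] vanishes on the graph [v = w (Z v)], which lies at distance at most
   [|h v|] from v. *)
Let W_hy_bound i : exists L : R, 0 <= L /\
  \forall v \near row_mx (xi i y0) y0, `|W (rsubmx v) *m hy v| <= L * `|h v|.
Proof.
rewrite xi0; pose E v := W (rsubmx v) *m hy v.
have sh' := shzs i.
have wr : rsubmx (w (zs i)) = y0 by rewrite /w row_mxKr fzs.
have sE : smooth_near (w (zs i)) E.
  apply: smooth_near_mulmx; last exact: smooth_near_dsubmx (smooth_near_jacobian sh').
  apply: smooth_near_dsubmx; apply: smooth_near_comp.
    exact: smooth_near_rsubmx (smooth_near_id _).
  by rewrite wr.
have [L [e [L0 e0 Le]]] := smooth_near_lipschitz sE; exists L; split=> //.
have sZ := sZzs i; have [_ sfZ _ _] := nbhs_singleton (goodZ i).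
have swZ : smooth_near (w (zs i)) (fun v => w (Z v)) by exact: smooth_near_comp sZ (sw sfZ).
have wZ : w (Z (w (zs i))) = w (zs i).
  by rewrite {1}/w (nbhs_singleton (lZzs i)) fZzs /w row_mxKl.
have b1 : \forall v \near w (zs i), ball (w (zs i)) e v by exact: nbhsx_ballx.
have b2 : \forall v \near w (zs i), ball (w (zs i)) e (w (Z v)).
  apply: (near_comp swZ (P := ball (w (zs i)) e)); rewrite wZ; exact: nbhsx_ballx.
have E0 : \forall z \near Z (w (zs i)), E (w z) = 0.
  have H : \forall z \near Z (w (zs i)), forall z', ball z0 d z' -> f z' = f z ->
      (W (f z) <= fu z')%MS.
    apply: (near_comp sfZ (P := fun y => forall z', ball z0 d z' -> f z' = y ->
      (W y <= fu z')%MS)).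
    by rewrite fZzs fzs.
  have go := goodZ i; near=> z.
  have [bz _ _ [_ fh _]] : good z by exact: (near go z).
  have Hz : forall z', ball z0 d z' -> f z' = f z -> (W (f z) <= fu z')%MS.
    exact: (near H z).
  rewrite /E {1}/w row_mxKr; have /submxP[X ->] := Hz z bz erefl.
  by rewrite -mulmxA fh mulmx0.
have EZ : \forall v \near w (zs i), E (w (Z v)) = 0.
  exact: (near_comp sZ (P := fun z => E (w z) = 0)).
have lZ := lZzs i; near=> v.
have lv : lsubmx (Z v) = lsubmx v by exact: (near lZ v).
have Ev : E (w (Z v)) = 0 by exact: (near EZ v).
have bv1 : ball (w (zs i)) e v by exact: (near b1 v).
have bv2 : ball (w (zs i)) e (w (Z v)) by exact: (near b2 v).
have := Le _ _ bv1 bv2; rewrite Ev subr0 => /le_trans; apply.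
rewrite ler_wpM2l //.
have -> : v - w (Z v) = row_mx 0 (h v).
  by rewrite -{1}[v]hsubmxK /w lv opp_row_mx add_row_mx subrr.
apply: mxnorm_le => // a j; rewrite mxE; case: fintype.splitP => k _.
  by rewrite mxE normr0.
exact: ler_mxnorm_entry.
Unshelve. all: by end_near. Qed.

Lemma frame_straightening : exists (psi : 'rV[R]_n -> 'rV[R]_r)
    (N : 'rV[R]_n -> 'M[R]_(q, n)),
  [/\ smooth_near y0 psi, \rank (row_mx ('J psi y0) S) = n,
    \forall y \near y0, N y *m S = 1%:M /\ N y *m 'J psi y = 0 &
    \forall z \near z0, (N (f z) <= fu z)%MS].
Proof.
have [psi [spsi rpsi Wpsi]] :=
  straightening rq sxi shxi hxi alh sD DC C0 W_hy_bound.
exists psi, (fun y => W y); split=> //.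
  have H := WCS; near=> y; split; last exact: (near Wpsi y).
  have [] // : W y *m (C y)^T = 0 /\ W y *m S = 1%:M by exact: (near H y).
have H : \forall z \near z0, forall z', ball z0 d z' -> f z' = f z ->
    (W (f z) <= fu z')%MS.
  exact: (near_comp sf (P := fun y => forall z', ball z0 d z' -> f z' = y ->
    (W y <= fu z')%MS)).
have b0 : \forall z \near z0, ball z0 d z by exact: nbhsx_ballx.
near=> z; have Hz : forall z', ball z0 d z' -> f z' = f z -> (W (f z) <= fu z')%MS.
  exact: (near H z).
by apply: Hz => //; exact: (near b0 z).
Unshelve. all: by end_near. Qed.

End Frame.

Lemma section_straightening : exists q (S : 'M[R]_(n, q))
    (psi : 'rV[R]_n -> 'rV[R]_r) (N : 'rV[R]_n -> 'M[R]_(q, n)),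
  [/\ (r + q = n)%N, smooth_near y0 psi, \rank (row_mx ('J psi y0) S) = n,
    \forall y \near y0, N y *m S = 1%:M /\ N y *m 'J psi y = 0 &
    \forall z \near z0, (N (f z) <= fu z)%MS].
Proof.
have [q [S [D [rq sD DC]]]] := dual_frame sC fC0; exists q, S.
have [psi [N [H1 H2 H3 H4]]] := frame_straightening rq sD DC.
by exists psi, N.
Qed.

End Sections.

Lemma family_straightening : exists q (S : 'M[R]_(n, q))
    (psi : 'rV[R]_n -> 'rV[R]_r) (N : 'rV[R]_n -> 'M[R]_(q, n)),
  [/\ (r + q = n)%N, smooth_near y0 psi, \rank (row_mx ('J psi y0) S) = n,
    \forall y \near y0, N y *m S = 1%:M /\ N y *m 'J psi y = 0 &
    \forall z \near z0, (N (f z) <= fu z)%MS].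
Proof.
have /all_sig[sg Hsg] : forall i, {s : 'rV[R]_n -> 'rV[R]_(n + m) |
    [/\ smooth_near y0 s, s y0 = zs i & \forall y \near y0, f (s y) = y]}.
  move=> i; apply: cid; have [_ sfi rJi _] := nbhs_singleton (goodzs i).
  by have := local_section sfi rJi; rewrite fzs.
apply: (@section_straightening sg) => i; by have [] := Hsg i.
Qed.

End Family.

Lemma kernel_straightening : exists q (S : 'M[R]_(n, q))
    (psi : 'rV[R]_n -> 'rV[R]_r) (N : 'rV[R]_n -> 'M[R]_(q, n)),
  [/\ (r + q = n)%N, smooth_near (f z0) psi,
    \rank (row_mx ('J psi (f z0)) S) = n,
    \forall y \near f z0, N y *m S = 1%:M /\ N y *m 'J psi y = 0 &
    \forall z \near z0, (N (f z) <= fu z)%MS].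
Proof.
have [B [sB fB QB]] := next_plus_basis sf rJ dimQ.
have [d [d0 bnd]] := kernel_family_bound sf rJ rfu sB fB QB.
have [Z [sZ Zw0 lZ fZ]] := retraction sf rfu.
pose h (v : 'rV[R]_(n + n)) := rsubmx v - f (Z v).
have sh : smooth_near (w z0) h := retraction_equation_smooth sf sZ Zw0.
have hE := retraction_equation sf rfu sZ Zw0 lZ fZ.
pose good z := [/\ ball z0 d z, smooth_near z f, \rank ('J f z) = n &
  [/\ h (w z) = 0, fu z *m dsubmx ('J h (w z)) = 0 &
    forall b : 'rV[R]_n, b *m (fu z)^T = 0 ->
      b *m (dsubmx ('J h (w z)))^T = b]].
have ng : \forall z \near z0, good z.
  have b0 : \forall z \near z0, ball z0 d z by exact: nbhsx_ballx.
  have sfo := smooth_near_open sf; have rJo := near_rank (smooth_near_jacobian sf) rJ.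
  near=> z; split; [exact: (near b0 z)|exact: (near sfo z)|exact: (near rJo z)|].
  exact: (near hE z).
(* The points of the family are merely close to z0, so every local property at z0 is first spread to
   a neighborhood, from which the family is then drawn. *)
pose fine z := [/\ \forall z' \near z, good z', \forall z' \near Z (w z), good z',
  smooth_near (w z) h, smooth_near (w z) Z &
  (\forall v \near w z, lsubmx (Z v) = lsubmx v) /\ f (Z (w z)) = f z].
have nf : \forall z \near z0, fine z.
  have ngo := near_join ng.
  have ngZ : \forall z \near z0, \forall z' \near Z (w z), good z'.
    have H : \forall z \near Z (w z0), \forall z' \near z, good z' by rewrite Zw0.
    exact: (near_comp (smooth_near_comp (sw sf) sZ)
      (P := fun z => \forall z' \near z, good z')).
  have sho := near_comp (sw sf) (smooth_near_open sh).
  have sZo := near_comp (sw sf) (smooth_near_open sZ).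
  have lZo := near_comp (sw sf) (near_join lZ).
  near=> z; split; [exact: (near ngo z)|exact: (near ngZ z)|exact: (near sho z)|
    exact: (near sZo z)|split; [exact: (near lZo z)|exact: (near fZ z)]].
have [k [zs [al [rk [fal Hzs]]]]] :=
  kernel_family_exists sf rJ sB fB QB nf.
have kr : k = r.
  apply/eqP; rewrite eqn_leq rk andbT; apply: (bnd (f z0) k zs al).
  split=> // i; have [[/nbhs_singleton[bi _ _ _] _ _ _ _] fi ai] := Hzs i.
  by split.
subst k.
apply: (@family_straightening d Z zs al) => // i;
  by have [[? ? ? ? [? ?]] ? ?] := Hzs i.
Unshelve. all: by end_near. Qed.

End KernelStraightening.

(** * Triangular form *)

Section Sufficiency.
Context {R : realType}.

Lemma rank_row_mxC p a b (A : 'M[R]_(p, a)) (B : 'M[R]_(p, b)) :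
  \rank (row_mx A B) = \rank (row_mx B A).
Proof.
by rewrite -mxrank_tr -[RHS]mxrank_tr !tr_row_mx -!addsmxE addsmxC.
Qed.

Lemma rank_row_mxA p a b c (A : 'M[R]_(p, a)) (B : 'M[R]_(p, b)) (C : 'M[R]_(p, c)) :
  \rank (row_mx A (row_mx B C)) = \rank (row_mx (row_mx A B) C).
Proof.
rewrite -mxrank_tr -[RHS]mxrank_tr !tr_row_mx -!addsmxE.
rewrite -(adds_eqmx (eqmx_refl _) (addsmxE _ _)).
by rewrite -(adds_eqmx (addsmxE _ _) (eqmx_refl _)) addsmxA.
Qed.

Lemma rank_row_mxr p a b (A : 'M[R]_(p, a)) (B : 'M[R]_(p, b)) :
  \rank (row_mx A B) = (a + b)%N -> \rank B = b.
Proof.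
rewrite -mxrank_tr tr_row_mx -addsmxE => rAB; apply/eqP.
rewrite eqn_leq rank_leq_col -(leq_add2l a) -rAB.
rewrite (leq_trans (mxrank_adds_leqif _ _)) // !mxrank_tr leq_add2r.
exact: rank_leq_col.
Qed.

Lemma dsubmx_row_mx p1 p2 a b (A : 'M[R]_(p1 + p2, a)) (B : 'M[R]_(p1 + p2, b)) :
  dsubmx (row_mx A B) = row_mx (dsubmx A) (dsubmx B).
Proof. by rewrite -{1}[A]vsubmxK -{1}[B]vsubmxK -block_mxEh block_mxEv col_mxKd. Qed.

(** The new columns form a basis of a complement of the column space of X in the sum, taken inside
    the column space of Y. *)
Lemma select_cols p a b (X : 'M[R]_(p, a)) (Y : 'M[R]_(p, b)) :
  exists k (A : 'M[R]_(b, k)), \rank (row_mx X (Y *m A)) = \rank (row_mx X Y) /\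
    \rank (row_mx X Y) = (\rank X + k)%N.
Proof.
pose D := row_base (Y^T :\: X^T)%MS.
have /submxP[U EU] : (D <= Y^T)%MS by rewrite eq_row_base diffmxSl.
have DX : (X^T + Y^T :=: X^T + D)%MS.
  apply/eqmxP; rewrite !addsmx_sub !addsmxSl /=; apply/andP; split; last first.
    by rewrite (submx_trans _ (addsmxSr _ _)) // eq_row_base diffmxSl.
  rewrite -(addsmx_diff_cap_eq Y^T X^T) addsmx_sub; apply/andP; split.
    by rewrite (submx_trans _ (addsmxSr _ _)) // eq_row_base.
  by rewrite (submx_trans _ (addsmxSl _ _)) // capmxSr.
have r1 : \rank (row_mx X Y) = \rank (X^T + D)%MS.
  by rewrite -mxrank_tr tr_row_mx -addsmxE DX.
exists (\rank (Y^T :\: X^T)%MS), U^T; rewrite r1; split.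
  by rewrite -mxrank_tr tr_row_mx trmx_mul trmxK -EU -addsmxE.
have -> : \rank (X^T + D)%MS = \rank ((Y^T :\: X^T) + X^T)%MS.
  by rewrite (adds_eqmx (eqmx_refl _) (eq_row_base _)) addsmxC.
by rewrite mxrank_disjoint_sum ?capmx_diff // mxrank_tr addnC.
Qed.

Variables (n m : nat) (f : 'rV[R]_(n + m) -> 'rV[R]_n).
Variables (x0 : 'rV[R]_n) (u0 : 'rV[R]_m).
Let z0 : 'rV[R]_(n + m) := row_mx x0 u0.
Local Notation fu z := (dsubmx ('J f z)).

Lemma input_transformation_rank m' (Phiu : 'rV[R]_(n + m) -> 'rV[R]_m') :
  m' = m -> smooth_near z0 Phiu -> \rank (dsubmx ('J Phiu z0)) = m' ->
  input_transformation x0 u0 Phiu.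
Proof.
move=> E; subst m' => sPhi rPhi; split; first exact: sPhi.
pose c (z : 'rV[R]_(n + m)) := row_mx (lsubmx z) (Phiu z).
have sc : smooth_near z0 c.
  exact: smooth_near_row_mx (smooth_near_lsubmx (smooth_near_id _)) sPhi.
have [_ [Psi [sPsi PsiK cK]]] :=
  local_diffeo_rank erefl sc (rank_lsub_row_mx sPhi rPhi).
have cz0 : c z0 = row_mx x0 (Phiu z0) by rewrite /c /z0 row_mxKl.
rewrite cz0 in sPsi cK.
exists (fun v => rsubmx (Psi v)); split.
- exact: smooth_near_rsubmx.
- near=> z; congr rsubmx; exact: (near PsiK z).
- near=> v; have : c (Psi v) = v by exact: (near cK v).
  rewrite -{2}[v]hsubmxK => /eq_row_mx[E1 E2].
  by rewrite -E1 hsubmxK E2.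
Unshelve. all: by end_near. Qed.

Hypothesis sf : smooth_near z0 f.
Hypothesis fz0 : f z0 = x0.
Variable rho : nat.
Hypothesis rfu : \forall z \near z0, \rank (fu z) = rho.
Variables (r q : nat) (S : 'M[R]_(n, q)) (psi : 'rV[R]_n -> 'rV[R]_r).
Variable N : 'rV[R]_n -> 'M[R]_(q, n).
Hypothesis rq : (r + q = n)%N.
Hypothesis spsi : smooth_near (f z0) psi.
Hypothesis rpsi : \rank (row_mx ('J psi (f z0)) S) = n.
Hypothesis NS : \forall y \near f z0, N y *m S = 1%:M /\ N y *m 'J psi y = 0.
Hypothesis Nfu : \forall z \near z0, (N (f z) <= fu z)%MS.

Let sfu : smooth_near z0 (fun z => fu z).
Proof. exact: smooth_near_dsubmx (smooth_near_jacobian sf). Qed.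

Let spsif : smooth_near z0 (fun z => psi (f z)).
Proof. exact: smooth_near_comp sf spsi. Qed.

(** N S = 1 with N in the row space of f_u: the component f S of x^+ is submersive in u. *)
Let rfuS : \rank (fu z0 *m S) = q.
Proof.
have [NS0 _] := nbhs_singleton NS; have /submxP[X EX] := nbhs_singleton Nfu.
apply/eqP; rewrite eqn_leq rank_leq_col -{1}(mxrank1 R q) -NS0 EX -mulmxA.
exact: mxrankM_maxr.
Qed.

Let dsubJ p (g : 'rV[R]_n -> 'rV[R]_p) z : smooth_near z f ->
  smooth_near (f z) g -> dsubmx ('J (fun z => g (f z)) z) = fu z *m 'J g (f z).
Proof.
move=> sfz sg.
by rewrite (jacobian_comp (smooth_near_diff sfz) (smooth_near_diff sg)) mul_dsub_mx.
Qed.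

Section Inputs.
Variables (k l : nat) (A : 'M[R]_(r, k)) (L : 'M[R]_(m, l)).
Hypothesis rho_qk : rho = (q + k)%N.
Hypothesis rA : \rank (row_mx (fu z0 *m S) (fu z0 *m 'J psi (f z0) *m A)) = rho.
Hypothesis qkl : (q + k + l = m)%N.
Hypothesis rL : \rank (row_mx (row_mx (fu z0 *m S)
  (fu z0 *m 'J psi (f z0) *m A)) L) = m.

(** A selects components of psi(f) that are independent, as functions of u, of each other and of f
    S; L fills up with old inputs. Taking f S itself as ubar_1 in [Phiu] makes f_1 a projection. *)
Let ub2 (z : 'rV[R]_(n + m)) := row_mx (psi (f z) *m A) (rsubmx z *m L).
Let Phiu (z : 'rV[R]_(n + m)) := row_mx (f z *m S) (ub2 z).

Let srL z : smooth_near z (fun z : 'rV[R]_(n + m) => rsubmx z *m L).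
Proof. exact: smooth_near_mulmxr (smooth_near_rsubmx (smooth_near_id _)). Qed.

Let sub2 : smooth_near z0 ub2.
Proof. exact: smooth_near_row_mx (smooth_near_mulmxr _ spsif) (srL _). Qed.

Let sPhiu : smooth_near z0 Phiu.
Proof. exact: smooth_near_row_mx (smooth_near_mulmxr _ sf) sub2. Qed.

Let dsubJub2 z : smooth_near z f -> smooth_near (f z) psi ->
  dsubmx ('J ub2 z) = row_mx (fu z *m 'J psi (f z) *m A) L.
Proof.
move=> sfz spz; have spf := smooth_near_comp sfz spz.
rewrite (jacobian_row_mx (smooth_near_mulmxr A spf) (srL z)).
have -> : 'J (fun z => psi (f z) *m A) z = 'J (fun z => psi (f z)) z *m A.
  apply: jacobianE => [|v]; first exact: smooth_near_diff (smooth_near_mulmxr _ spf).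
  rewrite (derive_mulmxr _ v (smooth_near_diff spf)).
  by rewrite (deriveEjacobian v (smooth_near_diff spf)) mulmxA.
have -> : 'J (fun z : 'rV[R]_(n + m) => rsubmx z *m L) z = col_mx 0 L.
  have -> : (fun z : 'rV[R]_(n + m) => rsubmx z *m L) = fun z => z *m col_mx 0 L.
    by apply/funext => v; rewrite -{2}[v]hsubmxK mul_row_col mulmx0 add0r.
  exact: jacobian_mulr.
by rewrite dsubmx_row_mx col_mxKd -mul_dsub_mx dsubJ.
Qed.

Let dsubJPhiu : dsubmx ('J Phiu z0) =
  row_mx (fu z0 *m S) (row_mx (fu z0 *m 'J psi (f z0) *m A) L).
Proof.
have sfS := smooth_near_mulmxr S sf.
rewrite (jacobian_row_mx sfS sub2).
rewrite dsubmx_row_mx (dsubJub2 sf spsi).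
by rewrite (dsubJ sf (smooth_near_mulr S _)) jacobian_mulr.
Qed.

Let rPhiu : \rank (dsubmx ('J Phiu z0)) = (q + (k + l))%N.
Proof. by rewrite dsubJPhiu rank_row_mxA rL addnA. Qed.

Let rub2 : \rank (dsubmx ('J ub2 z0)) = (k + l)%N.
Proof.
by move: rPhiu; rewrite dsubJPhiu (dsubJub2 sf spsi) => /rank_row_mxr.
Qed.

(** Let u be killed by ubar_2. With N = X f_u, subtracting u f_u S X from u removes the S component
    of u f_u and, since N psi' = 0, leaves its psi' component. The corrected vector is killed by f_u
    (S, psi' A), whose rank is that of f_u, hence by f_u itself. *)
Let ub2_kernel : \forall z \near z0, forall u : 'rV[R]_m,
  u *m dsubmx ('J ub2 z) = 0 -> u *m dsubmx ('J (fun z => psi (f z)) z) = 0.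
Proof.
pose T z := row_mx S ('J psi (f z) *m A).
have sJp : smooth_near z0 (fun z => 'J psi (f z)).
  exact: smooth_near_comp sf (smooth_near_jacobian spsi).
have sfT : smooth_near z0 (fun z => fu z *m T z).
  apply: smooth_near_mulmx sfu _.
  exact: smooth_near_row_mx (smooth_near_cst _ _) (smooth_near_mulmxr A sJp).
have rT : \forall z \near z0, \rank (fu z *m T z) = (q + k)%N.
  by apply: near_rank sfT _; rewrite /T mul_mx_row mulmxA rA.
have sfo := smooth_near_open sf; have spo := near_comp sf (smooth_near_open spsi).
have NSo := near_comp sf NS.
near=> z => u.
have sfz : smooth_near z f by exact: (near sfo z).
have spz : smooth_near (f z) psi by exact: (near spo z).
have [NSz Nz] : N (f z) *m S = 1%:M /\ N (f z) *m 'J psi (f z) = 0.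
  exact: (near NSo z).
have rTz : \rank (fu z *m T z) = (q + k)%N by exact: (near rT z).
have rfz : \rank (fu z) = rho by exact: (near rfu z).
have /submxP[X EX] : (N (f z) <= fu z)%MS by exact: (near Nfu z).
rewrite (dsubJub2 sfz spz) (dsubJ sfz spz) mul_mx_row -row_mx0.
move=> /eq_row_mx[uA _]; pose u' := u - u *m fu z *m S *m X.
have u'J : u' *m fu z *m 'J psi (f z) = u *m fu z *m 'J psi (f z).
  by rewrite /u' !mulmxBl -[_ *m X *m fu z]mulmxA -EX -[_ *m N _ *m _]mulmxA Nz mulmx0 subr0.
have u'T : u' *m fu z *m T z = 0.
  rewrite /T mul_mx_row mulmxA u'J; apply/eqP; rewrite -row_mx0; apply/eqP; congr row_mx.
    rewrite /u' !mulmxBl -[_ *m X *m fu z]mulmxA -EX -[_ *m N _ *m _]mulmxA NSz.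
    by rewrite mulmx1 subrr.
  by move: uA; rewrite !mulmxA.
have u'0 : u' *m fu z = 0.
  by apply: rank_mul_kernel u'T; rewrite rTz rfz rho_qk.
by rewrite mulmxA -u'J u'0 mul0mx.
Unshelve. all: by end_near. Qed.

Lemma triangular_form_of_inputs : (1 <= q)%N -> transformable_to_triangular_form f x0 u0.
Proof.
move=> q1; pose Phix (x : 'rV[R]_n) := row_mx (x *m S) (psi x).
have spx : smooth_near x0 psi by rewrite -fz0.
have sPhix : smooth_near x0 Phix := smooth_near_row_mx (smooth_near_mulr _ _) spx.
have dPhix : local_diffeo x0 Phix.
  apply: local_diffeo_rank sPhix _; first by rewrite addnC.
  rewrite (jacobian_row_mx (smooth_near_mulr _ _) spx) jacobian_mulr.
  by rewrite rank_row_mxC -fz0.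
have [_ [Psix [sPsix PsixK _]]] := dPhix.
have [s [ss sz cs hs]] := partial_factor sub2 rub2 spsif ub2_kernel.
(* [arg2] lists xbar_2 before xbar_1 while [Phix] lists xbar_1 = x S first, so the blocks are
   swapped before [Psix] recovers x. *)
pose X (v : 'rV[R]_(r + q + (k + l))) :=
  Psix (row_mx (rsubmx (lsubmx v)) (lsubmx (lsubmx v))).
(* psi (f z) depends on x and ubar_2 only, so it can be evaluated at the representative given by
   [s]. *)
pose f2 v := psi (f (s (row_mx (X v) (rsubmx v)))).
pose f1 (v : 'rV[R]_(r + q + (k + l) + q)) := rsubmx v.
exists q, r, q, (k + l)%N, Phix, Phiu, f2, f1 => xb1 xb2 ub1 ub2' arg2 arg1.
have lz0 : lsubmx z0 = x0 by rewrite /z0 row_mxKl.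
have Xarg z : X (arg2 z) = Psix (Phix (lsubmx z)).
  by rewrite /X /arg2 !row_mxKl !row_mxKr /xb1 /xb2 hsubmxK.
have Xz0 : X (arg2 z0) = x0 by rewrite Xarg lz0 (nbhs_singleton PsixK).
have ub2E z : ub2' z = ub2 z by rewrite /ub2' /Phiu row_mxKr.
split=> //.
- by split=> //; [rewrite addnC|rewrite addnA].
- split=> //; apply: input_transformation_rank => //; by rewrite addnA.
- split; last exact: smooth_near_rsubmx (smooth_near_id _).
  have sX : smooth_near (arg2 z0) X.
    have sl := smooth_near_lsubmx (smooth_near_id (arg2 z0)).
    apply: smooth_near_comp.
      exact: smooth_near_row_mx (smooth_near_rsubmx sl) (smooth_near_lsubmx sl).
    by rewrite /arg2 !row_mxKl !row_mxKr /xb1 /xb2 hsubmxK lz0.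
  have sXr := smooth_near_row_mx sX (smooth_near_rsubmx (smooth_near_id (arg2 z0))).
  have Xrz0 : row_mx (X (arg2 z0)) (rsubmx (arg2 z0)) = row_mx (lsubmx z0) (ub2 z0).
    by rewrite Xz0 lz0 /arg2 row_mxKr ub2E.
  rewrite -Xrz0 in ss sz.
  have sS := smooth_near_comp sXr ss.
  have spf : smooth_near (s (row_mx (X (arg2 z0)) (rsubmx (arg2 z0))))
    (fun z => psi (f z)) by rewrite sz.
  exact: smooth_near_comp sS spf.
- have PsixK' : \forall z \near z0, Psix (Phix (lsubmx z)) = lsubmx z.
    apply: (near_comp (smooth_near_lsubmx (smooth_near_id z0))
      (P := fun x => Psix (Phix x) = x)).
    by rewrite lz0.
  near=> z; rewrite /Phix row_mxKl row_mxKr; split; last first.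
    by rewrite /f1 /arg1 row_mxKr /ub1 /Phiu row_mxKl.
  have Pz : Psix (Phix (lsubmx z)) = lsubmx z by exact: (near PsixK' z).
  have hz : psi (f (s (row_mx (lsubmx z) (ub2 z)))) = psi (f z) by exact: (near hs z).
  by rewrite /f2 Xarg Pz /arg2 row_mxKr ub2E hz.
- near=> p; rewrite /f1.
  under eq_fun do rewrite rsubmx_mul.
  by rewrite jacobian_mulr col_mxKd mxrank1.
Unshelve. all: by end_near. Qed.

End Inputs.

Lemma triangular_form_of_straightening : (1 <= q)%N ->
  transformable_to_triangular_form f x0 u0.
Proof.
move=> q1.
have rJS : \rank (row_mx (fu z0 *m S) (fu z0 *m 'J psi (f z0))) = rho.
  rewrite -mul_mx_row mxrankMfree ?(nbhs_singleton rfu) //.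
  by rewrite /row_free rank_row_mxC rpsi.
have [k [A [rA rk]]] := select_cols (fu z0 *m S) (fu z0 *m 'J psi (f z0)).
rewrite rJS rfuS in rA rk.
have rA' := rA; rewrite rk in rA'.
have [l [L [ql rL]]] := complete_cols rA'.
exact: triangular_form_of_inputs rk rA ql rL q1.
Qed.

End Sufficiency.

(** * Dimensions of the codistributions and the equivalence *)

Section Dimensions.
Context {R : realType} (n m : nat) (f : 'rV[R]_(n + m) -> 'rV[R]_n)
  (z0 : 'rV[R]_(n + m)).
Local Notation fu z := (dsubmx ('J f z)).
Local Notation Q := (next_plus f z0 (@span_dx R n m z0)).

Lemma dim_span_dx d : has_dim z0 (@span_dx R n m z0) d -> d = n.
Proof.
move=> /has_dimP[M [sM fM MX]].
have fX : row_free (row_mx 1%:M 0 : 'M[R]_(n, n + m)).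
  by rewrite /row_free rank_row_mx0 mxrank1.
rewrite span_dxE in MX; apply/eqP; rewrite eqn_leq; apply/andP; split.
  have := pointwise_span_dim sM fM (M' := fun=> row_mx 1%:M 0 : 'M[R]_(n, n + m)).
  rewrite -MX => /(_ (@subset_refl _ _))/mxrankS; rewrite (eqP fM) => /leq_trans.
  by apply; exact: rank_leq_row.
have := pointwise_span_dim (smooth_near_cst z0 _) fX (M' := M).
rewrite MX => /(_ (@subset_refl _ _))/mxrankS; rewrite (eqP fX) => /leq_trans.
by apply; exact: rank_leq_row.
Qed.

(** The sum of the two row spaces is the direct sum of span{dx} and the du part Y; the dimension
    formula then gives the intersection. *)
Lemma rank_dx_df (X : 'M[R]_n) (Y : 'M[R]_(n, m)) :
  (\rank (row_mx 1%:M 0 :&: row_mx X Y : 'M[R]_(n + m))%MS + \rank Y =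
   \rank (row_mx X Y))%N.
Proof.
set A := row_mx 1%:M 0; pose B : 'M[R]_(n, n + m) := row_mx 0 Y.
have rA : \rank A = n by rewrite rank_row_mx0 mxrank1.
have XA : (row_mx X 0 <= A)%MS.
  by apply/submxP; exists X; rewrite mul_mx_row mulmx1 mulmx0.
have XYE : row_mx X Y = row_mx X 0 + B by rewrite add_row_mx addr0 add0r.
have AB : (A :&: B)%MS = 0.
  apply/eqP; rewrite -submx0; apply/rV_subP => v; rewrite sub_capmx submx0.
  move=> /andP[/submxP[a ->] /submxP[b]]; rewrite !mul_mx_row !mulmx0.
  by move=> /eq_row_mx[-> _]; rewrite row_mx0.
have := mxrank_sum_cap A (row_mx X Y).
rewrite {1}XYE (addsmx_addKl _ XA) mxrank_disjoint_sum // rA rank_row_0mx -addnA.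
by move=> /addnI <-; rewrite addnC.
Qed.

Hypothesis sf : smooth_near z0 f.

(** The fibers of span{dx} and span{df} meet in dimension n minus the rank of f_u. *)
Lemma input_rank_constant : \rank ('J f z0) = n ->
  locally_constant_dim_dx_cap_df f z0 ->
  \forall z \near z0, \rank (fu z) = \rank (fu z0).
Proof.
move=> rJ; rewrite /locally_constant_dim_dx_cap_df => cap.
have dfE := df_matrix sf; have rJo := near_rank (smooth_near_jacobian sf) rJ.
have capE z : \matrix_(i < n) df f i z = ('J f z)^T -> \rank ('J f z) = n ->
    (\rank (\matrix_(i < n) @dx R n m i z :&: \matrix_(i < n) df f i z)%MS +
     \rank (fu z) = n)%N.
  move=> -> rz; rewrite dx_matrix -{1}['J f z]vsubmxK tr_col_mx.
  by rewrite -(mxrank_tr (fu z)) rank_dx_df -tr_col_mx vsubmxK mxrank_tr.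
have E0 := capE z0 (nbhs_singleton dfE) rJ.
near=> z.
have Ez : \matrix_(i < n) df f i z = ('J f z)^T by exact: (near dfE z).
have rz : \rank ('J f z) = n by exact: (near rJo z).
have cz : \rank (\matrix_(i < n) @dx R n m i z :&: \matrix_(i < n) df f i z)%MS =
  \rank (\matrix_(i < n) @dx R n m i z0 :&: \matrix_(i < n) df f i z0)%MS.
  exact: (near cap z).
have E := capE z Ez rz; rewrite cz in E.
exact: addnI (etrans E (esym E0)).
Unshelve. all: by end_near. Qed.

Hypothesis rJ : \rank ('J f z0) = n.
(** If P_2^+ has dimension n it is all of span{df}. Each df^i is the pullback of a constant form, so
    every dx^i lies in P_2. *)
Lemma backward_shift_full d : has_dim z0 Q n -> has_dim z0 (codist_seq f z0 1) d ->
  (n <= d)%N.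
Proof.
move=> dQ /has_dimP[M [_ _ P2M]].
have [B [sB fB QB]] := next_plus_basis sf rJ dQ.
have fBo := near_row_free sB fB; have sfo := smooth_near_open sf.
have dxM i : (row i (row_mx 1%:M 0 : 'M[R]_(n, n + m)) <= M z0)%MS.
  pose c : 'rV[R]_n := delta_mx 0 i; pose w (y : 'rV[R]_n) := c.
  have sw y : smooth_near y w by exact: smooth_near_cst.
  have cJ : \forall z \near z0, c *m ('J f z)^T = pullback f w z.
    near=> z; have sfz : smooth_near z f by exact: (near sfo z).
    by rewrite (pullbackE _ (smooth_near_diff sfz)).
  have Qw : Q (pullback f w).
    rewrite QB; split.
      apply: smooth_near_eq cJ _.
      apply: smooth_near_mulmx (smooth_near_cst _ _) _.
      exact: smooth_near_tr (smooth_near_jacobian sf).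
    near=> z; have <- : c *m ('J f z)^T = pullback f w z by exact: (near cJ z).
    have fBz : row_free (B z) by exact: (near fBo z).
    by apply: submxMr; apply: submx_full; rewrite row_full_unit -row_free_unit.
  have : codist_seq f z0 1 (pullback (fun z : 'rV[R]_(n + m) => lsubmx z) w).
    by move=> P [_ HP]; apply: HP; exists w.
  rewrite P2M => -[_ /nbhs_singleton]; rewrite pullback_lsubmx.
  by rewrite rowE mul_mx_row mulmx1 mulmx0.
have /row_subP/mxrankS := dxM.
by rewrite rank_row_mx0 mxrank1 => /leq_trans; apply; exact: rank_leq_row.
Unshelve. all: by end_near. Qed.

End Dimensions.

Theorem theorem20 (R : realType) (n m : nat)
    (f : 'rV[R]_(n + m) -> 'rV[R]_n) (x0 : 'rV[R]_n) (u0 : 'rV[R]_m)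
    (z0 := row_mx x0 u0)
    (P1 := codist_seq f z0 0) (P2 := codist_seq f z0 1)
    (f_smooth : smooth_near z0 f)
    (f_equilibrium : f z0 = x0)
    (f_rank : \forall z \near z0, \rank ('J f z) = n)
    (dim_cap : locally_constant_dim_dx_cap_df f z0)
    (dim_P2plus : exists r, has_dim z0 (next_plus f z0 P1) r)
    (dim1 dim2 : nat)
    (dim_P1 : has_dim z0 P1 dim1) (dim_P2 : has_dim z0 P2 dim2) :
  transformable_to_triangular_form f x0 u0 <-> (dim2 < dim1)%N.
Proof.
have rJ : \rank ('J f z0) = n := nbhs_singleton f_rank.
have fz0 : f z0 = lsubmx z0 by rewrite f_equilibrium row_mxKl.
rewrite (dim_span_dx dim_P1); split.
  move=> [n1 [n2 [m1 [m2 [Phix [Phiu [f2 [f1]]]]]]]].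
  move=> [[n12 _ n1_gt0] [dPhix tPhiu] [sf2 sf1] fE rf1].
  have tPhiu' : input_transformation (lsubmx z0) (rsubmx z0) Phiu.
    by rewrite row_mxKl row_mxKr.
  rewrite -f_equilibrium in dPhix.
  have [sG fG kG] :=
    triangular_form_kernel f_smooth fz0 dPhix tPhiu' sf2 sf1 fE rf1.
  have := backward_shift_dim f_smooth rJ fz0 sG fG kG dim_P2.
  (* The dimension of P_2 is at most n2, and n1 >= 1. *)
  by move=> /leq_ltn_trans; apply; rewrite -n12 -addn1 addnC leq_add2r.
move=> dim2n; have rfu := input_rank_constant f_smooth rJ dim_cap.
have [r dimQ] := dim_P2plus.
have [q [S [psi [N [rq spsi rpsi NS Nfu]]]]] :=
  kernel_straightening f_smooth rJ rfu dimQ.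
apply: (triangular_form_of_straightening f_smooth f_equilibrium rfu rq spsi rpsi NS Nfu).
(* q = 0 would mean r = n, and P_2 would have dimension at least n. *)
case: q S N rq rpsi NS Nfu => // S N rq rpsi NS Nfu.
rewrite addn0 in rq; rewrite rq in dimQ.
by have := backward_shift_full f_smooth rJ dimQ dim_P2; rewrite leqNgt dim2n.
Qed.
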